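(* Let $n\geq 3$ and let $\Omega\subset\mathbb{R}^n$ be an open set of finite positive Lebesgue measure $V=|\Omega|$. Let $\lambda_1\le\lambda_2\le\cdots$ be the Dirichlet eigenvalues of $-\Delta$ on $\Omega$, repeated according to multiplicity. Let $x_n$ be the unique solution in $(1,\infty)$ of $$(n-2)x^n-nx^{n-2}+\frac{8}{n+2}=0,$$ and define $$K_n=\frac{n x_n^{n-2}-2}{n-2},\qquad c_n=K_n^{-2/n}.$$ Then, for every integer $k\geq 1$, $$\lambda_k\geq c_n\,C_n\,V^{-2/n}\,k^{2/n},\qquad C_n=(2\pi)^2\omega_n^{-2/n}.$$ Moreover, the constant $c_n$ satisfies $$\frac{n}{n+2}<c_n<1.$$
   Context: $\omega_n=|B_1(0)|$ denotes the Lebesgue measure of the unit ball in $\mathbb{R}^n$. The Dirichlet eigenvalues $0<\lambda_1\le\lambda_2\le\cdots\nearrow\infty$ are those of the Dirichlet Laplacian on $\Omega$, understood weakly: there is an orthonormal basis $\{\phi_j\}_{j\ge1}$ of $L^2(\Omega)$ with $\phi_j\in H_0^1(\Omega)$ and $\int_\Omega\nabla\phi_j\cdot\nabla v\,dx=\lambda_j\int_\Omega\phi_j v\,dx$ for all $v\in H_0^1(\Omega)$. No regularity of the boundary or connectedness of $\Omega$ is assumed. *)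

(* Defs.v *)
From HB Require Import structures.
From mathcomp Require Import all_boot all_order all_algebra.
From mathcomp Require Import all_classical all_reals all_analysis.
From mathcomp Require Import measurable_realfun.
From mathcomp Require Import lra.
Set Implicit Arguments.
Unset Strict Implicit.
Unset Printing Implicit Defensive.
Import Order.TTheory GRing.Theory Num.Theory.
Import numFieldNormedType.Exports.
Local Open Scope classical_set_scope.
Local Open Scope ring_scope.

(* The Borel sigma-algebra of R^n, realised as 'rV[R]_n. *)
HB.instance Definition _ (R : realType) (n : nat) :=
  @isMeasurable.Build default_measure_display 'rV[R]_n
    <<s @open 'rV[R]_n >> (@sigma_algebra0 _ setT _)
    (@sigma_algebraC _ _) (@sigma_algebra_bigcup _ setT _).

Definition consrv (R : realType) (n : nat)
  (tx : measurableTypeR R * 'rV[R]_n) : 'rV[R]_n.+1 :=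
  row_mx (const_mx tx.1 : 'rV[R]_1) tx.2 : 'rV[R]_(1 + n).

Definition unconsrv (R : realType) (n : nat) (x : 'rV[R]_n.+1) :
  measurableTypeR R * 'rV[R]_n := (x ord0 ord0, \row_(j < n) x ord0 (lift ord0 j)).

Section borel_rV.
Variable R : realType.

Lemma open_measurable_rV n (U : set 'rV[R]_n) : open U -> measurable U.
Proof. exact: sub_sigma_algebra. Qed.

Lemma consrv0 n tx : @consrv R n tx ord0 ord0 = tx.1.
Proof.
rewrite /consrv mxE; case: splitP => [k _|k /=]; first by rewrite mxE.
by rewrite add1n.
Qed.

Lemma consrvS n tx j : @consrv R n tx ord0 (lift ord0 j) = tx.2 ord0 j.
Proof.
rewrite /consrv mxE; case: splitP => [[[]//]|k /= [jk]].
by congr (tx.2 _ _); exact/val_inj.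
Qed.

Lemma consrvK n : cancel (@consrv R n) (@unconsrv R n).
Proof.
move=> tx; rewrite /unconsrv consrv0 [RHS]surjective_pairing; congr pair.
by apply/rowP => j; rewrite mxE consrvS.
Qed.

Lemma unconsrvK n : cancel (@unconsrv R n) (@consrv R n).
Proof.
move=> x; apply/rowP => j; have [i ->|->] := unliftP ord0 j.
  by rewrite consrvS mxE.
by rewrite consrv0.
Qed.

Lemma open_rV_bigcup n (U : set 'rV[R]_n) : open U ->
  U = \bigcup_(p in [set p : 'rV[rat]_n * nat |
        ball (map_mx ratr p.1 : 'rV[R]_n) p.2.+1%:R^-1 `<=` U])
      ball (map_mx ratr p.1 : 'rV[R]_n) p.2.+1%:R^-1.
Proof.
move=> oU; apply/seteqP; split => [x Ux|x [p /= pU]]; last exact: pU.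
have /nbhs_ballP[e /= e0 xeU] : nbhs x U by exact: open_nbhs_nbhs.
have [k ke] : exists k : nat, k.+1%:R^-1 < e / 2.
  have e20 : 0 < e / 2 by rewrite divr_gt0.
  have [N _ /(_ N)/(_ (leqnn _)) ?] := near_infty_natSinv_lt (PosNum e20).
  by exists N.
have k0 : 0 < k.+1%:R^-1 :> R by rewrite invr_gt0.
have qE i : exists q : rat, ball (x ord0 i) k.+1%:R^-1 (ratr q : R).
  move: k0; set d := k.+1%:R^-1 => d0.
  have /rat_in_itvoo[q] : x ord0 i - d < x ord0 i + d by lra.
  rewrite in_itv/= => /andP[q1 q2]; exists q.
  by rewrite /ball/= ltr_norml; apply/andP; split; lra.
have [q qP] := choice qE.
have xq : ball x k.+1%:R^-1 (map_mx ratr (\row_i q i) : 'rV[R]_n).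
  by split => // i j; rewrite !mxE (ord1 i); exact: qP.
exists (\row_i q i, k) => /=; last exact: ball_sym.
apply: subset_trans xeU => y qy.
by apply: le_ball (ball_triangle xq qy); move: ke; set d := k.+1%:R^-1 => ke; lra.
Qed.

Lemma measurable_consrv n : measurable_fun setT (@consrv R n).
Proof.
apply: (measurability (@open 'rV[R]_n.+1)) => // _ [U oU <-].
rewrite setTI (open_rV_bigcup oU) preimage_bigcup.
rewrite bigcup_mkcond; apply: countable_bigcupT_measurable; first exact: countableP.
move=> p; case: ifPn => // _.
move: (map_mx ratr p.1) => c; set e := p.2.+1%:R^-1.
have e0 : 0 < e by rewrite invr_gt0.
rewrite (_ : _ @^-1` _ =
    ball (unconsrv c).1 e `*` ball (unconsrv c).2 e); last first.
  apply/seteqP; split => tx /=.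
    move=> [_ ce]; split; first by have := ce ord0 ord0; rewrite consrv0.
    split=> // i j; have := ce i (lift ord0 j); rewrite !(ord1 i) consrvS. by rewrite mxE.
  move=> [c0 [_ cS]]; split => // i j; rewrite (ord1 i).
  have [k ->|->] := unliftP ord0 j; last by rewrite consrv0.
  by have := cS ord0 k; rewrite consrvS mxE.
apply: measurableX; first exact: measurable_ball.
by apply: open_measurable_rV; exact: ball_open.
Qed.

Lemma continuous_measurable_rV n (f : 'rV[R]_n -> measurableTypeR R) :
  continuous (f : 'rV[R]_n -> R) -> measurable_fun setT f.
Proof.
move=> /continuousP cf; apply: (measurability _ (RGenOpens.measurableE R)).
move=> _ [_ [a [b ->] <-]]; rewrite setTI.
apply: open_measurable_rV; apply: cf; exact: interval_open.
Qed.

Lemma measurable_unconsrv n : measurable_fun setT (@unconsrv R n).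
Proof.
apply: measurable_fun_pair.
  by apply: continuous_measurable_rV; exact: coord_continuous.
apply: (measurability (@open 'rV[R]_n)) => // _ [U oU <-].
rewrite setTI; apply: open_measurable_rV.
suff : open [set x : 'rV[R]_n.+1 | U (\row_(j < n) x ord0 (lift ord0 j))] by [].
rewrite openE => x /= Ux.
have /nbhs_ballP[e /= e0 eU] : nbhs (unconsrv x).2 U by exact: open_nbhs_nbhs.
apply/nbhs_ballP; exists e => // y [_ xy]; apply: eU; split => // i j.
by rewrite !mxE; exact: xy.
Qed.

End borel_rV.

HB.instance Definition _ (R : realType) (n : nat) :=
  isMeasurableFun.Build _ _ _ _ (@consrv R n) (@measurable_consrv R n).

Section lebesgue_rV_succ.
Variables (R : realType) (n : nat).
Variable mu : {sigma_finite_measure set 'rV[R]_n -> \bar R}.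

Definition lebesgue_rV_succ : set 'rV[R]_n.+1 -> \bar R :=
  pushforward (lebesgue_measure \x mu)%E (@consrv R n).

Let lebesgue_rV_succ0 : lebesgue_rV_succ set0 = 0%E.
Proof. exact: measure0. Qed.

Let lebesgue_rV_succ_ge0 A : (0 <= lebesgue_rV_succ A)%E.
Proof. exact: measure_ge0. Qed.

Let lebesgue_rV_succ_sigma_additive : semi_sigma_additive lebesgue_rV_succ.
Proof. exact: measure_semi_sigma_additive. Qed.

HB.instance Definition _ := isMeasure.Build _ _ _ lebesgue_rV_succ
  lebesgue_rV_succ0 lebesgue_rV_succ_ge0 lebesgue_rV_succ_sigma_additive.

Let sigma_finite_lebesgue_rV_succ : sigma_finite setT lebesgue_rV_succ.
Proof.
have /sigma_finiteP[F [FT ndF Foo]] := sigma_finiteT (@lebesgue_measure R).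
have /sigma_finiteP[G [GT ndG Goo]] := sigma_finiteT mu.
exists (fun k => @unconsrv R n @^-1` (F k `*` G k)).
  apply/esym/seteqP; split => // x _.
  have [[i _ Fi] [j _ Gj]] : (\bigcup_i F i) (unconsrv x).1 /\
      (\bigcup_i G i) (unconsrv x).2 by rewrite -FT -GT.
  exists (maxn i j) => //; split.
  - by move: Fi; apply/subsetPset/ndF/leq_maxl.
  - by move: Gj; apply/subsetPset/ndG/leq_maxr.
move=> k; have [mF Fk] := Foo k; have [mG Gk] := Goo k.
have mFG : measurable (F k `*` G k) by exact: measurableX.
split; first by rewrite -[X in measurable X]setTI; exact: measurable_unconsrv.
rewrite /lebesgue_rV_succ /pushforward -comp_preimage.
rewrite (_ : _ \o _ = id); last exact/funext/consrvK.
rewrite preimage_id product_measure1E// lte_mul_pinfty//.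
by rewrite ge0_fin_numE.
Qed.

HB.instance Definition _ := Measure_isSigmaFinite.Build _ _ _ lebesgue_rV_succ
  sigma_finite_lebesgue_rV_succ.

End lebesgue_rV_succ.

(* n-dimensional Lebesgue measure on Borel sets, as an iterated product of the
   one-dimensional one transported along R * R^n ~ R^(n+1);
   [lebesgue_rV_box] computes it on boxes. *)
Fixpoint lebesgue_rV (R : realType) (n : nat) :
    {sigma_finite_measure set 'rV[R]_n -> \bar R} :=
  if n is m.+1 return {sigma_finite_measure set 'rV[R]_n -> \bar R}
  then lebesgue_rV_succ (lebesgue_rV R m) else \d_(0 : 'rV[R]_0).

Lemma measurable_rV_box (R : realType) n (a b : 'I_n -> R) :
  measurable [set x : 'rV[R]_n | forall i, a i <= x ord0 i <= b i].
Proof.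
rewrite (_ : mkset _ = \bigcap_(i in [set: 'I_n])
    ((fun x : 'rV[R]_n => x ord0 i) @^-1` `[a i, b i]%classic)); last first.
  by apply/seteqP; split=> x /= h i => [_|]; have := h i; rewrite /= in_itv; exact.
apply: fin_bigcap_measurable; first exact: finite_finset.
move=> i _; rewrite -[X in measurable X]setTI.
apply: (@continuous_measurable_rV R n (fun x => x ord0 i)) => //.
exact: coord_continuous.
Qed.

Lemma lebesgue_rV_box (R : realType) n (a b : 'I_n -> R) :
  (forall i, a i <= b i) ->
  lebesgue_rV R n [set x | forall i, a i <= x ord0 i <= b i] =
  (\prod_(i < n) (b i - a i))%:E.
Proof.
elim: n a b => [|n IH] a b ab.
  by rewrite /= big_ord0 diracE mem_set// => -[].
transitivity ((lebesgue_measure \x lebesgue_rV R n)%E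
    (`[a ord0, b ord0]%classic `*` [set x : 'rV[R]_n |
      forall i, a (lift ord0 i) <= x ord0 i <= b (lift ord0 i)])).
  congr ((lebesgue_measure \x lebesgue_rV R n)%E _).
  apply/seteqP; split => tx /=.
    move=> abx; split; first by have := abx ord0; rewrite consrv0 in_itv.
    by move=> i; have := abx (lift ord0 i); rewrite consrvS.
  move=> [abt abx] i; have [j ->|->] := unliftP ord0 i.
    by rewrite consrvS; exact: abx.
  by rewrite consrv0; move: abt; rewrite in_itv.
rewrite product_measure1E//; last exact: measurable_rV_box.
rewrite (IH (fun i => a (lift ord0 i)) (fun i => b (lift ord0 i)))//.
rewrite [X in (X * _)%E](lebesgue_measure_itv `[a ord0, b ord0])/= lte_fin.
rewrite big_ord_recl EFinM.
case: ltP => // ba; have /eqP -> : b ord0 == a ord0 by rewrite eq_le ab ba.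
by rewrite subrr mul0e.
Qed.

Section sobolev.
Context {R : realType} {n : nat}.
Implicit Types (Omega : set 'rV[R]_n) (f g u v psi : 'rV[R]_n -> R)
  (Du Dv : 'I_n -> 'rV[R]_n -> R).

Local Notation mu := (lebesgue_rV R n).

Definition partial (i : 'I_n) f : 'rV[R]_n -> R :=
  fun x => 'D_(delta_mx ord0 i) f x.

Fixpoint continuously_differentiable (k : nat) f : Prop :=
  if k is m.+1 then
    [/\ continuous f,
        forall (i : 'I_n) (x : 'rV[R]_n), derivable f x (delta_mx ord0 i) &
        forall i : 'I_n, continuously_differentiable m (partial i f)]
  else continuous f.

Definition smooth f := forall k, continuously_differentiable k f.

Definition closed_support f : set 'rV[R]_n := closure [set x | f x != 0].

(* C_c^oo(Omega) *)
Definition test_function Omega psi :=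
  [/\ smooth psi, compact (closed_support psi) & closed_support psi `<=` Omega].

(* Elements of L^2(Omega) are represented by (Borel) functions on R^n, of which
   only the values on Omega matter. *)
Definition L2 Omega f :=
  measurable_fun Omega f /\ mu.-integrable Omega (fun x => (f x ^+ 2)%:E).

Definition L2_dot Omega f g : R := \int[mu]_(x in Omega) (f x * g x).

(* The integral is taken in \bar R, so that an infinite distance is not
   mistaken for 0. *)
Definition L2_cvg Omega (f_ : nat -> 'rV[R]_n -> R) f :=
  (\int[mu]_(x in Omega) ((f_ m x - f x) ^+ 2)%:E)%E @[m --> \oo] --> 0%E.

Definition weak_partial Omega (i : 'I_n) u g := forall psi,
  test_function Omega psi ->
  L2_dot Omega u (partial i psi) = - L2_dot Omega g psi.

(* u is in H^1(Omega), with weak gradient Du. *)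
Definition H1 Omega u Du :=
  [/\ L2 Omega u, forall i, L2 Omega (Du i) &
      forall i, weak_partial Omega i u (Du i)].

(* u is in H^1_0(Omega), the closure of C_c^oo(Omega) in H^1(Omega), with weak
   gradient Du. *)
Definition H10 Omega u Du := H1 Omega u Du /\
  exists psi_ : nat -> 'rV[R]_n -> R,
    [/\ forall m, test_function Omega (psi_ m), L2_cvg Omega psi_ u &
        forall i, L2_cvg Omega (fun m => partial i (psi_ m)) (Du i)].

Definition dirichlet_form Omega Du Dv : R :=
  \int[mu]_(x in Omega) (\sum_(i < n) Du i x * Dv i x).

Definition orthonormal_basis Omega (phi : nat -> 'rV[R]_n -> R) :=
  [/\ forall j, L2 Omega (phi j),
      forall i j, L2_dot Omega (phi i) (phi j) = (i == j)%:R &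
      forall f, L2 Omega f -> L2_cvg Omega
        (fun m x => \sum_(j < m) L2_dot Omega f (phi j) * phi j x) f].

(* Indexing starts at 0: [lam j] is the (j+1)-st eigenvalue. *)
Definition dirichlet_eigenvalues Omega (lam : nat -> R) :=
  [/\ 0 < lam 0%N, nondecreasing_seq lam, lam j @[j --> \oo] --> +oo &
      exists2 phi, orthonormal_basis Omega phi &
        forall j, exists2 Dphi, H10 Omega (phi j) Dphi &
          forall v Dv, H10 Omega v Dv ->
            dirichlet_form Omega Dphi Dv = lam j * L2_dot Omega (phi j) v].

End sobolev.

Section constants.
Variables (R : realType) (n : nat).

(* The Euclidean unit ball; [ball] is relative to the sup norm on 'rV[R]_n. *)
Definition omega : R :=
  fine (lebesgue_rV R n [set x | \sum_(i < n) x ord0 i ^+ 2 < 1]).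

Definition weyl_constant : R := (2 * pi) ^+ 2 * omega `^ (- (2 / n%:R)).

Definition x_equation (x : R) := 1 < x /\
  (n%:R - 2) * x ^+ n - n%:R * x ^+ (n - 2) + 8 / (n%:R + 2) = 0.

Definition x_ : R := xget 0 x_equation.

Definition K_ : R := (n%:R * x_ ^+ (n - 2) - 2) / (n%:R - 2).

Definition c_ : R := K_ `^ (- (2 / n%:R)).

End constants.

(* Main.v *)
Require Import Defs.
From HB Require Import structures.
From mathcomp Require Import all_boot all_order all_algebra.
From mathcomp Require Import all_classical all_reals all_analysis.
From mathcomp Require Import measurable_realfun ring lra.
Import Order.TTheory GRing.Theory Num.Theory.
Import numFieldNormedType.Exports.
Set Implicit Arguments.
Unset Strict Implicit.
Unset Printing Implicit Defensive.
Local Open Scope classical_set_scope.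
Local Open Scope ring_scope.

(** Write [L] for [lam k.-1] and [V] for the volume of [Omega], and let [F xi] be the
    sum over the first [k] eigenfunctions of the squared modulus of their
    unnormalized Fourier transform at [xi]; it is the squared norm of the projection
    of the plane wave of frequency [xi] onto the span of these eigenfunctions.
    Three facts are used.

    - By Plancherel's theorem, [\int F >= (2 pi)^n k] and
      [\int |xi|^2 F <= (2 pi)^n k L], because the gradients of the eigenfunctions
      have squared norms at most [L] ([H10_plancherel_ge], [power_integral_le]).

    - Bessel's inequality gives [F <= V] ([density_le_volume]).

    - Pairing the gradient of the projection with the gradient of the plane wave
      and integrating by parts gives [|xi|^2 F], while the Cauchy-Schwarz
      inequality bounds the pairing by [(L F)^(1/2) |xi| V^(1/2)]; hence
      [|xi|^2 F <= L V] ([density_decay]). This is the improvement on the argument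
      of Li and Yau, which only uses [F <= V].

    So [F <= V m], where [m] is the minimum of [1] and [L / |xi|^2]. Among the
    nonnegative functions below [V m] for which [\int (|xi|^2 - L) F <= 0], the integral is the
    largest for [V m] cut off at the radius where the last inequality becomes an
    equality. For the radius [x sqrt L] that equality is the equation of [x_], and
    the largest integral is [V omega L^(n/2) K_] ([bathtub], which is the dual form
    of this optimization, with an explicit Lagrange multiplier). Therefore
    [(2 pi)^n k <= V omega L^(n/2) K_] ([eigenvalue_count]), and the stated bound
    follows by taking powers of exponent [2/n].

    Plancherel's theorem is proved in the form needed here. The upper bound holds for
    every function in [L^1] and [L^2] ([plancherel_le]) and the lower bound for
    continuous functions of bounded support ([plancherel_ge]), by inserting a
    Gaussian under the integral and letting its width tend to infinity; the lower
    bound is carried to [H10] by approximation with test functions.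

    That [n / (n + 2) < c_ < 1] amounts to [1 < K_ < y ^+ n] with
    [y ^+ 2 = (n + 2) / n], see [K_gt1] and [K_lt]. *)

(** * Measurable and integrable real functions *)

Lemma measurable_cos (R : realType) : measurable_fun [set: R] (@cos R).
Proof. by apply: continuous_measurable_fun => x; exact: continuous_cos. Qed.

Lemma measurable_sin (R : realType) : measurable_fun [set: R] (@sin R).
Proof. by apply: continuous_measurable_fun => x; exact: continuous_sin. Qed.

(* Measurability of the functions built from the arithmetic operations, the
   absolute value, [expR], [cos] and [sin]. *)
Ltac mfun1 := first [ exact: measurable_cst | exact: measurable_id | assumption
  | exact: measurable_fst | exact: measurable_snd
  | apply: measurable_funX | apply: measurable_funD | apply: measurable_funB
  | apply: measurable_funN | apply: measurable_funM
  | (apply: measurableT_comp; [exact: measurable_expR |])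
  | (apply: measurableT_comp; [exact: measurable_cos |])
  | (apply: measurableT_comp; [exact: measurable_sin |])
  | (apply: measurableT_comp; [exact: normr_measurable |]) ].
Ltac mfun := repeat mfun1.

Lemma measurable_EFin_fun d (T : measurableType d) (R : realType) (D : set T)
    (f : T -> R) :
  measurable_fun D f -> measurable_fun D (fun x => (f x)%:E).
Proof. by move=> mf; apply/measurable_EFinP. Qed.

(* The integration theory is stated for functions with extended real values;
   these are the forms that it takes for real-valued functions. *)
Section real_integrable.
Context d (T : measurableType d) (R : realType).
Variables (mu : {measure set T -> \bar R}) (D : set T) (mD : measurable D).
Implicit Types f g h : T -> R.

Lemma integrable_scale (k : R) f : mu.-integrable D (EFin \o f) ->
  mu.-integrable D (EFin \o (fun x => k * f x)).
Proof.
by move=> fi; rewrite (_ : _ \o _ = fun x => (k%:E * (EFin \o f) x)%E)//;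
  exact: integrableZl.
Qed.

Lemma integrable_add f g : mu.-integrable D (EFin \o f) ->
  mu.-integrable D (EFin \o g) ->
  mu.-integrable D (EFin \o (fun x => f x + g x)).
Proof.
by move=> fi gi; rewrite (_ : _ \o _ = ((EFin \o f) \+ (EFin \o g))%E)//;
  exact: integrableD.
Qed.

Lemma integrable_sub f g : mu.-integrable D (EFin \o f) ->
  mu.-integrable D (EFin \o g) ->
  mu.-integrable D (EFin \o (fun x => f x - g x)).
Proof.
by move=> fi gi; rewrite (_ : _ \o _ = ((EFin \o f) \- (EFin \o g))%E)//;
  exact: integrableB.
Qed.

Lemma integrable_sum_ord (m : nat) (F : 'I_m -> T -> R) :
  (forall i, mu.-integrable D (EFin \o F i)) ->
  mu.-integrable D (EFin \o (fun x => \sum_(i < m) F i x)).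
Proof.
move=> Fi; rewrite (_ : _ \o _ = fun x => \sum_(i < m) (F i x)%:E)%E.
  by apply: integrable_sum => // i _; exact: Fi.
by apply/funext => x /=; rewrite sumEFin.
Qed.

Lemma le_integrable_real f g : measurable_fun D f ->
  (forall x, D x -> `|f x| <= g x) ->
  mu.-integrable D (EFin \o g) -> mu.-integrable D (EFin \o f).
Proof.
move=> mf fg; apply: le_integrable => //; first exact/measurable_EFinP.
by move=> x Dx /=; rewrite lee_fin (le_trans (fg _ Dx))// ler_norm.
Qed.

Lemma RintegralE_fin f : mu.-integrable D (EFin \o f) ->
  (\int[mu]_(x in D) (f x)%:E = (\int[mu]_(x in D) f x)%:E)%E.
Proof. by move=> fi; rewrite /Rintegral fineK// integrable_fin_num. Qed.

Lemma Rintegral_sum_ord (m : nat) (F : 'I_m -> T -> R) :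
  (forall i, mu.-integrable D (EFin \o F i)) ->
  \int[mu]_(x in D) (\sum_(i < m) F i x) = \sum_(i < m) \int[mu]_(x in D) F i x.
Proof.
elim: m F => [|m IH] F Fi.
  by under eq_Rintegral do rewrite big_ord0; rewrite big_ord0 Rintegral_cst// mul0r.
under eq_Rintegral do rewrite big_ord_recl.
rewrite big_ord_recl -IH// RintegralD//.
by apply: integrable_sum_ord.
Qed.

End real_integrable.

(** * The constants *)

Section constants.
Variable R : realType.

(** The inequality between the means of [s ^+ m.+2] and [t ^+ m.+2] with weights
    [m] and [2], for natural exponents. *)
Lemma weighted_AM_GM (m : nat) (s t : R) : 0 <= s -> 0 <= t ->
  (m%:R + 2) * t ^+ 2 * s ^+ m <= m%:R * s ^+ m.+2 + 2 * t ^+ m.+2.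
Proof.
move=> s0 t0; elim: m => [|m IH]; first by rewrite !expr0 !mul0r; lra.
have /(ler_wpM2l t0) := IH.
have : 0 <= s ^+ m * ((s - t) ^+ 2 * ((m%:R + 1) * s + (m%:R + 2) * t)).
  apply: mulr_ge0; first exact: exprn_ge0.
  apply: mulr_ge0; first exact: sqr_ge0.
  have : 0 <= m%:R :> R by [].
  by move: (m%:R : R) => M M0; nra.
rewrite -(@natr1 _ m) !exprS; move: (s ^+ m) (t ^+ m) => S T.
by move: (m%:R : R) => M; nra.
Qed.

Lemma bernoulli2 (k : nat) (d : R) : 0 <= d -> (3 <= k)%N ->
  1 + k%:R * d + 3 * d ^+ 2 <= (1 + d) ^+ k.
Proof.
move=> d0; elim: k => // k IH; rewrite leq_eqVlt => /predU1P[[<-]|].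
  by rewrite !exprS expr0; nra.
rewrite ltnS => k3; rewrite (exprS (1 + d)) -(@natr1 _ k).
have d1 : 0 <= 1 + d by lra.
apply: le_trans _ (ler_wpM2l d1 (IH k3)).
have : 3%:R <= k%:R :> R by rewrite ler_nat.
by move: (k%:R : R) => M M3; nra.
Qed.

(** Up to a positive factor this is the integral from [1] to [y] of
    [(s ^+ (n - 1) - s ^+ (n - 3)) * (y ^+ 2 - s ^+ 2)] with [n = m + 3], whose
    integrand is positive. *)
Lemma moment_poly_gt0 (m : nat) (y : R) : 1 < y ->
  0 < m.+1%:R * y ^+ (m + 5) - (m%:R + 5) * y ^+ (m + 3)
      + (m%:R + 5) * y ^+ 2 - m.+1%:R.
Proof.
move=> y1.
have y0 : 0 < y by lra.
have step k : 0 < y ^+ (k + 5) - y ^+ (k + 3) - (k%:R + 4) * y ^+ 3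
    + (k%:R + 5) * y ^+ 2 + k%:R * y - (k%:R + 1).
  have d0 : 0 <= y - 1 by lra.
  have := @bernoulli2 (k + 3) _ d0 (leq_addl _ _).
  rewrite (addrC 1 (y - 1)) subrK natrD => H.
  have -> : (k + 5 = (k + 3) + 2)%N by rewrite -addnA.
  rewrite (exprD _ _ 2); move: (y ^+ (k + 3)) H => Y H.
  have k0 : 0 <= k%:R :> R by [].
  move: (k%:R : R) k0 H => M M0 H.
  have : 0 < (y - 1) * (Y * (y + 1) - (M + 4) * y ^+ 2 + y + M + 1).
    rewrite mulr_gt0//; first lra.
    have : (1 + (M + 3) * (y - 1) + 3 * (y - 1) ^+ 2) * (y + 1) <= Y * (y + 1).
      by rewrite ler_wpM2r//; lra.
    have : 0 < (y - 1) ^+ 2 * (3 * y + 2).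
      by rewrite mulr_gt0 ?exprn_gt0//; lra.
    lra.
  by move=> ?; lra.
elim: m => [|m IH]; first by have := step 0; rewrite !add0n; lra.
have := step m.+1; move: IH => /(mulr_gt0 y0).
rewrite !addSn !(exprS _ (m + _)) -(@natr1 _ m.+1) -(@natr1 _ m).
by move: (y ^+ (m + 5)) (y ^+ (m + 3)) (m%:R : R) => Y Z M H1 H2; nra.
Qed.

Variables (n : nat) (hn : (3 <= n)%N).

Let ge3n : 3 <= n%:R :> R. Proof. by rewrite (ler_nat _ 3). Qed.

Let f (x : R) := (n%:R - 2) * x ^+ n - n%:R * x ^+ (n - 2) + 8 / (n%:R + 2).

(** Strict monotonicity of the left-hand side of the equation of [x_], from the
    arithmetic-geometric inequality and [1 < x ^+ 2]. *)
Lemma x_equation_lhs_increasing (x y : R) : 1 < x -> x < y -> f x < f y.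
Proof.
have n3 := ge3n.
move=> x1 xy; rewrite /f ltrD2r.
have x0 : 0 <= x by lra. have y0 : 0 <= y by lra.
have := weighted_AM_GM (n - 2) y0 x0.
rewrite natrB ?(ltnW hn)// subrK -[(n - 2).+2]addn2 subnK ?(ltnW hn)//.
have -> : x ^+ n = x ^+ 2 * x ^+ (n - 2) by rewrite -exprD subnKC// (ltnW hn).
have : x ^+ (n - 2) < y ^+ (n - 2) by rewrite ltrXn2r// subn_eq0 -ltnNge.
have : 1 < x ^+ 2 by rewrite exprn_egt1.
move: (x ^+ 2) (x ^+ (n - 2)) (y ^+ (n - 2)) (y ^+ n) (n%:R : R) n3 => a b c d M M3.
move=> a1 bc H.
have : 0 < M * (a - 1) * (c - b) by rewrite !mulr_gt0//; lra.
nra.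
Qed.

Lemma x_equationP : x_equation n (x_ R n).
Proof.
have n3 := ge3n.
rewrite /x_; case: xgetP => [y -> //|noroot]; exfalso.
pose p : {poly R} := (n%:R - 2) *: 'X^n - n%:R *: 'X^(n - 2) + (8 / (n%:R + 2))%:P.
have pE x : p.[x] = f x by rewrite /p !(hornerD, hornerN, hornerZ, hornerXn, hornerC).
(* The left-hand side changes sign between 1 and 2. *)
have f1 : f 1 < 0.
  rewrite /f !expr1n !mulr1.
  have : 8 / (n%:R + 2) < 2 :> R by rewrite ltr_pdivrMr; lra.
  lra.
have f2 : 0 < f 2.
  rewrite /f; have -> : (2:R) ^+ n = 2 ^+ 2 * 2 ^+ (n - 2).
    by rewrite -exprD subnKC// (ltnW hn).
  have : 0 < (2:R) ^+ (n - 2) by rewrite exprn_gt0.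
  have : 0 < 8 / (n%:R + 2) :> R by rewrite divr_gt0//; lra.
  move: (n%:R : R) n3 (2 ^+ (n - 2)) (8 / _) => M M3 a b b0 a0.
  by have : 0 < a * (3 * M - 8) by [rewrite mulr_gt0//; lra]; nra.
have [||x x12 rx] := @poly_ivt R p 1 2; rewrite ?pE ?ler1n ?ltW//.
have /eqP := rx; rewrite pE => fx.
apply: (noroot x); split => //; move: x12; rewrite le_eqVlt => /andP[/predU1P[x1|//] _].
by move: fx f1; rewrite -x1 => ->; rewrite ltxx.
Qed.

Lemma x_equation_unique : unique (@x_equation R n) (x_ R n).
Proof.
have n3 := ge3n.
split=> [|y [y1 fy]]; first exact: x_equationP.
have [x1 fx] := x_equationP.
have [xy|yx|//] := ltgtP (x_ R n) y.
- by have := x_equation_lhs_increasing x1 xy; rewrite /f fx fy ltxx.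
- by have := x_equation_lhs_increasing y1 yx; rewrite /f fx fy ltxx.
Qed.

Lemma K_eq : K_ R n = x_ R n ^+ n - 2 / (n%:R + 2).
Proof.
have n3 := ge3n.
have [x1 fx] := x_equationP; rewrite /K_.
have -> : n%:R * x_ R n ^+ (n - 2) =
    (n%:R - 2) * x_ R n ^+ n + 8 / (n%:R + 2) by lra.
by field; rewrite !gt_eqF//; lra.
Qed.

Lemma K_gt1 : 1 < K_ R n.
Proof.
have n3 := ge3n.
have [x1 _] := x_equationP; rewrite /K_ ltr_pdivlMr; last by lra.
have : 1 < x_ R n ^+ (n - 2) by rewrite exprn_egt1// subn_eq0 -ltnNge.
move: (x_ R n ^+ (n - 2)) => a a1.
by have : 0 < n%:R * (a - 1) by [rewrite mulr_gt0//; lra]; lra.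
Qed.

(** The constant improves on the one of Li and Yau. Both are maxima of
    [\int F / omega] among the nonnegative functions [F <= 1] with
    [\int (|xi|^2 - 1) F <= 0]; for [K_] it is also required that [F] be at most
    [1 / |xi|^2], and [y] is the radius of the ball whose indicator function is
    the maximizer without that constraint. The arithmetic-geometric inequality at [x_] and [y] bounds [K_] by an affine
    function of [y ^+ n], and [moment_poly_gt0] at [y] makes this bound smaller
    than [y ^+ n]. *)
Lemma K_lt : K_ R n < Num.sqrt ((n%:R + 2) / n%:R) ^+ n.
Proof.
have n3 := ge3n.
set y := Num.sqrt _.
have [x1 fx] := x_equationP; have KE := K_eq.
have y2 : y ^+ 2 = (n%:R + 2) / n%:R.
  by rewrite sqr_sqrtr// divr_ge0//; lra.
have y0 : 0 <= y by rewrite sqrtr_ge0.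
have y1 : 1 < y.
  rewrite -[1]sqrtr1 ltr_sqrt; last by rewrite divr_gt0//; lra.
  by rewrite ltr_pdivlMr; lra.
have x0 : 0 <= x_ R n by lra.
have := weighted_AM_GM (n - 2) x0 y0.
rewrite natrB ?(ltnW hn)// subrK -[(n - 2).+2]addn2 subnK ?(ltnW hn)//.
have := moment_poly_gt0 (n - 3) y1.
have -> : (n - 3).+1%:R = n%:R - 2 :> R.
  by rewrite -natr1 natrB//; lra.
have -> : (n - 3)%:R + 5 = n%:R + 2 :> R by rewrite natrB//; lra.
have -> : (n - 3 + 5 = n + 2)%N by rewrite -{2}(subnK hn) -addnA.
rewrite (exprD _ n) subnK// y2.
have : K_ R n * (n%:R - 2) = n%:R * x_ R n ^+ (n - 2) - 2.
  by rewrite /K_ divfK// gt_eqF//; lra.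
move: KE; move: (K_ R n) (x_ R n ^+ n) (x_ R n ^+ (n-2)) (y ^+ n) (n%:R : R) n3 => K a b c M M3.
move=> -> E1 I2 I1.
have M0 : 0 < M by lra.
have M2 : 0 < M + 2 by lra.
(* Clearing the denominators leaves polynomial inequalities. *)
set q := (M + 2) / M in I1 I2.
have qE : q = 1 + 2 / M by rewrite /q mulrDl divff// gt_eqF.
set p := 2 / M in qE.
have pM : p * M = 2 by rewrite /p divfK// gt_eqF.
have p0 : 0 < p by rewrite divr_gt0.
set r := 2 / (M + 2) in E1 *.
have rM : r * (M + 2) = 2 by rewrite /r divfK// gt_eqF.
have r0 : 0 < r by rewrite divr_gt0.
have I2' : c * (M + 2) < 3 * M + 2.
  have : 0 < M * ((M - 2) * (c * q) - (M + 2) * c + (M + 2) * q - (M - 2)).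
    by rewrite mulr_gt0.
  rewrite qE.
  have -> : M * ((M - 2) * (c * (1 + p)) - (M + 2) * c + (M + 2) * (1 + p) - (M - 2)) =
    (M - 2) * (c * (M + p * M)) - (M + 2) * c * M + (M + 2) * (M + p * M) - (M - 2) * M by ring.
  by rewrite pM => ?; nra.
have I1' : (M + 2) * (M * b) <= M * ((M - 2) * a + 2 * c).
  have := ler_wpM2l (ltW M0) I1.
  have -> // : M * (M * q * b) = (M + 2) * (M * b).
  rewrite qE; have -> : M * (M * (1 + p) * b) = (M + p * M) * (M * b) by ring.
  by rewrite pM.
have I3 : (a - r) * (M - 2) < c * (M - 2).
  have E2 : M * b = (a - r) * (M - 2) + 2 by lra.
  move: I1'; rewrite E2 => I1'.
  have : (a - r) * (M - 2) * 2 <= M * (M - 2) * r + 2 * c * M - 2 * (M + 2) by nra.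
  have rM1 : (M * (M - 2) * r) * (M + 2) = 2 * M * (M - 2) by rewrite -mulrA rM; ring.
  move=> I4.
  rewrite -(ltr_pM2r (_ : 0 < 2 * (M + 2))); last lra.
  have := ler_wpM2r (ltW M2) I4.
  by nra.
by move: I3; rewrite ltr_pM2r//; lra.
Qed.

Lemma c_bounds : n%:R / (n%:R + 2) < c_ R n < 1.
Proof.
have n3 := ge3n.
have n0 : 0 < n%:R :> R by lra.
have e0 : 0 < 2 / n%:R :> R by rewrite divr_gt0.
have K0 : 0 < K_ R n by apply: lt_trans K_gt1.
rewrite /c_ powRN; apply/andP; split.
  have q0 : 0 < n%:R / (n%:R + 2) :> R by rewrite divr_gt0//; lra.
  rewrite -[ltLHS]invrK ltf_pV2 ?posrE ?powR_gt0 ?invr_gt0//.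
  rewrite invf_div.
  have yE : ((Num.sqrt ((n%:R + 2) / n%:R) ^+ n) `^ (2 / n%:R) = (n%:R + 2) / n%:R :> R).
    rewrite -powR_mulrn ?sqrtr_ge0// -powRrM mulrCA divff ?gt_eqF// mulr1.
    by rewrite (powR_mulrn 2)// ?sqrtr_ge0// sqr_sqrtr// divr_ge0//; lra.
  rewrite -yE; apply: gt0_ltr_powR => //; first by rewrite nnegrE ltW.
    by rewrite nnegrE exprn_ge0// sqrtr_ge0.
  exact: K_lt.
rewrite invf_lt1 ?powR_gt0//.
have : 1 `^ (2 / n%:R) < K_ R n `^ (2 / n%:R).
  apply: gt0_ltr_powR => //; first by rewrite nnegrE ler01.
    by rewrite nnegrE ltW.
  exact: K_gt1.
by rewrite powR1.
Qed.

End constants.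

(** * Gaussian integrals on the line *)

Section gauss1.
Variable R : realType.
Local Notation leb := (@lebesgue_measure R).

Lemma integral_gauss1 (a m : R) : 0 < a ->
  (\int[leb]_x (expR (- (a * (x - m) ^+ 2)))%:E = (Num.sqrt (pi / a))%:E)%E.
Proof.
move=> a0; pose s : R := Num.sqrt (2 * a)^-1.
have s2 : s ^+ 2 = (2 * a)^-1 by rewrite sqr_sqrtr// invr_ge0; lra.
have s0 : s != 0 by rewrite gt_eqF// sqrtr_gt0 invr_gt0; lra.
have pk0 : normal_peak s != 0 by rewrite gt_eqF// normal_peak_gt0.
have pkE : (normal_peak s)^-1 = Num.sqrt (pi / a).
  by rewrite /normal_peak invrK s2; congr Num.sqrt; field; rewrite gt_eqF.
have := integral_normal_pdf m s.
rewrite (normal_pdfE m s0); under eq_integral do rewrite EFinM.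
rewrite ge0_integralZl//=; last 3 first.
- by apply/measurable_EFinP; exact: measurable_normal_fun.
- by move=> x _; rewrite lee_fin expR_ge0.
- by rewrite lee_fin normal_peak_ge0.
move=> H; transitivity ((Num.sqrt (pi / a))%:E * 1)%E; last by rewrite mule1.
rewrite -H muleA -EFinM -pkE mulVf// mul1e.
apply: eq_integral => x _; congr (expR _)%:E.
by rewrite s2; field; rewrite gt_eqF.
Qed.

Lemma integrable_gauss1 (a m : R) : 0 < a ->
  leb.-integrable setT (EFin \o (fun x => expR (- (a * (x - m) ^+ 2)))).
Proof.
move=> a0; apply/integrableP; split.
  apply/measurable_EFinP; mfun.
under eq_integral do rewrite /= ger0_norm ?expR_ge0//.
by rewrite integral_gauss1// ltry.
Qed.


Lemma derivable_continuous (f : R -> R) :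
  (forall x : R, derivable f x (1 : R)) -> continuous f.
Proof. by move=> H x; apply: differentiable_continuous; exact/derivable1_diffP. Qed.

(** The fundamental theorem of calculus on the line, for a primitive that tends to
    0 along the integers in both directions. *)
Lemma integral_derive_eq0 (F f : R -> R) :
  (forall x : R, is_derive x (1 : R) F (f x)) -> continuous f ->
  leb.-integrable setT (EFin \o f) ->
  F n%:R @[n --> \oo] --> 0 -> F (- n%:R) @[n --> \oo] --> 0 ->
  (\int[leb]_x (f x)%:E = 0)%E.
Proof.
move=> dF cf intf Fy FNy.
pose f_ n x := ((EFin \o f) \_ `[- n.+1%:R, n.+1%:R]) x.
have f_E n : (\int[leb]_x f_ n x = (F n.+1%:R - F (- n.+1%:R))%:E)%E.
  rewrite /f_ -integral_mkcond/= EFinB; apply: continuous_FTC2.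
  - by rewrite -subr_gt0 opprK addr_gt0.
  - exact: continuous_subspaceT.
  - have cF : continuous F.
      by apply: derivable_continuous => x; have [] := dF x.
    split => [x _| |]; first by have [] := dF x.
    + by apply: cvg_at_right_filter; exact: cF.
    + by apply: cvg_at_left_filter; exact: cF.
  - by move=> x _; rewrite derive1E; apply: derive_val.
have : (\int[leb]_x f_ n x)%E @[n --> \oo] --> (\int[leb]_x (f x)%:E)%E.
  have mf : measurable_fun setT (EFin \o f) by exact: measurable_int intf.
  apply: (@dominated_cvg _ _ R leb setT measurableT f_ (EFin \o f)
    (fun x => `|(f x)%:E|%E)) => //.
  - by move=> n; apply/measurable_restrict => //; exact: measurable_funTS.
  - move=> x _; apply: cvg_near_cst.
    near=> n; rewrite /f_ patchE mem_set//= in_itv/= -ler_norml.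
    near: n; exists (Num.truncn `|x|) => // n /= xn.
    by rewrite ltW// (lt_le_trans (truncnS_gt _))// ler_nat.
  - exact: integrable_abse.
  - move=> n x _; rewrite /f_ patchE; case: ifPn => //= _.
    by rewrite lee_fin normr0.
under eq_cvg do rewrite f_E.
move=> H; apply: cvg_unique H _ => //.
apply: cvg_EFin; first exact: nearW.
rewrite /comp/= -[0](subr0 0).
by apply: cvgB; [rewrite (cvg_shiftS (fun n => F n%:R))|rewrite (cvg_shiftS (fun n => F (- n%:R)))].
Unshelve. all: end_near. Qed.

Lemma is_derive_gauss1 (a x : R) :
  is_derive x 1 (fun x => expR (- (a * x ^+ 2)))
    (- (2 * a * x) * expR (- (a * x ^+ 2))).
Proof. by apply: is_derive_eq; rewrite /GRing.scale/= !mulr1; lra. Qed.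

End gauss1.
Section gauss_cos.
Variable R : realType.
Local Notation leb := (@lebesgue_measure R).
Variables (a th : R) (a0 : 0 < a).

Let g (x : R) := expR (- (a * x ^+ 2)).

Let int_g : leb.-integrable setT (EFin \o g).
Proof.
have := integrable_gauss1 0 a0; rewrite /g.
by under eq_fun do rewrite subr0.
Qed.

(* [|x|] is absorbed by half of the Gaussian: [|x| <= C expR (a x^2 / 2)]. *)
Let int_xg : leb.-integrable setT (EFin \o (fun x => `|x| * g x)).
Proof.
have a20 : 0 < a / 2 by rewrite divr_gt0.
pose C := 1 + 2 / a.
have C0 : 0 < C by rewrite addr_gt0// divr_gt0.
apply: (@le_integrable _ _ R leb setT measurableT (EFin \o (fun x : R => `|x| * g x))
    (EFin \o (fun x : R => C * expR (- (a / 2 * (x - 0) ^+ 2))))) => //.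
- by apply/measurable_EFinP; mfun.
- move=> x _ /=; rewrite lee_fin !normrM normr_id (gtr0_norm C0) ![`|expR _|]ger0_norm ?expR_ge0//.
  rewrite subr0 /g.
  have -> : - (a * x ^+ 2) = - (a / 2 * x ^+ 2) + - (a / 2 * x ^+ 2) by lra.
  rewrite expRD mulrA ler_wpM2r ?expR_ge0//.
  rewrite expRN ler_pdivrMr ?expR_gt0//.
  apply: le_trans (_ : C * (1 + a / 2 * x ^+ 2) <= _); last first.
    by rewrite ler_wpM2l ?(ltW C0)// expR_ge1Dx.
  have -> : C * (1 + a / 2 * x ^+ 2) = C + (a / 2 + 1) * x ^+ 2.
    by rewrite /C; field; rewrite gt_eqF.
  rewrite -(real_normK (num_real x)).
  have : 0 < 2 / a by rewrite divr_gt0.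
  rewrite /C; move: `|x| (2 / a) => t b b0.
  have : 0 <= (t - 1) ^+ 2 by rewrite sqr_ge0.
  have : 0 <= a * t ^+ 2 by rewrite mulr_ge0 ?sqr_ge0// ltW.
  nra.
- rewrite (_ : _ \o _ = (fun x => C%:E * (expR (- (a / 2 * (x - 0) ^+ 2)))%:E)%E).
    by apply: integrableZl => //; exact: integrable_gauss1.
  by apply/funext.
Qed.

(* The cosine transform of the Gaussian, with phase [th]. *)
Let J (b : R) := \int[leb]_x (g x * cos (b * x + th)).

Let int_gc (b : R) : leb.-integrable setT (EFin \o (fun x => g x * cos (b * x + th))).
Proof.
apply: le_integrable int_g => //; first by apply/measurable_EFinP; rewrite /g; mfun.
move=> x _ /=; rewrite lee_fin normrM ler_piMr//.
by rewrite ler_norml cos_geN1 cos_le1.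
Qed.

Let int_xgs (b : R) : leb.-integrable setT (EFin \o (fun x => x * g x * sin (b * x + th))).
Proof.
apply: le_integrable int_xg => //; first by apply/measurable_EFinP; rewrite /g; mfun.
move=> x _ /=; rewrite lee_fin !normrM normr_id ler_piMr// ?mulr_ge0//.
by rewrite ler_norml sin_geN1 sin_le1.
Qed.

Let dcos (b x : R) :
  is_derive b (1:R) (fun b => g x * cos (b * x + th)) (- (x * g x * sin (b * x + th))).
Proof. by apply: is_derive_eq; rewrite /GRing.scale/= !mulr1; lra. Qed.

Let dJ (b : R) : is_derive b (1:R) J (- \int[leb]_x (x * g x * sin (b * x + th))).
Proof.
have d1 (c x : R) : partial1of2 (fun b x => g x * cos (b * x + th)) c x =
    - (x * g x * sin (c * x + th)).
  by rewrite partial1of2E; apply: derive_val.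
have Ib : b \in `]b - 1, b + 1[ by rewrite in_itv/=; lra.
have G0 x : 0 <= `|x| * g x by rewrite mulr_ge0 ?expR_ge0.
have H1 : forall x, `]b - 1, b + 1[%classic x ->
  leb.-integrable setT (EFin \o (fun x0 => g x0 * cos (x * x0 + th))) by move=> x _.
have H2 : forall x y : R, `]b - 1, b + 1[%classic x -> [set: R] y ->
  derivable ((fun b x => g x * cos (b * x + th)) ^~ y) x 1.
  by move=> x y _ _; have [] := dcos x y.
have H3 : forall x y, `]b - 1, b + 1[%classic x -> [set: R] y ->
   `|partial1of2 (fun b x => g x * cos (b * x + th)) x y| <= `|y| * g y.
  move=> x y _ _; rewrite d1 normrN !normrM (ger0_norm (expR_ge0 _)).
  rewrite ler_piMr ?G0//.
  by rewrite ler_norml sin_geN1 sin_le1.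
apply: DeriveDef; first exact: (derivable_under_integral measurableT Ib H1 H2 G0 int_xg H3).
rewrite -derive1E (differentiation_under_integral measurableT Ib H1 H2 G0 int_xg H3).
under eq_Rintegral do rewrite d1.
rewrite -mulN1r -RintegralZl//.
by apply: eq_Rintegral => x _; rewrite mulN1r.
Qed.

(* Integrating the derivative of [g x * sin (b * x + th)] gives the differential
   equation of [J]. *)
Let J_ode (b : R) : \int[leb]_x (x * g x * sin (b * x + th)) = b / (2 * a) * J b.
Proof.
pose H x := g x * sin (b * x + th).
pose h x := - (2 * a) * (x * g x * sin (b * x + th)) + b * (g x * cos (b * x + th)).
have dH (x : R) : is_derive x (1:R) H (h x).
  have := is_derive_gauss1 a x => dg.
  apply: is_derive_eq; rewrite /GRing.scale/= !mulr1 /h /g; lra.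
have ch : continuous h.
  by apply: derivable_continuous => x; rewrite /h /g; apply: ex_derive.
have cvg_H (u : nat -> R) : (forall n, `|u n| = n%:R) -> H (u n) @[n --> \oo] --> 0.
  move=> un; pose C := 2 + a^-1.
  have Ca : C * a = 2 * a + 1 by rewrite /C mulrDl mulVf// gt_eqF.
  have C0 : 0 < C by rewrite addr_gt0// invr_gt0.
  apply: norm_cvg0.
  apply: (@squeeze_cvgr _ _ _ _ (cst 0) (fun n => C * harmonic n)).
  - near=> n; rewrite normr_ge0/= /H normrM.
    apply: le_trans (_ : g (u n) <= _).
      rewrite (ger0_norm (expR_ge0 _)) ler_piMr ?expR_ge0//.
      by rewrite ler_norml sin_geN1 sin_le1.
    rewrite /g -(real_normK (num_real (u n))) un expRN /harmonic/=.
    rewrite -ler_pdivrMl// -invfM lef_pV2 ?posrE ?mulr_gt0 ?expR_gt0//.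
    apply: le_trans (_ : C * (1 + a * n%:R ^+ 2) <= _); last first.
      by rewrite ler_wpM2l ?(ltW C0)// expR_ge1Dx.
    rewrite mulrDr mulrA Ca -natr1 mulr1 /C.
    have : 0 < a^-1 by rewrite invr_gt0.
    have : 0 <= (n%:R - 1) ^+ 2 :> R by rewrite sqr_ge0.
    have : 0 <= a * n%:R ^+ 2 by rewrite mulr_ge0 ?sqr_ge0// ltW.
    by move: (n%:R : R) a^-1 => ? ?; nra.
  - exact: cvg_cst.
  - by rewrite -[X in _ --> X](mulr0 C); apply: cvgMr; exact: cvg_harmonic.
have ih1 := integrable_scale measurableT (- (2 * a)) (int_xgs b).
have ih2 := integrable_scale measurableT b (int_gc b).
have ih : leb.-integrable setT (EFin \o h) by exact: integrable_add.
have : (\int[leb]_x (h x)%:E = 0)%E.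
  by apply: (integral_derive_eq0 dH ch ih); apply: cvg_H => n; rewrite ?normrN normr_nat.
rewrite RintegralE_fin// RintegralD// !RintegralZl// -/(J b).
move=> [E]; apply: (@mulfI _ (2 * a)); first by rewrite gt_eqF// mulr_gt0.
have -> : 2 * a * (b / (2 * a) * J b) = b * J b by field; rewrite gt_eqF.
by move: E; set x := Rintegral _ _ _; set y := J b; lra.
Unshelve. all: end_near. Qed.

(** The function [E] below is constant because [J] solves
    [J' = - b / (2 a) J]. *)
Lemma Rintegral_gauss1_cos (b : R) :
  \int[leb]_x (expR (- (a * x ^+ 2)) * cos (b * x + th)) =
  Num.sqrt (pi / a) * expR (- (b ^+ 2 / (4 * a))) * cos th.
Proof.
pose E b := J b * expR (b ^+ 2 / (4 * a)).
have dE (c : R) : is_derive c (1:R) E 0.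
  have := dJ c => dJc.
  apply: is_derive_eq; rewrite J_ode /GRing.scale/= !mulr1.
  field; rewrite gt_eqF//.
have : E b = E 0 by exact: is_derive_0_is_cst.
rewrite /E expr0n mul0r expR0 mulr1 => Eb.
have J0 : J 0 = Num.sqrt (pi / a) * cos th.
  rewrite /J; under eq_Rintegral do rewrite mul0r add0r.
  rewrite RintegralZr//; congr (_ * _).
  rewrite /Rintegral -[RHS]/(fine (Num.sqrt (pi / a))%:E) -(integral_gauss1 0 a0).
  congr fine.
  by apply: eq_integral => x _; rewrite subr0.
by rewrite expRN mulrAC -J0 -Eb /J/= mulfK// gt_eqF// expR_gt0.
Qed.

End gauss_cos.

(** * Iterated integrals and scaling in dimension [n] *)

Section tonelli_rV.
Variable R : realType.
Local Notation leb := (@lebesgue_measure R).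
Local Notation mu n := (lebesgue_rV R n).

Lemma measurable_coord n (i : 'I_n) :
  measurable_fun setT (fun x : 'rV[R]_n => x ord0 i : measurableTypeR R).
Proof. by apply: continuous_measurable_rV => x; exact: coord_continuous. Qed.

Lemma integral_rV0 (f : 'rV[R]_0 -> \bar R) :
  measurable_fun setT f -> (\int[mu 0]_x f x = f 0%R)%E.
Proof. by move=> mf; rewrite integral_dirac// diracE in_setT mul1e. Qed.

Lemma ge0_integral_rVS n (f : 'rV[R]_n.+1 -> \bar R) :
  measurable_fun setT f -> (forall x, 0 <= f x)%E ->
  (\int[mu n.+1]_x f x = \int[leb]_t \int[mu n]_x f (consrv (t, x)))%E.
Proof.
move=> mf f0.
rewrite [LHS](@ge0_integral_pushforward _ _ _ _ _ _ (@measurable_consrv R n)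
  (leb \x mu n)%E setT f)//.
rewrite preimage_setT fubini_tonelli1//.
  by apply: measurableT_comp => //; exact: measurable_consrv.
by move=> x; exact: f0.
Qed.

Lemma integrable_rVS n (f : 'rV[R]_n.+1 -> \bar R) :
  (mu n.+1).-integrable setT f ->
  (leb \x mu n)%E.-integrable setT (f \o @consrv R n).
Proof.
move=> /integrableP[mf foo]; apply/integrableP; split.
  by apply: measurableT_comp => //; exact: measurable_consrv.
apply: le_lt_trans foo.
rewrite [leRHS](@ge0_integral_pushforward _ _ _ _ _ _ (@measurable_consrv R n)
  (leb \x mu n)%E setT (abse \o f))//=.
exact: measurableT_comp.
Qed.

Lemma integral_rVS n (f : 'rV[R]_n.+1 -> \bar R) :
  (mu n.+1).-integrable setT f ->
  (\int[mu n.+1]_x f x = \int[leb]_t \int[mu n]_x f (consrv (t, x)))%E.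
Proof.
move=> fi; have fci := integrable_rVS fi.
rewrite [LHS](@integral_pushforward _ _ _ _ _ _ (@measurable_consrv R n)
  (leb \x mu n)%E setT f)//; last exact: measurable_int fi.
by rewrite preimage_setT -(integral12_prod_meas1 fci).
Qed.

Lemma integral_rVS_swap n (f : 'rV[R]_n.+1 -> \bar R) :
  (mu n.+1).-integrable setT f ->
  (\int[mu n.+1]_x f x = \int[mu n]_x \int[leb]_t f (consrv (t, x)))%E.
Proof.
move=> fi; have fci := integrable_rVS fi.
rewrite [LHS](@integral_pushforward _ _ _ _ _ _ (@measurable_consrv R n)
  (leb \x mu n)%E setT f)//; last exact: measurable_int fi.
by rewrite preimage_setT -(integral21_prod_meas1 fci).
Qed.

Lemma measurable_consrvl n (t : R) :
  measurable_fun setT (fun x : 'rV[R]_n => consrv (t, x)).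
Proof.
apply: (measurableT_comp (@measurable_consrv R n)).
exact: measurable_fun_pair.
Qed.

End tonelli_rV.

(** The pushforward of a measure, with its structure of measure. *)
Definition pushforward_measure d d' (T : measurableType d) (T' : measurableType d')
    (R : realType) (m : {measure set T -> \bar R}) (f : T -> T')
    (mf : measurable_fun setT f) : {measure set T' -> \bar R}.
Proof. by refine [the measure T' R of pushforward m f]. Defined.

Section scaling.
Variable R : realType.
Local Notation leb := (@lebesgue_measure R).
Local Notation mu n := (lebesgue_rV R n).
Variables (s : R) (s0 : 0 < s).

(** The image of [lebesgue_measure] by a dilation is a multiple of it, by
    uniqueness of the measure of intervals. *)
Lemma ge0_integral_scale1 (f : R -> \bar R) :
  measurable_fun setT f -> (forall x, 0 <= f x)%E ->
  (\int[leb]_x f x = s%:E * \int[leb]_x f (s * x)%R)%E.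
Proof.
move=> mf f0.
pose phi (x : measurableTypeR R) : measurableTypeR R := s * x.
have mphi : measurable_fun setT phi by rewrite /phi; mfun.
pose nu : {measure set (measurableTypeR R) -> \bar R} :=
  mscale (NngNum (ltW s0)) (pushforward_measure leb mphi).
transitivity (\int[nu]_x f x)%E; last first.
  rewrite ge0_integral_mscale//=; congr (_ * _)%E.
  by rewrite (@ge0_integral_pushforward _ _ _ _ _ _ mphi leb setT f).
apply: eq_measure_integral => A mA _.
apply: (@lebesgue_measure_unique R nu) => // X [[a b] _ <-].
rewrite [RHS](_ : _ = s%:E * leb (phi @^-1` `]a, b]))%E//.
rewrite (_ : phi @^-1` _ = `]a / s, b / s]%classic); last first.
  apply/seteqP; split => x; rewrite /= !in_itv/= /phi ltr_pdivrMr// ler_pdivlMr//.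
    by rewrite !(mulrC x).
  by rewrite !(mulrC x).
rewrite !lebesgue_measure_itv/= !lte_fin ltr_pM2r ?invr_gt0//.
case: ifPn => _; last by rewrite mule0.
by rewrite -!EFinB -EFinM -mulrBl mulrCA divff ?gt_eqF// mulr1.
Qed.

Lemma measurable_scale_rV n : measurable_fun setT (fun x : 'rV[R]_n => s *: x).
Proof.
apply: (measurability (@open 'rV[R]_n)) => // _ [U oU <-].
rewrite setTI; apply: open_measurable_rV.
by apply: open_comp oU => x _; exact: (@scaler_continuous _ 'rV[R]_n s).
Qed.

Lemma ge0_integral_scale n (f : 'rV[R]_n -> \bar R) :
  measurable_fun setT f -> (forall x, 0 <= f x)%E ->
  (\int[mu n]_x f x = (s ^+ n)%:E * \int[mu n]_x f (s *: x)%R)%E.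
Proof.
elim: n f => [|n IH] f mf f0.
  rewrite !integral_rV0//.
    by rewrite expr0 mul1e scaler0.
  by apply: measurableT_comp => //; exact: measurable_scale_rV.
have mfs : measurable_fun setT (fun x : 'rV[R]_n.+1 => f (s *: x)).
  by apply: measurableT_comp => //; exact: measurable_scale_rV.
rewrite !ge0_integral_rVS//.
pose h t := (\int[mu n]_x f (consrv (t, x)))%E.
have mh : measurable_fun setT h.
  apply: (@measurable_fun_fubini_tonelli_F _ _ _ _ _ (mu n)
    (fun tx => f (consrv tx))) => //.
  by apply: measurableT_comp => //; exact: measurable_consrv.
have h0 t : (0 <= h t)%E by exact: integral_ge0.
rewrite [LHS]ge0_integral_scale1//.
rewrite exprS EFinM -[in RHS]muleA; congr (_ * _)%E.
rewrite -ge0_integralZl//=; last 3 first.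
- apply: (@measurable_fun_fubini_tonelli_F _ _ _ _ _ (mu n)
    (fun tx => f (s *: consrv tx))) => //.
  exact: (measurableT_comp mfs (@measurable_consrv R n)).
- by move=> t _; exact: integral_ge0.
- by rewrite lee_fin exprn_ge0// ltW.
apply: eq_integral => t _; rewrite /h IH//; last first.
  exact: (measurableT_comp mf (measurable_consrvl _)).
congr (_ * _)%E; apply: eq_integral => x _; congr f.
apply/rowP => j; rewrite [RHS]mxE; have [i ->|->] := unliftP ord0 j.
  by rewrite !consrvS mxE.
by rewrite !consrv0.
Qed.

End scaling.

(** * Gaussians and balls in dimension [n] *)

(** Euclidean scalar product of row vectors. *)
Definition dot (R : realType) n (x y : 'rV[R]_n) : R :=
  \sum_(i < n) x ord0 i * y ord0 i.

(** Squared Euclidean norm; the norm of the normed module of row vectors is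
    the sup norm. *)
Definition sqnorm (R : realType) n (x : 'rV[R]_n) : R := \sum_(i < n) x ord0 i ^+ 2.

Lemma subr_rVE (R : realType) n (x y : 'rV[R]_n) i :
  (x - y) ord0 i = x ord0 i - y ord0 i.
Proof. by rewrite !mxE. Qed.

Section euclidean.
Variables (R : realType) (n : nat).
Implicit Types x y : 'rV[R]_n.

Lemma sqnorm_ge0 x : 0 <= sqnorm x.
Proof. by apply: sumr_ge0 => i _; exact: sqr_ge0. Qed.

Lemma dotBr x y z : dot x (y - z) = dot x y - dot x z.
Proof. by rewrite /dot -sumrB; apply: eq_bigr => i _; rewrite !mxE mulrBr. Qed.

Lemma sqnormB x y : sqnorm (x - y) = sqnorm (y - x).
Proof. by apply: eq_bigr => i _; rewrite !mxE -sqrrN opprB. Qed.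

Lemma sqnormZ (s : R) x : sqnorm (s *: x) = s ^+ 2 * sqnorm x.
Proof. by rewrite /sqnorm mulr_sumr; apply: eq_bigr => i _; rewrite mxE exprMn. Qed.

Lemma measurable_sqnorm : measurable_fun setT (@sqnorm R n).
Proof.
by apply: measurable_sum => i; apply: measurable_funX; exact: measurable_coord.
Qed.

Lemma measurable_dotl y : measurable_fun setT (fun x => dot x y).
Proof.
by apply: measurable_sum => i; apply: measurable_funM => //; exact: measurable_coord.
Qed.

Lemma measurable_dotr x : measurable_fun setT (fun y => dot x y).
Proof.
by apply: measurable_sum => i; apply: measurable_funM => //; exact: measurable_coord.
Qed.

Lemma measurable_dot2 :
  measurable_fun setT (fun p : 'rV[R]_n * 'rV[R]_n => dot p.1 p.2).
Proof.
apply: measurable_sum => i; apply: measurable_funM.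
  exact: (measurableT_comp (measurable_coord i) measurable_fst).
exact: (measurableT_comp (measurable_coord i) measurable_snd).
Qed.

Lemma measurable_sqnormB y : measurable_fun setT (fun x => sqnorm (x - y)).
Proof.
rewrite /sqnorm.
under eq_fun do under eq_bigr do rewrite !mxE.
apply: measurable_sum => i; apply: measurable_funX; apply: measurable_funB => //.
exact: measurable_coord.
Qed.

Lemma measurable_sqnormB2 :
  measurable_fun setT (fun p : 'rV[R]_n * 'rV[R]_n => sqnorm (p.1 - p.2)).
Proof.
rewrite /sqnorm.
under eq_fun do under eq_bigr do rewrite !mxE.
apply: measurable_sum => i; apply: measurable_funX; apply: measurable_funB.
  exact: (measurableT_comp (measurable_coord i) measurable_fst).
exact: (measurableT_comp (measurable_coord i) measurable_snd).
Qed.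

Lemma dot_consrv (t : R) x (z : 'rV[R]_n.+1) :
  dot (consrv (t, x)) z = t * z ord0 ord0 + dot x (unconsrv z).2.
Proof.
rewrite /dot big_ord_recl consrv0; congr (_ + _).
by apply: eq_bigr => i _; rewrite consrvS mxE.
Qed.

Lemma sqnorm_consrv (t : R) x : sqnorm (consrv (t, x)) = t ^+ 2 + sqnorm x.
Proof.
rewrite /sqnorm big_ord_recl consrv0; congr (_ + _).
by apply: eq_bigr => i _; rewrite consrvS.
Qed.

Lemma sqnormB_consrv (t : R) x (z : 'rV[R]_n.+1) :
  sqnorm (consrv (t, x) - z) = (t - z ord0 ord0) ^+ 2 + sqnorm (x - (unconsrv z).2).
Proof.
rewrite /sqnorm big_ord_recl subr_rVE consrv0; congr (_ + _).
by apply: eq_bigr => i _; rewrite !subr_rVE consrvS mxE.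
Qed.

End euclidean.

Ltac mrv1 := first [ mfun1 | exact: measurable_sqnorm | exact: measurable_dotl
  | exact: measurable_dotr | exact: measurable_dot2 | exact: measurable_sqnormB
  | exact: measurable_sqnormB2
  | (apply: (measurableT_comp (@measurable_sqnorm _ _))) ].
Ltac mrv := repeat mrv1.

Section gaussian.
Variable R : realType.
Local Notation leb := (@lebesgue_measure R).
Local Notation mu n := (lebesgue_rV R n).
Variables (a : R) (a0 : 0 < a).

Lemma integral_gauss n (z : 'rV[R]_n) :
  (\int[mu n]_x (expR (- (a * sqnorm (x - z))))%:E = (Num.sqrt (pi / a) ^+ n)%:E)%E.
Proof.
elim: n z => [|n IH] z.
  rewrite integral_rV0; last by apply: measurable_EFin_fun; mrv.
  by rewrite /sqnorm big_ord0 mulr0 oppr0 expR0.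
rewrite ge0_integral_rVS//; last by apply: measurable_EFin_fun; mrv.
pose G := Num.sqrt (pi / a) ^+ n.
have G0 : 0 <= G by rewrite exprn_ge0// sqrtr_ge0.
transitivity (\int[leb]_t (G%:E * (expR (- (a * (t - z ord0 ord0) ^+ 2)))%:E))%E.
  apply: eq_integral => t _.
  under eq_integral do rewrite sqnormB_consrv mulrDr opprD expRD EFinM.
  rewrite ge0_integralZl//=; last by apply: measurable_EFin_fun; mrv.
  by rewrite IH muleC.
rewrite ge0_integralZl//=; last by apply: measurable_EFin_fun; mfun.
by rewrite integral_gauss1// -EFinM exprSr.
Qed.

Lemma integrable_gauss n (z : 'rV[R]_n) :
  (mu n).-integrable setT (EFin \o (fun x => expR (- (a * sqnorm (x - z))))).
Proof.
apply/integrableP; split; first by apply: measurable_EFin_fun; mrv.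
under eq_integral do rewrite /= ger0_norm ?expR_ge0//.
by rewrite integral_gauss ltry.
Qed.

Lemma integrable_gauss0 n :
  (mu n).-integrable setT (EFin \o (fun x => expR (- (a * sqnorm x)))).
Proof.
have := integrable_gauss (0 : 'rV[R]_n); apply: eq_integrable => // x _ /=.
by rewrite subr0.
Qed.

Lemma integrable_gauss_cos n (z : 'rV[R]_n) (th : R) : (mu n).-integrable setT
  (EFin \o (fun x => expR (- (a * sqnorm x)) * cos (dot x z + th))).
Proof.
apply: le_integrable_real (integrable_gauss0 n) => //; first by mrv.
by move=> x _; rewrite normrM (ger0_norm (expR_ge0 _)) ler_piMr ?expR_ge0// cos_max.
Qed.

(** The cosine transform of a Gaussian. The phase makes the induction on the
    dimension go through without addition formulas. *)
Lemma integral_gauss_cos n (z : 'rV[R]_n) (th : R) :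
  (\int[mu n]_x (expR (- (a * sqnorm x)) * cos (dot x z + th))%:E =
   (Num.sqrt (pi / a) ^+ n * expR (- (sqnorm z / (4 * a))) * cos th)%:E)%E.
Proof.
elim: n z th => [|n IH] z th.
  rewrite integral_rV0; last by apply: measurable_EFin_fun; mrv.
  by rewrite /sqnorm /dot !big_ord0 mul0r mulr0 oppr0 expR0 add0r !mul1r.
rewrite integral_rVS//; last exact: integrable_gauss_cos.
set z0 := z ord0 ord0; set z' := (unconsrv z).2.
pose C := Num.sqrt (pi / a) ^+ n * expR (- (sqnorm z' / (4 * a))).
transitivity (\int[leb]_t (C * (expR (- (a * t ^+ 2)) * cos (z0 * t + th)))%:E)%E.
  apply: eq_integral => t _.
  transitivity ((expR (- (a * t ^+ 2)))%:E *
    \int[mu n]_x (expR (- (a * sqnorm x)) * cos (dot x z' + (z0 * t + th)))%:E)%E.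
    rewrite -integralZl//; last exact: integrable_gauss_cos.
    apply: eq_integral => x _; rewrite -EFinM sqnorm_consrv dot_consrv -/z0 -/z'.
    by rewrite mulrDr opprD expRD -mulrA (mulrC t) (addrC (z0 * t)) addrA.
  by rewrite IH -EFinM mulrCA.
have ig : leb.-integrable setT (EFin \o (fun t => expR (- (a * t ^+ 2)) * cos (z0 * t + th))).
  have := integrable_gauss1 0 a0; apply: le_integrable_real => //; first by mfun.
  move=> t _; rewrite subr0 normrM (ger0_norm (expR_ge0 _)) ler_piMr ?expR_ge0//.
  exact: cos_max.
rewrite RintegralE_fin//; last exact: integrable_scale.
rewrite RintegralZl// Rintegral_gauss1_cos// /C; congr EFin.
have -> : sqnorm z = z0 ^+ 2 + sqnorm z'.
  rewrite -{1}(unconsrvK z) -/(unconsrv z) [unconsrv z]surjective_pairing.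
  by rewrite sqnorm_consrv.
by rewrite (mulrDl (z0 ^+ 2)) opprD expRD (exprS _ n); ring.
Qed.

End gaussian.

Section ball_measure.
Variables (R : realType) (n : nat).
Local Notation mu := (lebesgue_rV R n).

Lemma measurable_sqnorm_lt (r : R) : measurable [set x : 'rV[R]_n | sqnorm x < r].
Proof.
rewrite (_ : mkset _ = setT `&` @sqnorm R n @^-1` `]-oo, r[%classic).
  exact: measurable_sqnorm.
by rewrite setTI; apply/seteqP; split => x; rewrite /= in_itv.
Qed.

Lemma unit_ball_measure :
  mu [set x | sqnorm x < 1] = (omega R n)%:E.
Proof.
rewrite /omega fineK// ge0_fin_numE//.
apply: (@le_lt_trans _ _ (mu [set x | forall i, -1 <= x ord0 i <= 1])).
  apply: le_measure; rewrite ?inE.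
  - exact: measurable_sqnorm_lt.
  - exact: measurable_rV_box.
  - move=> x /= x1 i; rewrite -ler_norml -(@ler_pXn2r _ 2)// ?nnegrE//.
    rewrite real_normK ?num_real// expr1n; apply: le_trans (ltW x1).
    by rewrite /sqnorm (bigD1 i)//= lerDl sumr_ge0// => j _; exact: sqr_ge0.
by rewrite (@lebesgue_rV_box _ _ (fun=> -1) (fun=> 1)) ?ltry.
Qed.

Lemma ball_measure (r : R) : 0 < r ->
  mu [set x | sqnorm x < r ^+ 2] = (r ^+ n * omega R n)%:E.
Proof.
move=> r0; have mB := @measurable_sqnorm_lt (r ^+ 2).
pose B := [set x : 'rV[R]_n | sqnorm x < r ^+ 2].
have -> : mu B = (\int[mu]_x (\1_B x)%:E)%E by rewrite integral_indic// setIT.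
rewrite (ge0_integral_scale r0)//; last first.
  by apply/measurable_EFinP; exact: measurable_indic.
rewrite EFinM; congr (_ * _)%E.
have mB1 := @measurable_sqnorm_lt 1.
rewrite -unit_ball_measure -[RHS](congr1 mu (setIT _)) -integral_indic//.
apply: eq_integral => x _; rewrite !indicE; congr ((nat_of_bool _)%:R%:E).
have E q : (r ^+ 2 * q < r ^+ 2) = (q < 1).
  by rewrite -[X in _ < X]mulr1 ltr_pM2l ?exprn_gt0.
by apply/idP/idP; rewrite !inE /B /= sqnormZ E.
Qed.

End ball_measure.

(** * Integration of a partial derivative *)

Section integration_by_parts.
Variable R : realType.
Local Notation leb := (@lebesgue_measure R).
Local Notation mu n := (lebesgue_rV R n).

(** The function vanishes outside the cube of half-side [M]. *)
Definition zero_outside n (M : R) (f : 'rV[R]_n -> R) :=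
  forall x : 'rV[R]_n, (exists i, M < `|x ord0 i|) -> f x = 0.

(** The closed cube of half-side [M] centred at the origin. *)
Definition cube n (M : R) : set 'rV[R]_n := [set x | forall i, - M <= x ord0 i <= M].

Lemma notin_cube n M (x : 'rV[R]_n) : ~ cube M x -> exists i, M < `|x ord0 i|.
Proof.
move=> /existsNP[i /negP]; rewrite -ler_norml -ltNge => Mx.
by exists i.
Qed.

Lemma cube_compact n M : compact (@cube n M).
Proof.
rewrite (_ : cube M = [set v : 'rV[R]_n | forall i, `[- M, M]%classic (v ord0 i)]).
  by apply: (@rV_compact R n (fun=> `[- M, M]%classic)) => i; exact: segment_compact.
by apply/seteqP; split => x /= h i; have := h i; rewrite /= in_itv.
Qed.

Lemma measurable_cube n M : measurable (@cube n M).
Proof. exact: (@measurable_rV_box R n (fun=> - M) (fun=> M)). Qed.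

Lemma zero_outside_bounded n M (f : 'rV[R]_n -> R) : 0 <= M ->
  continuous f -> zero_outside M f -> exists C, forall x, `|f x| <= C.
Proof.
move=> M0 cf f0.
have [||c _ fc] := @EVT_max_rV R n (fun x => `|f x|) (cube M) _ (@cube_compact n M).
- by exists 0 => i; rewrite mxE; lra.
- apply: continuous_subspaceT => x; apply: continuous_comp; first exact: cf.
  exact: norm_continuous.
exists `|f c| => x; have [Mx|/notin_cube Mx] := pselect (cube M x).
  by apply: fc; rewrite inE.
by rewrite f0// normr0.
Qed.

Lemma zero_outside_integrable n M (f : 'rV[R]_n -> R) : 0 <= M ->
  continuous f -> zero_outside M f -> (mu n).-integrable setT (EFin \o f).
Proof.
move=> M0 cf f0; have [C fC] := zero_outside_bounded M0 cf f0.
apply: (@le_integrable_real _ _ _ _ _ measurableT _ (fun x => C * \1_(cube M) x)).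
- exact: continuous_measurable_rV.
- move=> x _; rewrite indicE; case: (boolP (x \in cube M)) => [_|/negP].
    by rewrite mulr1.
  by rewrite inE => /notin_cube /f0 ->; rewrite normr0 mulr0.
- apply: integrable_scale => //; apply/integrableP; split.
    by apply/measurable_EFinP/measurable_indic; exact: measurable_cube.
  under eq_integral do rewrite /= ger0_norm//.
  rewrite integral_indic//; last exact: measurable_cube.
  rewrite setIT [X in (X < _)%E](@lebesgue_rV_box R n (fun=> - M) (fun=> M)) ?ltry//.
  by move=> _; lra.
Qed.

Lemma continuous_consrvl n (t : R) : continuous (fun x : 'rV[R]_n => consrv (t, x)).
Proof.
move=> x A /nbhs_ballP[e /= e0 eA]; apply/nbhs_ballP; exists e => // y [_ xy].
apply: eA; split => // i j; rewrite (ord1 i); have [k ->|->] := unliftP ord0 j.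
  by rewrite !consrvS; exact: xy.
by rewrite !consrv0; exact: ballxx.
Qed.

Lemma continuous_consrvr n (x : 'rV[R]_n) : continuous (fun t : R => consrv (t, x)).
Proof.
move=> t A /nbhs_ballP[e /= e0 eA]; apply/nbhs_ballP; exists e => // u tu.
apply: eA; split => // i j; rewrite (ord1 i); have [k ->|->] := unliftP ord0 j.
  by rewrite !consrvS; exact: ballxx.
by rewrite !consrv0.
Qed.

Lemma shift_consrv0 n (h t : R) (x : 'rV[R]_n) :
  h *: delta_mx ord0 ord0 + consrv (t, x) = consrv (h + t, x).
Proof.
apply/rowP => j; rewrite [LHS]mxE [X in X + _]mxE [X in _ * X + _]mxE eqxx/=.
have [k ->|->] := unliftP ord0 j.
  by rewrite !consrvS mulr0 add0r.
by rewrite !consrv0 mulr1.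
Qed.

Lemma shift_consrvS n (h t : R) (i : 'I_n) (x : 'rV[R]_n) :
  h *: delta_mx ord0 (lift ord0 i) + consrv (t, x) =
  consrv (t, h *: delta_mx ord0 i + x).
Proof.
apply/rowP => j; rewrite [LHS]mxE [X in X + _]mxE [X in _ * X + _]mxE eqxx/=.
have [k ->|->] := unliftP ord0 j.
  by rewrite !consrvS !mxE eqxx/= (inj_eq lift_inj).
by rewrite !consrv0 mulr0 add0r.
Qed.

Lemma zero_outside_partial n M (f : 'rV[R]_n -> R) i :
  zero_outside M f -> zero_outside M (partial i f).
Proof.
move=> f0 x [j Mxj]; rewrite /partial.
have fE : \forall y \near x, f y = cst 0 y.
  have e0 : 0 < `|x ord0 j| - M by rewrite subr_gt0.
  near=> y; rewrite f0//; exists j.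
  have [_ /(_ ord0 j)] : ball x (`|x ord0 j| - M) y.
    by near: y; exact: nbhsx_ballx.
  rewrite /ball/= => xy; have := ler_dist_dist (x ord0 j) (y ord0 j).
  by move=> /le_lt_trans/(_ xy); rewrite ltr_norml; lra.
by rewrite (near_eq_derive _ fE) derive_cst.
Unshelve. all: end_near. Qed.

(** By induction on the dimension: the first variable is integrated out by the
    fundamental theorem of calculus, the others by the induction hypothesis on
    each slice. *)
Lemma integral_partial_eq0 n M (f : 'rV[R]_n -> R) i : 0 <= M ->
  continuous f -> (forall x, derivable f x (delta_mx ord0 i)) ->
  continuous (partial i f) -> zero_outside M f ->
  (\int[mu n]_x (partial i f x)%:E = 0)%E.
Proof.
move=> M0; elim: n f i => [|n IH] f i cf df cdf f0; first by case: i df cdf => -[].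
have pf0 := zero_outside_partial i f0.
have int_pf := zero_outside_integrable M0 cdf pf0.
have [j iE|iE] := unliftP ord0 i; subst i.
  rewrite integral_rVS//; apply: integral0_eq => t _.
  pose g (x : 'rV[R]_n) := f (consrv (t, x)).
  (* The difference quotients of a slice are those of [f]. *)
  have shiftE h (x : 'rV[R]_n) : (f \o shift (consrv (t, x))) (h *: delta_mx ord0 (lift ord0 j)) =
      (g \o shift x) (h *: delta_mx ord0 j).
    by rewrite /= shift_consrvS.
  have gE : partial j g = fun x => partial (lift ord0 j) f (consrv (t, x)).
    apply/funext => x; rewrite /partial /derive.
    by under [in RHS]eq_fun do rewrite shiftE.
  have -> : (fun x => (partial (lift ord0 j) f (consrv (t, x)))%:E) =
      (fun x => (partial j g x)%:E) by rewrite gE.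
  apply: IH.
  - move=> x; apply: continuous_comp; [exact: continuous_consrvl|exact: cf].
  - move=> x; have := df (consrv (t, x)); rewrite /derivable.
    by under eq_fun do rewrite shiftE.
  - rewrite gE => x; apply: continuous_comp; [exact: continuous_consrvl|exact: cdf].
  - move=> x [k Mk]; apply: f0; exists (lift ord0 k); by rewrite consrvS.
rewrite integral_rVS_swap//; apply: integral0_eq => x _.
pose g (t : R) := f (consrv (t, x)).
pose dg (t : R) := partial ord0 f (consrv (t, x)).
have shiftE h (t : R) : (f \o shift (consrv (t, x))) (h *: delta_mx ord0 ord0) =
    (g \o shift t) (h *: 1).
  by rewrite /= shift_consrv0 scaler1.
have dgE (t : R) : is_derive t (1 : R) g (dg t).
  apply: DeriveDef.
    have := df (consrv (t, x)); rewrite /derivable.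
    by under eq_fun do rewrite shiftE.
  rewrite /dg /partial /derive.
  by under [in RHS]eq_fun do rewrite shiftE.
have cdg : continuous dg.
  by move=> t; apply: continuous_comp; [exact: continuous_consrvr|exact: cdf].
have g0 (t : R) : M < `|t| -> g t = 0.
  by move=> Mt; apply: f0; exists ord0; rewrite consrv0.
have dg0 (t : R) : M < `|t| -> dg t = 0.
  by move=> Mt; apply: pf0; exists ord0; rewrite consrv0.
have [C pfC] := zero_outside_bounded M0 cdf pf0.
apply: (integral_derive_eq0 dgE cdg).
- apply: (@le_integrable_real _ _ R leb setT measurableT dg
    (fun x : R => C * \1_(`[- M, M]%classic) x)).
  + exact: continuous_measurable_fun.
  + move=> t _; rewrite indicE; case: (boolP (t \in _)) => [_|].
      by rewrite mulr1; exact: pfC.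
    rewrite notin_setE/= in_itv/= -ler_norml => /negP.
    by rewrite -ltNge => /dg0 ->; rewrite normr0 mulr0.
  + apply: integrable_scale => //; apply/integrableP; split.
      by apply/measurable_EFinP/measurable_indic.
    under eq_integral do rewrite /= ger0_norm//.
    rewrite integral_indic// setIT [X in (X < _)%E](lebesgue_measure_itv `[- M, M])/=.
    by case: ifP; rewrite -?EFinB ltry.
- apply: cvg_near_cst; near=> k; apply: g0; rewrite normr_nat.
  by near: k; exact: nbhs_infty_gtr.
- apply: cvg_near_cst; near=> k; apply: g0; rewrite normrN normr_nat.
  by near: k; exact: nbhs_infty_gtr.
Unshelve. all: end_near. Qed.

End integration_by_parts.

(** * The Fourier transform and its Gaussian regularization *)

Section fubini_real.
Context d1 d2 (T1 : measurableType d1) (T2 : measurableType d2) (R : realType).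
Variables (m1 : {sigma_finite_measure set T1 -> \bar R}).
Variables (m2 : {sigma_finite_measure set T2 -> \bar R}).

Lemma Rintegral_Fubini (f : T1 * T2 -> R) :
  (m1 \x m2)%E.-integrable setT (EFin \o f) ->
  (forall x, m2.-integrable setT (EFin \o (fun y => f (x, y)))) ->
  (forall y, m1.-integrable setT (EFin \o (fun x => f (x, y)))) ->
  \int[m1]_x \int[m2]_y f (x, y) = \int[m2]_y \int[m1]_x f (x, y).
Proof.
move=> fi fi1 fi2; have := Fubini fi => H.
rewrite /Rintegral; congr fine; transitivity (\int[m1]_x \int[m2]_y (EFin \o f) (x, y))%E.
  by apply: eq_integral => x _; rewrite fineK//; exact: integrable_fin_num (fi1 x).
rewrite H; apply: eq_integral => y _.
by rewrite fineK//; exact: integrable_fin_num (fi2 y).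
Qed.

Lemma integrable_prodM (f : T1 -> R) (g : T2 -> R) :
  m1.-integrable setT (EFin \o f) -> m2.-integrable setT (EFin \o g) ->
  (m1 \x m2)%E.-integrable setT (EFin \o (fun p => f p.1 * g p.2)).
Proof.
move=> fi gi.
have mf : measurable_fun setT f by apply/measurable_EFinP; exact: measurable_int fi.
have mg : measurable_fun setT g by apply/measurable_EFinP; exact: measurable_int gi.
apply/integrable12ltyP.
  apply: measurable_EFin_fun; apply: measurable_funM.
    exact: (measurableT_comp mf measurable_fst).
  exact: (measurableT_comp mg measurable_snd).
have /integrableP[_ foo] := fi; have /integrableP[_ goo] := gi.
under eq_integral => x _.
  under eq_integral do rewrite /= normrM EFinM.
  rewrite ge0_integralZl//=; first last.
    by apply: measurable_EFin_fun; apply: measurableT_comp.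
  over.
rewrite ge0_integralZr//=; first last.
- exact: integral_ge0.
- by apply: measurable_EFin_fun; apply: measurableT_comp.
by rewrite lte_mul_pinfty// ?integral_ge0// ge0_fin_numE// integral_ge0.
Qed.

End fubini_real.

Section fourier.
Variables (R : realType) (n : nat).
Local Notation mu := (lebesgue_rV R n).
Implicit Types (u psi : 'rV[R]_n -> R) (xi x y : 'rV[R]_n).

(** Real and (up to sign) imaginary part of the unnormalized Fourier transform;
    real integrals avoid complex-valued functions. *)
Definition fcos u xi : R := \int[mu]_x (u x * cos (dot xi x)).
Definition fsin u xi : R := \int[mu]_x (u x * sin (dot xi x)).

(** Squared modulus of the Fourier transform. *)
Definition power u xi : R := fcos u xi ^+ 2 + fsin u xi ^+ 2.

Lemma power_ge0 u xi : 0 <= power u xi.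
Proof. by rewrite addr_ge0// sqr_ge0. Qed.

(** The squared [L^2] norm of the Fourier transform, regularized by a Gaussian. *)
Definition energy a u : R := \int[mu]_xi (expR (- (a * sqnorm xi)) * power u xi).

(** The Fourier transform of the Gaussian regularization: a heat kernel of
    total mass [(2 pi)^n]. *)
Definition heat a x : R :=
  Num.sqrt (pi / a) ^+ n * expR (- (sqnorm x / (4 * a))).

Lemma heat_ge0 a x : 0 <= heat a x.
Proof. by rewrite mulr_ge0 ?exprn_ge0 ?sqrtr_ge0 ?expR_ge0. Qed.

Lemma measurable_heatB a x : measurable_fun setT (fun y => heat a (x - y)).
Proof.
have -> : (fun y => heat a (x - y)) = fun y => heat a (y - x).
  by apply/funext => y; rewrite /heat sqnormB.
by rewrite /heat; mrv.
Qed.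

Lemma integral_heat a x : 0 < a ->
  (\int[mu]_y (heat a (x - y))%:E = ((2 * pi) ^+ n)%:E)%E.
Proof.
move=> a0; have a40 : 0 < (4 * a)^-1 by rewrite invr_gt0 mulr_gt0.
under eq_integral do rewrite /heat sqnormB (mulrC _ (4 * a)^-1) EFinM.
rewrite ge0_integralZl//=; first last.
- by apply: measurable_EFin_fun; mrv.
rewrite integral_gauss// -EFinM -exprMn -sqrtrM ?divr_ge0 ?pi_ge0 ?ltW//.
have -> : pi / a * (pi / (4 * a)^-1) = (2 * pi) ^+ 2 :> R.
  by field; rewrite gt_eqF.
by rewrite sqrtr_sqr ger0_norm// mulr_ge0// pi_ge0.
Qed.

Section fixed_function.
Variable u : 'rV[R]_n -> R.
Hypothesis ui : mu.-integrable setT (EFin \o u).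

Let mu_u : measurable_fun setT u.
Proof. by apply/measurable_EFinP; exact: measurable_int ui. Qed.

Let uni : mu.-integrable setT (EFin \o (fun x => `|u x|)).
Proof.
exact: (integrable_abse ui).
Qed.

Lemma integrable_mul_bounded (h : 'rV[R]_n -> R) (C : R) :
  measurable_fun setT h -> (forall x, `|h x| <= C) ->
  mu.-integrable setT (EFin \o (fun x => u x * h x)).
Proof.
move=> mh hC.
apply: (@le_integrable_real _ _ _ _ _ measurableT _ (fun x => C * `|u x|)).
- by apply: measurable_funM.
- by move=> x _; rewrite normrM mulrC ler_wpM2r.
- exact: integrable_scale.
Qed.

Lemma integrable_mul_cos xi :
  mu.-integrable setT (EFin \o (fun x => u x * cos (dot xi x))).
Proof. by apply: (@integrable_mul_bounded _ 1); [mrv|move=> x; exact: cos_max]. Qed.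

Lemma integrable_mul_sin xi :
  mu.-integrable setT (EFin \o (fun x => u x * sin (dot xi x))).
Proof.
apply: (@integrable_mul_bounded _ 1); [mrv|move=> x].
by rewrite ler_norml sin_geN1 sin_le1.
Qed.

Let N := \int[mu]_x `|u x|.

Let fcos_le xi : `|fcos u xi| <= N.
Proof.
apply: le_trans (le_normr_Rintegral _ (integrable_mul_cos xi)) _ => //.
apply: le_Rintegral => //.
- apply: le_integrable_real uni => //.
    by apply: measurableT_comp => //; apply: measurable_funM => //; mrv.
  by move=> x _; rewrite normr_id normrM ler_piMr// cos_max.
- by move=> x _; rewrite normrM ler_piMr// cos_max.
Qed.

Let fsin_le xi : `|fsin u xi| <= N.
Proof.
have sin_max (t : R) : `|sin t| <= 1 by rewrite ler_norml sin_geN1 sin_le1.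
apply: le_trans (le_normr_Rintegral _ (integrable_mul_sin xi)) _ => //.
apply: le_Rintegral => //.
- apply: le_integrable_real uni => //.
    by apply: measurableT_comp => //; apply: measurable_funM => //; mrv.
  by move=> x _; rewrite normr_id normrM ler_piMr.
- by move=> x _; rewrite normrM ler_piMr.
Qed.

(* A Gaussian factor in [xi] makes the integrand integrable on the product. *)
Let measurable_ftrans (tr : R -> R) : measurable_fun setT tr ->
    (forall t, `|tr t| <= 1) ->
  measurable_fun setT (fun xi => \int[mu]_x (u x * tr (dot xi x))).
Proof.
move=> mtr tr1.
pose w xi : R := expR (- (1 * sqnorm xi)).
have wi : mu.-integrable setT (EFin \o w) by exact: integrable_gauss0.
pose f (p : 'rV[R]_n * 'rV[R]_n) := w p.1 * (u p.2 * tr (dot p.1 p.2)).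
have fi : (mu \x mu)%E.-integrable setT (EFin \o f).
  apply: le_integrable_real (integrable_prodM wi uni) => //.
    apply: measurable_funM.
      by apply: (measurableT_comp _ measurable_fst); rewrite /w; mrv.
    apply: measurable_funM; first exact: (measurableT_comp mu_u measurable_snd).
    by apply: measurableT_comp => //; mrv.
  move=> p _; rewrite /f !normrM (ger0_norm (expR_ge0 _)) ler_wpM2l ?expR_ge0//.
  by rewrite ler_piMr.
have mF := measurable_fubini_F fi.
have -> : (fun xi => \int[mu]_x (u x * tr (dot xi x))) =
    (fun xi => (w xi)^-1 * fine (fubini_F mu (EFin \o f) xi)).
  apply/funext => xi.
  have -> : fine (fubini_F mu (EFin \o f) xi) = w xi * \int[mu]_x (u x * tr (dot xi x)).
    rewrite -RintegralZl//; apply: (@integrable_mul_bounded _ 1) => //.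
    by apply: measurableT_comp => //; mrv.
  by rewrite mulrA mulVf ?mul1r// gt_eqF// expR_gt0.
apply: measurable_funM; last exact: measurableT_comp.
have -> : (fun xi => (w xi)^-1) = (fun xi => expR (1 * sqnorm xi)).
  by apply/funext => xi; rewrite /w expRN invrK.
by mrv.
Qed.

Lemma measurable_fcos : measurable_fun setT (fcos u).
Proof. by apply: measurable_ftrans; [exact: measurable_cos|exact: cos_max]. Qed.

Lemma measurable_fsin : measurable_fun setT (fsin u).
Proof.
apply: measurable_ftrans; first exact: measurable_sin.
by move=> t; rewrite ler_norml sin_geN1 sin_le1.
Qed.

Lemma measurable_power : measurable_fun setT (power u).
Proof.
by apply: measurable_funD; apply: measurable_funX;
  [exact: measurable_fcos|exact: measurable_fsin].
Qed.

Variables (a : R) (a0 : 0 < a).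
Let w xi : R := expR (- (a * sqnorm xi)).

Let wi : mu.-integrable setT (EFin \o w).
Proof. exact: integrable_gauss0. Qed.

Let mw : measurable_fun setT w.
Proof. by rewrite /w; mrv. Qed.

Let sin_max (t : R) : `|sin t| <= 1.
Proof. by rewrite ler_norml sin_geN1 sin_le1. Qed.

Let w_mul_bounded (h : 'rV[R]_n -> R) (C : R) :
  measurable_fun setT h -> (forall x, `|h x| <= C) ->
  mu.-integrable setT (EFin \o (fun x => w x * h x)).
Proof.
move=> mh hC.
apply: (@le_integrable_real _ _ _ _ _ measurableT _ (fun x => C * w x)).
- exact: measurable_funM.
- by move=> x _; rewrite normrM (ger0_norm (expR_ge0 _)) mulrC ler_wpM2r ?expR_ge0.
- exact: integrable_scale.
Qed.

Lemma integrable_energy : mu.-integrable setT (EFin \o (fun xi => w xi * power u xi)).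
Proof.
apply: (@w_mul_bounded _ (N ^+ 2 + N ^+ 2)); first exact: measurable_power.
move=> xi; rewrite ger0_norm ?power_ge0// lerD// -(real_normK (num_real _)).
  by rewrite ler_pXn2r ?nnegrE// (le_trans _ (fcos_le xi)).
by rewrite ler_pXn2r ?nnegrE// (le_trans _ (fsin_le xi)).
Qed.

Let inner x : \int[mu]_xi (w xi * (fcos u xi * cos (dot xi x) + fsin u xi * sin (dot xi x))) =
  \int[mu]_y (u y * heat a (x - y)).
Proof.
pose f (p : 'rV[R]_n * 'rV[R]_n) := w p.1 * (u p.2 * cos (dot p.1 (x - p.2))).
have mdB : measurable_fun setT (fun p : 'rV[R]_n * 'rV[R]_n => dot p.1 (x - p.2)).
  by under eq_fun do rewrite dotBr; apply: measurable_funB; [|mrv];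
    exact: (measurableT_comp (measurable_dotl x) measurable_fst).
have mdB1 xi : measurable_fun setT (fun y : 'rV[R]_n => dot xi (x - y)).
  by under eq_fun do rewrite dotBr; mrv.
have fi : (mu \x mu)%E.-integrable setT (EFin \o f).
  apply: le_integrable_real (integrable_prodM wi uni) => //.
    apply: measurable_funM; first exact: (measurableT_comp mw measurable_fst).
    apply: measurable_funM; first exact: (measurableT_comp mu_u measurable_snd).
    by apply: measurableT_comp; [exact: measurable_cos|].
  move=> p _; rewrite /f !normrM (ger0_norm (expR_ge0 _)) ler_wpM2l ?expR_ge0//.
  by rewrite ler_piMr// cos_max.
have ucos xi : mu.-integrable setT (EFin \o (fun y => u y * cos (dot xi (x - y)))).
  apply: (@integrable_mul_bounded _ 1) => [|y]; last exact: cos_max.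
  by apply: measurableT_comp; [exact: measurable_cos|].
transitivity (\int[mu]_xi \int[mu]_y f (xi, y)).
  apply: eq_Rintegral => xi _; rewrite /f/= RintegralZl//; congr (_ * _).
  rewrite /fcos /fsin -!RintegralZr//; first last.
  - exact: integrable_mul_cos.
  - exact: integrable_mul_sin.
  rewrite -RintegralD//; first last.
  - under eq_fun do rewrite mulrC; apply: integrable_scale => //.
    exact: integrable_mul_sin.
  - under eq_fun do rewrite mulrC; apply: integrable_scale => //.
    exact: integrable_mul_cos.
  apply: eq_Rintegral => y _; rewrite dotBr cosB; ring.
rewrite (Rintegral_Fubini fi); first last.
- move=> y; apply: (@w_mul_bounded (fun xi => u y * cos (dot xi (x - y))) `|u y|) => [|xi].
    apply: measurable_funM => //.
    exact: (measurableT_comp (@measurable_cos R) (measurable_dotl (x - y))).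
  by rewrite normrM ler_piMr// cos_max.
- by move=> xi; exact: (integrable_scale measurableT (w xi) (ucos xi)).
apply: eq_Rintegral => y _; rewrite /f/=.
under eq_Rintegral do rewrite mulrCA.
rewrite RintegralZl//; last first.
  by apply: (@w_mul_bounded _ 1) => [|xi]; [mrv|exact: cos_max].
congr (_ * _); rewrite /Rintegral.
under eq_integral do rewrite -[dot _ _]addr0.
by rewrite integral_gauss_cos// cos0 mulr1.
Qed.

(** The regularized Plancherel identity, by two applications of Fubini's theorem
    and the formula for the transform of a Gaussian. *)
Lemma energyE : energy a u = \int[mu]_x (u x * \int[mu]_y (u y * heat a (x - y))).
Proof.
pose f (p : 'rV[R]_n * 'rV[R]_n) := w p.1 *
  (u p.2 * (fcos u p.1 * cos (dot p.1 p.2) + fsin u p.1 * sin (dot p.1 p.2))).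
have bnd xi x : `|fcos u xi * cos (dot xi x) + fsin u xi * sin (dot xi x)| <= N + N.
  apply: le_trans (ler_normD _ _) _; rewrite !normrM; apply: lerD.
    by apply: le_trans (fcos_le xi); rewrite ler_piMr// cos_max.
  by apply: le_trans (fsin_le xi); rewrite ler_piMr.
pose g xi x := fcos u xi * cos (dot xi x) + fsin u xi * sin (dot xi x).
have mg xi : measurable_fun setT (g xi).
  by apply: measurable_funD; apply: measurable_funM; mrv.
have mg' x : measurable_fun setT (g ^~ x).
  apply: measurable_funD; apply: measurable_funM; try by mrv.
    exact: measurable_fcos.
  exact: measurable_fsin.
have ug xi : mu.-integrable setT (EFin \o (fun x => u x * g xi x)).
  exact: (integrable_mul_bounded (mg xi) (bnd xi)).
have fi : (mu \x mu)%E.-integrable setT (EFin \o f).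
  apply: le_integrable_real (integrable_scale _ (N + N) (integrable_prodM wi uni)) => //.
    apply: measurable_funM; first exact: (measurableT_comp mw measurable_fst).
    apply: measurable_funM; first exact: (measurableT_comp mu_u measurable_snd).
    apply: measurable_funD; apply: measurable_funM.
    - exact: (measurableT_comp measurable_fcos measurable_fst).
    - by mrv.
    - exact: (measurableT_comp measurable_fsin measurable_fst).
    - by mrv.
  move=> p _; rewrite /f !normrM (ger0_norm (expR_ge0 _)) [leRHS]mulrCA ler_wpM2l ?expR_ge0//.
  by rewrite mulrC ler_wpM2r.
have fx xi : mu.-integrable setT (EFin \o (fun x => f (xi, x))).
  exact: (integrable_scale measurableT (w xi) (ug xi)).
transitivity (\int[mu]_xi \int[mu]_x f (xi, x)).
  apply: eq_Rintegral => xi _; rewrite /f/= RintegralZl//; last exact: ug.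
  congr (_ * _); rewrite /power !expr2 {2}/fcos {2}/fsin -!RintegralZl//; first last.
  - exact: integrable_mul_cos.
  - exact: integrable_mul_sin.
  rewrite -RintegralD//; first last.
  - by apply: integrable_scale => //; exact: integrable_mul_sin.
  - by apply: integrable_scale => //; exact: integrable_mul_cos.
  by apply: eq_Rintegral => x _; ring.
rewrite (Rintegral_Fubini fi)//; last first.
  move=> x; apply: (@w_mul_bounded (fun xi => u x * g xi x) (`|u x| * (N + N))).
    by apply: measurable_funM.
  by move=> xi; rewrite normrM ler_wpM2l//; exact: bnd.
apply: eq_Rintegral => x _; rewrite -inner /f/=.
under eq_Rintegral do rewrite mulrCA.
rewrite RintegralZl//.
by apply: (@w_mul_bounded (g ^~ x) (N + N)) => // xi; exact: bnd.
Qed.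

End fixed_function.
End fourier.

(** * Plancherel's theorem *)

Section plancherel.
Variables (R : realType) (n : nat).
Local Notation mu := (lebesgue_rV R n).
Implicit Types (u psi : 'rV[R]_n -> R) (xi x y : 'rV[R]_n).

Lemma heatN (a : R) x y : heat a (x - y) = heat a (y - x).
Proof. by rewrite /heat sqnormB. Qed.

Lemma measurable_heat2 (a : R) :
  measurable_fun setT (fun p : 'rV[R]_n * 'rV[R]_n => heat a (p.1 - p.2)).
Proof. by rewrite /heat; mrv. Qed.

Lemma heat_le (a : R) x : 0 < a -> heat a x <= Num.sqrt (pi / a) ^+ n.
Proof.
move=> a0; rewrite /heat ler_piMr ?exprn_ge0 ?sqrtr_ge0//.
by rewrite -expR0 ler_expR oppr_le0 divr_ge0 ?sqnorm_ge0// mulr_ge0// ltW.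
Qed.

Lemma integrable_heat (a : R) x : 0 < a ->
  mu.-integrable setT (EFin \o (fun y => heat a (x - y))).
Proof.
move=> a0; apply/integrableP; split.
  by apply: measurable_EFin_fun; exact: measurable_heatB.
under eq_integral do rewrite /= ger0_norm ?heat_ge0//.
by rewrite integral_heat// ltry.
Qed.

Lemma integrable_mul_heat (a : R) u x : 0 < a -> mu.-integrable setT (EFin \o u) ->
  mu.-integrable setT (EFin \o (fun y => u y * heat a (x - y))).
Proof.
move=> a0 ui; apply: (integrable_mul_bounded ui (measurable_heatB a x)) => y.
by rewrite ger0_norm ?heat_ge0//; exact: heat_le.
Qed.

Lemma integrable_heat_form (a : R) u : 0 < a -> mu.-integrable setT (EFin \o u) ->
  (mu \x mu)%E.-integrable setT
    (EFin \o (fun p => u p.1 * (u p.2 * heat a (p.1 - p.2)))).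
Proof.
move=> a0 ui.
have mu_u : measurable_fun setT u by apply/measurable_EFinP; exact: measurable_int ui.
pose C := Num.sqrt (pi / a) ^+ n.
have hC x : `|heat a x| <= C by rewrite ger0_norm ?heat_ge0// heat_le.
have uni : mu.-integrable setT (EFin \o (fun x => `|u x|)) by exact: (integrable_abse ui).
apply: le_integrable_real (integrable_scale _ C (integrable_prodM uni uni)) => //.
  apply: measurable_funM; first exact: (measurableT_comp mu_u measurable_fst).
  apply: measurable_funM; first exact: (measurableT_comp mu_u measurable_snd).
  exact: measurable_heat2.
move=> p _; rewrite normrM (normrM (u p.2)) mulrA mulrC.
by apply: ler_wpM2r; [exact: mulr_ge0|exact: hC].
Qed.

Lemma heat_formE (a : R) u x : 0 < a -> mu.-integrable setT (EFin \o u) ->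
  fubini_F mu (EFin \o (fun p => u p.1 * (u p.2 * heat a (p.1 - p.2)))) x =
  (u x * \int[mu]_y (u y * heat a (x - y)))%:E.
Proof.
move=> a0 ui; have uh := integrable_mul_heat x a0 ui.
rewrite /fubini_F/= -RintegralZl// RintegralE_fin//.
exact: (integrable_scale measurableT (u x) uh).
Qed.

(** From [u x * u y <= (u x ^+ 2 + u y ^+ 2) / 2] and the mass of the kernel. *)
Lemma energy_le (a : R) u : 0 < a -> mu.-integrable setT (EFin \o u) ->
  mu.-integrable setT (EFin \o (fun x => u x ^+ 2)) ->
  energy a u <= (2 * pi) ^+ n * \int[mu]_x (u x ^+ 2).
Proof.
move=> a0 ui u2i.
have mu_u : measurable_fun setT u by apply/measurable_EFinP; exact: measurable_int ui.
have mu_u1 : measurable_fun setT (fun p : 'rV[R]_n * 'rV[R]_n => u p.1).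
  exact: (measurableT_comp mu_u measurable_fst).
have mu_u2 : measurable_fun setT (fun p : 'rV[R]_n * 'rV[R]_n => u p.2).
  exact: (measurableT_comp mu_u measurable_snd).
have mh := measurable_heat2 a.
pose q (p : 'rV[R]_n * 'rV[R]_n) := u p.1 * (u p.2 * heat a (p.1 - p.2)).
have qi : (mu \x mu)%E.-integrable setT (EFin \o q) by exact: integrable_heat_form.
have -> : energy a u = fine (\int[mu \x mu]_p (q p)%:E)%E.
  rewrite energyE// -(integral12_prod_meas1 qi); congr fine.
  by apply: eq_integral => x _; rewrite heat_formE.
rewrite -lee_fin fineK; last exact: integrable_fin_num qi.
pose q2 (p : 'rV[R]_n * 'rV[R]_n) :=
  (2^-1 * u p.1 ^+ 2 * heat a (p.1 - p.2), 2^-1 * u p.2 ^+ 2 * heat a (p.1 - p.2)).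
have q20 p : 0 <= (q2 p).1 /\ 0 <= (q2 p).2.
  by split; apply: mulr_ge0; rewrite ?heat_ge0//; apply: mulr_ge0; rewrite ?sqr_ge0.
have mq21 : measurable_fun setT (fun p => (q2 p).1).
  by apply: measurable_funM => //; apply: measurable_funM => //; apply: measurable_funX.
have mq22 : measurable_fun setT (fun p => (q2 p).2).
  by apply: measurable_funM => //; apply: measurable_funM => //; apply: measurable_funX.
apply: (@le_trans _ _ (\int[mu \x mu]_p (((q2 p).1)%:E + ((q2 p).2)%:E))%E).
  apply: le_trans (lee_abs _) _; apply: le_trans (le_abse_integral _ _ _) _ => //.
    exact: measurable_int qi.
  apply: ge0_le_integral => //.
  - by apply: measurableT_comp => //; exact: measurable_int qi.
  - by apply: emeasurable_funD; exact: measurable_EFin_fun.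
  - move=> p _; rewrite -EFinD lee_fin /q /q2/= -mulrDl mulrA normrM.
    rewrite (ger0_norm (heat_ge0 _ _)) ler_wpM2r ?heat_ge0//.
    rewrite -mulrDr normrM -(real_normK (num_real (u p.1))) -(real_normK (num_real (u p.2))).
    by have := sqr_ge0 (`|u p.1| - `|u p.2|); nra.
rewrite ge0_integralD//; last 4 first.
- by move=> p _; rewrite lee_fin; have [] := q20 p.
- exact: measurable_EFin_fun.
- by move=> p _; rewrite lee_fin; have [] := q20 p.
- exact: measurable_EFin_fun.
have int1 x : (\int[mu]_y (2^-1 * u x ^+ 2 * heat a (x - y))%:E =
    ((2 * pi) ^+ n)%:E * (2^-1)%:E * (u x ^+ 2)%:E)%E.
  under eq_integral do rewrite EFinM.
  rewrite ge0_integralZl//; last 3 first.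
  - by apply: measurable_EFin_fun; exact: measurable_heatB.
  - by move=> y _; rewrite lee_fin heat_ge0.
  - by rewrite lee_fin mulr_ge0// sqr_ge0.
  by rewrite integral_heat// muleC EFinM muleA.
have int2 y : (\int[mu]_x (2^-1 * u y ^+ 2 * heat a (x - y))%:E =
    ((2 * pi) ^+ n)%:E * (2^-1)%:E * (u y ^+ 2)%:E)%E.
  by under eq_integral do rewrite heatN; exact: int1.
have -> : (\int[mu \x mu]_p ((q2 p).1)%:E = \int[mu]_x
    (((2 * pi) ^+ n)%:E * (2^-1)%:E * (u x ^+ 2)%:E))%E.
  rewrite fubini_tonelli1; [|exact: measurable_EFin_fun|]; last first.
    by move=> p; rewrite lee_fin; have [] := q20 p.
  by apply: eq_integral => x _; exact: int1.
have -> : (\int[mu \x mu]_p ((q2 p).2)%:E = \int[mu]_x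
    (((2 * pi) ^+ n)%:E * (2^-1)%:E * (u x ^+ 2)%:E))%E.
  rewrite fubini_tonelli2; [|exact: measurable_EFin_fun|]; last first.
    by move=> p; rewrite lee_fin; have [] := q20 p.
  by apply: eq_integral => x _; exact: int2.
rewrite ge0_integralZl//; last 3 first.
- by apply: measurable_EFin_fun; exact: measurable_funX.
- by move=> x _; rewrite lee_fin sqr_ge0.
- by rewrite -EFinM lee_fin mulr_ge0// exprn_ge0// mulr_ge0// pi_ge0.
rewrite RintegralE_fin// -!EFinM -EFinD lee_fin.
by rewrite le_eqVlt; apply/orP; left; apply/eqP; field.
Qed.

Lemma gauss_cvg1 (c : R) :
  expR (- (k.+1%:R^-1 * c)) @[k --> \oo] --> (1 : R).
Proof.
have : expR (- (k.+1%:R^-1 * c)) @[k --> \oo] --> expR (- (0 * c)).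
  apply: continuous_cvg; first exact: continuous_expR.
  by apply: cvgN; apply: cvgM; [exact: (@cvg_harmonic R)|exact: cvg_cst].
by rewrite mul0r oppr0 expR0.
Qed.

(** Half of Plancherel's theorem, for every function in L^1 and L^2. *)
Lemma plancherel_le u : mu.-integrable setT (EFin \o u) ->
  mu.-integrable setT (EFin \o (fun x => u x ^+ 2)) ->
  (\int[mu]_xi (power u xi)%:E <= ((2 * pi) ^+ n * \int[mu]_x (u x ^+ 2))%:E)%E.
Proof.
move=> ui u2i.
pose g k xi := (expR (- (k.+1%:R^-1 * sqnorm xi)) * power u xi)%:E.
have gi k : mu.-integrable setT (g k) by exact: integrable_energy.
have g0 k xi : (0 <= g k xi)%E by rewrite lee_fin mulr_ge0 ?expR_ge0 ?power_ge0.
have ndg xi : {homo g ^~ xi : k l / (k <= l)%N >-> (k <= l)%E}.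
  move=> k l kl; rewrite lee_fin ler_wpM2r ?power_ge0// ler_expR lerN2.
  by rewrite ler_wpM2r ?sqnorm_ge0// lef_pV2 ?posrE// ler_nat.
have gcvg xi : g k xi @[k --> \oo] --> (power u xi)%:E.
  apply: cvg_EFin; first exact: nearW.
  rewrite -[X in _ --> X]mul1r; apply: cvgM; [exact: gauss_cvg1|exact: cvg_cst].
have := @cvg_monotone_convergence _ _ _ mu setT measurableT g
  (fun k => measurable_int _ (gi k)) (fun k x _ => g0 k x) (fun x _ => ndg x).
under [X in _ --> X -> _]eq_integral do rewrite (cvg_lim _ (gcvg _))//.
move=> H; apply: (cvge_to_le H); apply: nearW => k.
rewrite RintegralE_fin//; last exact: gi.
by rewrite lee_fin; apply: energy_le.
Qed.

Lemma sqr_coord_le x i : x ord0 i ^+ 2 <= sqnorm x.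
Proof.
by rewrite /sqnorm (bigD1 i)//= lerDl sumr_ge0// => j _; exact: sqr_ge0.
Qed.

(** Approximate identity: the heat kernels concentrate at the origin. *)
Lemma heat_cvg (psi : 'rV[R]_n -> R) (C : R) x : continuous psi ->
  (forall y, `|psi y| <= C) ->
  \int[mu]_y (psi y * heat k.+1%:R^-1 (x - y)) @[k --> \oo] -->
    (2 * pi) ^+ n * psi x.
Proof.
move=> cpsi psiC.
have C0 : 0 <= C by exact: le_trans (psiC 0).
have P0 : 0 < (2 * pi) ^+ n :> R by rewrite exprn_gt0// mulr_gt0// pi_gt0.
have mpsi : measurable_fun setT psi by exact: continuous_measurable_rV.
have hi a := @integrable_heat a x.
have hpi a : 0 < a -> mu.-integrable setT (EFin \o (fun y => psi y * heat a (x - y))).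
  move=> a0; have := integrable_mul_bounded (hi _ a0) mpsi psiC.
  by under eq_fun do rewrite mulrC.
pose D : R := Num.sqrt (8 * pi ^+ 2) ^+ n.
have D0 : 0 <= D by rewrite exprn_ge0// sqrtr_ge0.
(* [s * expR (- s) <= 1] bounds the second moment of the kernel by a wider
   Gaussian times [8 * a]. *)
have mom a y : 0 < a -> sqnorm (x - y) * heat a (x - y) <=
    8 * a * (Num.sqrt (pi / a) ^+ n * expR (- ((8 * a)^-1 * sqnorm (y - x)))).
  move=> a0; rewrite /heat mulrCA [leRHS]mulrCA ler_wpM2l ?exprn_ge0 ?sqrtr_ge0//.
  rewrite sqnormB; move: (sqnorm _) (sqnorm_ge0 (y - x)) => s s0.
  have -> : s / (4 * a) = (8 * a)^-1 * s + (8 * a)^-1 * s by field; rewrite gt_eqF.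
  rewrite opprD expRD mulrA ler_wpM2r ?expR_ge0//.
  rewrite expRN ler_pdivrMr ?expR_gt0//.
  apply: le_trans (_ : 8 * a * (1 + (8 * a)^-1 * s) <= _); last first.
    by rewrite ler_wpM2l ?expR_ge1Dx// mulr_ge0// ltW.
  rewrite mulrDr mulrA divff ?mul1r ?gt_eqF ?mulr_gt0// lerDr.
  by rewrite !mulr_ge0// ltW.
have gi a : 0 < a -> mu.-integrable setT (EFin \o (fun y =>
    8 * a * (Num.sqrt (pi / a) ^+ n * expR (- ((8 * a)^-1 * sqnorm (y - x)))))).
  move=> a0; apply: integrable_scale => //; apply: integrable_scale => //.
  by apply: integrable_gauss; rewrite invr_gt0 mulr_gt0.
have gint a : 0 < a -> \int[mu]_y
    (8 * a * (Num.sqrt (pi / a) ^+ n * expR (- ((8 * a)^-1 * sqnorm (y - x))))) = 8 * a * D.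
  move=> a0; have a80 : 0 < (8 * a)^-1 by rewrite invr_gt0 mulr_gt0.
  have gi' : mu.-integrable setT (EFin \o (fun y => expR (- ((8 * a)^-1 * sqnorm (y - x))))).
    exact: integrable_gauss.
  rewrite RintegralZl//; last exact: integrable_scale.
  rewrite RintegralZl// /Rintegral integral_gauss//= -exprMn -sqrtrM; last first.
    by rewrite divr_ge0 ?pi_ge0// ltW.
  congr (_ * Num.sqrt _ ^+ _); field; by rewrite gt_eqF.
apply/cvgrPdist_le => e e0.
pose e1 := e / 2 / (2 * pi) ^+ n.
have e10 : 0 < e1 by rewrite !divr_gt0.
have [d /= d0 xd] : exists2 d : R, 0 < d & forall y, ball x d y -> `|psi x - psi y| < e1.
  have /cvgrPdist_lt/(_ _ e10) := cpsi x.
  by move=> /nbhs_ballP[d d0 H]; exists d => // y; exact: H.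
pose B := 2 * C / d ^+ 2.
have B0 : 0 <= B by rewrite divr_ge0 ?sqr_ge0// mulr_ge0.
(* Near [x] by continuity, far from [x] because the left-hand side is at most
   [2 * C]. *)
have psiB y : `|psi x - psi y| <= e1 + B * sqnorm (x - y).
  have [xy|xy] := pselect (ball x d y).
    by rewrite (le_trans (ltW (xd _ xy)))// lerDl mulr_ge0 ?sqnorm_ge0.
  have [i xyi] : exists i, d <= `|x ord0 i - y ord0 i|.
    apply: contrapT => /forallNP H; apply: xy; split => // i j; rewrite (ord1 i).
    by rewrite /ball/= ltNge; apply/negP/H.
  have : d ^+ 2 <= sqnorm (x - y).
    apply: le_trans (sqr_coord_le _ i); rewrite subr_rVE.
    by rewrite -(real_normK (num_real (x ord0 i - _))) ler_pXn2r ?nnegrE// ltW.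
  move=> dxy; apply: le_trans (_ : 2 * C <= _).
    by apply: le_trans (ler_normB _ _) _; rewrite mulr_natl mulr2n lerD.
  rewrite -[leLHS]add0r lerD ?(ltW e10)// /B mulrAC ler_pdivlMr ?exprn_gt0//.
  by rewrite ler_wpM2l// mulr_ge0.
have key a : 0 < a ->
    `|(2 * pi) ^+ n * psi x - \int[mu]_y (psi y * heat a (x - y))| <= e / 2 + B * (8 * a * D).
  move=> a0.
  have -> : (2 * pi) ^+ n * psi x = \int[mu]_y (psi x * heat a (x - y)).
    rewrite RintegralZl//; last exact: hi.
    by rewrite /Rintegral integral_heat//= mulrC.
  rewrite -RintegralB//; [|by apply: integrable_scale => //; exact: hi|exact: hpi].
  have di : mu.-integrable setT
      (EFin \o (fun y => psi x * heat a (x - y) - psi y * heat a (x - y))).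
    by apply: integrable_sub; [|by apply: integrable_scale => //; exact: hi|exact: hpi].
  apply: le_trans (le_normr_Rintegral _ di) _ => //.
  have -> : e / 2 = \int[mu]_y (e1 * heat a (x - y)).
    rewrite RintegralZl//; last exact: hi.
    by rewrite /Rintegral integral_heat//= /e1 divfK// gt_eqF.
  rewrite -gint// -RintegralZl//; last exact: gi.
  rewrite -RintegralD//; last 2 first.
  - by apply: integrable_scale => //; exact: hi.
  - by apply: integrable_scale => //; exact: gi.
  apply: le_Rintegral => //.
  - exact: (integrable_abse di).
  - by apply: integrable_add => //; apply: integrable_scale => //; [exact: hi|exact: gi].
  - move=> y _; rewrite -mulrBl normrM (ger0_norm (heat_ge0 _ _)).
    apply: le_trans (ler_wpM2r (heat_ge0 _ _) (psiB y)) _.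
    by rewrite mulrDl lerD2l -[leLHS](mulrA B) ler_wpM2l// mom.
near=> k; apply: le_trans (key _ _) _; first by rewrite invr_gt0.
rewrite {2}[e]splitr lerD2l.
near: k.
have : B * (8 * k.+1%:R^-1 * D) @[k --> \oo] --> B * (8 * 0 * D).
  by apply: cvgM; [exact: cvg_cst|apply: cvgM; [apply: cvgM;
    [exact: cvg_cst|exact: cvg_harmonic]|exact: cvg_cst]].
rewrite mulr0 mul0r mulr0 => /cvgrPdist_le/(_ (e / 2)) H.
have /H : 0 < e / 2 by rewrite divr_gt0.
apply: filterS => k; rewrite sub0r normrN; apply: le_trans; exact: ler_norm.
Unshelve. all: end_near. Qed.

(** The other half of Plancherel's theorem, for continuous functions of bounded
    support. *)
Lemma plancherel_ge M psi : 0 <= M -> continuous psi -> zero_outside M psi ->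
  (((2 * pi) ^+ n * \int[mu]_x (psi x ^+ 2))%:E <= \int[mu]_xi (power psi xi)%:E)%E.
Proof.
move=> M0 cpsi psi0.
have psii := zero_outside_integrable M0 cpsi psi0.
have mpsi : measurable_fun setT psi by exact: continuous_measurable_rV.
have [C psiC] := zero_outside_bounded M0 cpsi psi0.
have P0 : 0 <= (2 * pi) ^+ n :> R by rewrite exprn_ge0// mulr_ge0// pi_ge0.
pose a k : R := k.+1%:R^-1.
have a0 k : 0 < a k by rewrite invr_gt0.
have : ((energy (a k) psi)%:E @[k --> \oo] --> ((2 * pi) ^+ n * \int[mu]_x (psi x ^+ 2))%:E)%E.
  pose f k x := (psi x * \int[mu]_y (psi y * heat (a k) (x - y)))%:E.
  have fE k : f k = fubini_F mu
      (EFin \o (fun p => psi p.1 * (psi p.2 * heat (a k) (p.1 - p.2)))).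
    by apply/funext => x; rewrite heat_formE.
  have fi k : mu.-integrable setT (f k).
    by rewrite fE; apply: integrable_fubini_F; exact: integrable_heat_form.
  have hle k x : `|\int[mu]_y (psi y * heat (a k) (x - y))| <= (2 * pi) ^+ n * C.
    have hk := integrable_heat x (a0 k).
    have pk := integrable_mul_heat x (a0 k) psii.
    apply: le_trans (le_normr_Rintegral _ pk) _ => //.
    apply: (@le_trans _ _ (\int[mu]_y (C * heat (a k) (x - y)))).
      apply: le_Rintegral => //; first exact: (integrable_abse pk).
        exact: (integrable_scale measurableT C hk).
      by move=> y _; rewrite normrM (ger0_norm (heat_ge0 _ _)) ler_wpM2r ?heat_ge0.
    by rewrite RintegralZl// /Rintegral integral_heat//= mulrC.
  have -> : (fun k => (energy (a k) psi)%:E) = (fun k => \int[mu]_x f k x)%E.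
    by apply/funext => k; rewrite energyE// RintegralE_fin//; exact: fi.
  have psi2i : mu.-integrable setT (EFin \o (fun x => psi x ^+ 2)).
    exact: (integrable_mul_bounded psii mpsi psiC).
  have -> : ((2 * pi) ^+ n * \int[mu]_x (psi x ^+ 2))%:E =
      (\int[mu]_x (psi x * ((2 * pi) ^+ n * psi x))%:E)%E.
    rewrite -RintegralZl// -RintegralE_fin//; last exact: integrable_scale.
    by apply: eq_integral => x _; congr EFin; ring.
  apply: (@dominated_cvg _ _ _ mu setT measurableT f (fun x => (psi x * ((2 * pi) ^+ n * psi x))%:E)
    (fun x => ((2 * pi) ^+ n * C * `|psi x|)%:E)) => //.
  - by move=> k; exact: measurable_int (fi k).
  - move=> x _; apply: cvg_EFin; first exact: nearW.
    by apply: cvgM; [exact: cvg_cst|exact: (heat_cvg cpsi psiC)].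
  - apply: (integrable_scale measurableT); exact: (integrable_abse psii).
  - move=> k x _; rewrite lee_fin normrM mulrC ler_wpM2r//; exact: hle.
move=> H; apply: (cvge_to_le H); apply: nearW => k.
rewrite -RintegralE_fin//; last exact: integrable_energy.
apply: ge0_le_integral => //.
- by move=> xi _; rewrite lee_fin mulr_ge0 ?expR_ge0 ?power_ge0.
- exact: measurable_int (integrable_energy psii (a0 k)).
- by apply: measurable_EFin_fun; exact: measurable_power.
- move=> xi _; rewrite lee_fin ler_piMl ?power_ge0// -expR0 ler_expR oppr_le0.
  by rewrite mulr_ge0 ?sqnorm_ge0// ltW.
Qed.

End plancherel.

(** * Bounds on the spectral density *)

Section L2_algebra.
Variables (R : realType) (n : nat) (Om : set 'rV[R]_n) (mOm : measurable Om).
Local Notation mu := (lebesgue_rV R n).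
Implicit Types (f g h : 'rV[R]_n -> R).

Lemma L2_mul_integrable f g : L2 Om f -> L2 Om g ->
  mu.-integrable Om (EFin \o (fun x => f x * g x)).
Proof.
move=> [mf fi] [mg gi].
apply: (le_integrable_real mOm _ _ (integrable_add mOm fi gi)).
  exact: measurable_funM.
move=> x _; rewrite normrM -(real_normK (num_real (f x))) -(real_normK (num_real (g x))).
have := sqr_ge0 (`|f x| - `|g x|).
have := mulr_ge0 (normr_ge0 (f x)) (normr_ge0 (g x)).
by move: `|f x| `|g x| => a b; nra.
Qed.

Lemma L2_scale (k : R) f : L2 Om f -> L2 Om (fun x => k * f x).
Proof.
move=> [mf fi]; split; first exact: measurable_funM.
under eq_fun do rewrite exprMn.
exact: (integrable_scale mOm).
Qed.

Lemma L2_add f g : L2 Om f -> L2 Om g -> L2 Om (fun x => f x + g x).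
Proof.
move=> Lf Lg; have fg := L2_mul_integrable Lf Lg; case: Lf Lg => [mf fi] [mg gi].
split; first exact: measurable_funD.
under eq_fun do rewrite sqrrD -addrA (addrC _ (g _ ^+ 2)) -mulr_natl.
apply: (integrable_add mOm fi).
apply: (integrable_add mOm gi).
exact: (integrable_scale mOm).
Qed.

Lemma L2_sub f g : L2 Om f -> L2 Om g -> L2 Om (fun x => f x - g x).
Proof.
move=> Lf Lg; have := L2_add Lf (L2_scale (-1) Lg).
by under eq_fun do rewrite mulN1r.
Qed.

Lemma L2_sum (m : nat) (F : 'I_m -> 'rV[R]_n -> R) :
  (forall j, L2 Om (F j)) -> L2 Om (fun x => \sum_(j < m) F j x).
Proof.
elim: m F => [|m IH] F LF.
  under eq_fun do rewrite big_ord0.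
  split; first exact: measurable_cst.
  by rewrite expr0n; exact: integrable0.
under eq_fun do rewrite big_ord_recl.
by apply: L2_add => //; exact: IH.
Qed.

Lemma L2_bounded f (C : R) : (mu Om < +oo)%E -> measurable_fun setT f ->
  (forall x, `|f x| <= C) -> L2 Om f.
Proof.
move=> fOm mf fC; split; first exact: measurable_funTS.
apply: (@le_integrable_real _ _ R mu Om mOm (fun x => f x ^+ 2) (fun=> C ^+ 2)).
- by apply: measurable_funX; exact: measurable_funTS.
- move=> x _; rewrite ger0_norm ?sqr_ge0// -(real_normK (num_real (f x))).
  by rewrite ler_pXn2r ?nnegrE// (le_trans _ (fC x)).
- apply/integrableP; split; first exact: measurable_cst.
  by rewrite integral_cst//= ltey_eq fin_numM// ge0_fin_numE.
Qed.

Lemma L2_dotC f g : L2_dot Om f g = L2_dot Om g f.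
Proof. by apply: eq_Rintegral => x _; rewrite mulrC. Qed.

Lemma L2_dotDl f g h : L2 Om f -> L2 Om g -> L2 Om h ->
  L2_dot Om (fun x => f x + g x) h = L2_dot Om f h + L2_dot Om g h.
Proof.
move=> Lf Lg Lh; rewrite /L2_dot -RintegralD//; try exact: L2_mul_integrable.
by apply: eq_Rintegral => x _; rewrite mulrDl.
Qed.

Lemma L2_dotZl (k : R) f g : L2 Om f -> L2 Om g ->
  L2_dot Om (fun x => k * f x) g = k * L2_dot Om f g.
Proof.
move=> Lf Lg; rewrite /L2_dot -RintegralZl//; last exact: L2_mul_integrable.
by apply: eq_Rintegral => x _; rewrite mulrA.
Qed.

Lemma L2_dot_suml (m : nat) (F : 'I_m -> 'rV[R]_n -> R) g :
  (forall j, L2 Om (F j)) -> L2 Om g ->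
  L2_dot Om (fun x => \sum_(j < m) F j x) g = \sum_(j < m) L2_dot Om (F j) g.
Proof.
move=> LF Lg; rewrite /L2_dot -Rintegral_sum_ord//.
  by apply: eq_Rintegral => x _; rewrite mulr_suml.
by move=> j; exact: L2_mul_integrable.
Qed.

Lemma L2_dot_ge0 f : 0 <= L2_dot Om f f.
Proof. by apply: Rintegral_ge0 => x _; rewrite -expr2 sqr_ge0. Qed.

(** The squared distance of [t h] to a linear combination. *)
Lemma L2_dot_comb_sub (m : nat) (f : 'I_m -> 'rV[R]_n -> R) (b : 'I_m -> R) h (t : R) :
  (forall j, L2 Om (f j)) -> L2 Om h ->
  let p x := \sum_(j < m) b j * f j x - t * h x in
  L2_dot Om p p = \sum_(j < m) \sum_(l < m) b j * b l * L2_dot Om (f j) (f l)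
    - 2 * t * (\sum_(j < m) b j * L2_dot Om (f j) h) + t ^+ 2 * L2_dot Om h h.
Proof.
move=> Lf Lh p.
pose s x := \sum_(j < m) b j * f j x.
have Lbf j : L2 Om (fun x => b j * f j x) by exact: L2_scale.
have Ls : L2 Om s by exact: L2_sum.
have Lth : L2 Om (fun x => (- t) * h x) by exact: L2_scale.
have pE : p = fun x => s x + (- t) * h x by apply/funext => x; rewrite mulNr.
have Lp : L2 Om p by rewrite pE; exact: L2_add.
have sg g : L2 Om g -> L2_dot Om s g = \sum_(j < m) b j * L2_dot Om (f j) g.
  by move=> Lg; rewrite L2_dot_suml//; apply: eq_bigr => j _; rewrite L2_dotZl.
have pg g : L2 Om g -> L2_dot Om p g = L2_dot Om s g - t * L2_dot Om h g.
  by move=> Lg; rewrite pE L2_dotDl// L2_dotZl// mulNr.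
rewrite pg// (L2_dotC s) (L2_dotC h) !pg// (L2_dotC h s) sg//.
rewrite (sg h)//.
have -> : \sum_(j < m) b j * L2_dot Om (f j) s =
    \sum_(j < m) \sum_(l < m) b j * b l * L2_dot Om (f j) (f l).
  apply: eq_bigr => j _; rewrite L2_dotC sg// mulr_sumr.
  by apply: eq_bigr => l _; rewrite L2_dotC mulrA.
ring.
Qed.

End L2_algebra.

Section bessel.
Variables (R : realType) (n : nat) (Om : set 'rV[R]_n) (mOm : measurable Om).
Local Notation mu := (lebesgue_rV R n).
Variables (V : R) (V0 : 0 < V) (muOm : mu Om = V%:E).
Variable xi : 'rV[R]_n.

Let co x := cos (dot xi x).
Let si x := sin (dot xi x).

Let fOm : (mu Om < +oo)%E. Proof. by rewrite muOm ltry. Qed.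

Lemma L2_cos : L2 Om co.
Proof.
apply: (@L2_bounded _ _ _ mOm _ 1) => //; first by rewrite /co; mrv.
by move=> x; exact: cos_max.
Qed.

Lemma L2_sin : L2 Om si.
Proof.
apply: (@L2_bounded _ _ _ mOm _ 1) => //; first by rewrite /si; mrv.
by move=> x; rewrite ler_norml sin_geN1 sin_le1.
Qed.

Lemma L2_dot_cos_sin : L2_dot Om co co + L2_dot Om si si = V.
Proof.
have [Lc Ls] := (L2_cos, L2_sin).
rewrite /L2_dot -RintegralD//; last 2 first.
- exact: (L2_mul_integrable mOm Lc Lc).
- exact: (L2_mul_integrable mOm Ls Ls).
under eq_Rintegral do rewrite -!expr2 cos2Dsin2.
by rewrite Rintegral_cst// mul1r; exact: (congr1 fine muOm).
Qed.

Variables (k : nat) (phi : 'I_k -> 'rV[R]_n -> R).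
Hypothesis Lphi : forall j, L2 Om (phi j).
Hypothesis ophi : forall j l, L2_dot Om (phi j) (phi l) = (j == l)%:R.

(** Spectral density of the span of the [phi j] at the frequency [xi]. *)
Let F := \sum_(j < k) (L2_dot Om (phi j) co ^+ 2 + L2_dot Om (phi j) si ^+ 2).

Lemma sum_delta (b : 'I_k -> R) (c : 'I_k -> R) :
  \sum_(j < k) \sum_(l < k) b j * b l * (c j * (j == l)%:R) = \sum_(j < k) b j ^+ 2 * c j.
Proof.
apply: eq_bigr => j _; rewrite (bigD1 j)//= eqxx mulr1 big1 ?addr0 ?expr2//.
by move=> l lj; rewrite eq_sym (negbTE lj) !mulr0.
Qed.

(** Bessel's inequality. *)
Lemma bessel_le h : L2 Om h ->
  \sum_(j < k) L2_dot Om (phi j) h ^+ 2 <= L2_dot Om h h.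
Proof.
move=> Lh.
have := L2_dot_comb_sub mOm (fun j => L2_dot Om (phi j) h) 1 Lphi Lh.
move=> /= E; have := L2_dot_ge0 Om
  (fun x => \sum_(j < k) L2_dot Om (phi j) h * phi j x - 1 * h x).
rewrite E.
under eq_bigr do under eq_bigr do rewrite ophi -[_%:R]mul1r.
rewrite (sum_delta _ (fun=> 1)) /=.
under eq_bigr do rewrite mulr1.
under [X in _ - 2 * 1 * X]eq_bigr do rewrite -expr2.
by lra.
Qed.

Lemma density_le_volume : F <= V.
Proof.
by rewrite /F big_split/= -L2_dot_cos_sin; apply: lerD; apply: bessel_le;
  [exact: L2_cos|exact: L2_sin].
Qed.

Variables (D : 'I_k -> 'I_n -> 'rV[R]_n -> R) (lam : 'I_k -> R) (L : R).
(* [D j] is the gradient of [phi j]; the last two hypotheses are integration by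
   parts against a plane wave. *)
Hypothesis LD : forall j i, L2 Om (D j i).
Hypothesis oD : forall j l, \sum_(i < n) L2_dot Om (D j i) (D l i) = lam j * (j == l)%:R.
Hypothesis L0 : 0 <= L.
Hypothesis lamL : forall j, lam j <= L.
Hypothesis Dcos : forall j i, L2_dot Om (D j i) co = xi ord0 i * L2_dot Om (phi j) si.
Hypothesis Dsin : forall j i, L2_dot Om (D j i) si = - (xi ord0 i * L2_dot Om (phi j) co).

(* Sum over the directions of the squared distance between the gradient of the
   combination with coefficients [b] and [t xi h]. *)
Let grad_comb (b : 'I_k -> R) (h : 'rV[R]_n -> R) (e : 'I_k -> R) (t : R) : L2 Om h ->
  (forall j i, L2_dot Om (D j i) h = xi ord0 i * e j) ->
  0 <= \sum_(j < k) b j ^+ 2 * lam j - 2 * t * (sqnorm xi * \sum_(j < k) b j * e j)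
    + t ^+ 2 * (sqnorm xi * L2_dot Om h h).
Proof.
move=> Lh De.
pose p i x := \sum_(j < k) b j * D j i x - t * xi ord0 i * h x.
have : 0 <= \sum_(i < n) L2_dot Om (p i) (p i) by apply: sumr_ge0 => i _; exact: L2_dot_ge0.
have -> : \sum_(i < n) L2_dot Om (p i) (p i) = \sum_(i < n)
   (\sum_(j < k) \sum_(l < k) b j * b l * L2_dot Om (D j i) (D l i)
    - xi ord0 i ^+ 2 * (2 * t * \sum_(j < k) b j * e j)
    + xi ord0 i ^+ 2 * (t ^+ 2 * L2_dot Om h h)).
  apply: eq_bigr => i _.
  rewrite [LHS](L2_dot_comb_sub mOm b (t * xi ord0 i) (fun j => LD j i) Lh).
  have -> : \sum_(j < k) b j * L2_dot Om (D j i) h = xi ord0 i * \sum_(j < k) b j * e j.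
    by rewrite mulr_sumr; apply: eq_bigr => j _; rewrite De mulrCA.
  by ring.
rewrite !big_split/= sumrN -!mulr_suml -/(sqnorm xi).
have -> : \sum_(i < n) \sum_(j < k) \sum_(l < k) b j * b l * L2_dot Om (D j i) (D l i) =
    \sum_(j < k) b j ^+ 2 * lam j.
  rewrite -sum_delta exchange_big; apply: eq_bigr => j _ /=.
  rewrite exchange_big; apply: eq_bigr => l _ /=.
  by rewrite -mulr_sumr oD.
by set S := \sum_(j < k) b j * e j; move=> H; lra.
Qed.

(** Let [P] be the projection of the plane wave of frequency [xi] onto the span.
    By the relations [Dcos] and [Dsin] the scalar product of the gradients of [P]
    and of the wave is [|xi|^2 F], and the squared norms of these gradients are
    at most [L F] and equal to [|xi|^2 V]; so this is the Cauchy-Schwarz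
    inequality, obtained here by minimizing over [t]. *)
Lemma density_decay : sqnorm xi * F <= L * V.
Proof.
pose c j := L2_dot Om (phi j) co.
pose s j := L2_dot Om (phi j) si.
have F0 : 0 <= F by apply: sumr_ge0 => j _; rewrite addr_ge0 ?sqr_ge0.
(* The minimizer of the quadratic polynomial in [t]. *)
pose t := F / V; pose q := sqnorm xi.
have q0 : 0 <= q := sqnorm_ge0 xi.
have tV : t * V = F by rewrite /t divfK// gt_eqF.
have Dsin' j i : L2_dot Om (D j i) si = xi ord0 i * - c j by rewrite Dsin mulrN.
have Hs := @grad_comb s co s t L2_cos Dcos.
have Hc := @grad_comb c si (fun j => - c j) (- t) L2_sin Dsin'.
have FE : \sum_(j < k) s j * s j - \sum_(j < k) c j * - c j = F.
  rewrite -sumrB; apply: eq_bigr => j _; rewrite /c /s; ring.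
have LE : \sum_(j < k) s j ^+ 2 * lam j + \sum_(j < k) c j ^+ 2 * lam j <= L * F.
  rewrite -big_split/= mulr_sumr; apply: ler_sum => j _.
  rewrite -mulrDl mulrC addrC -/(c j) -/(s j) ler_wpM2r// addr_ge0 ?sqr_ge0//.
have cs := L2_dot_cos_sin.
have key : q * F ^+ 2 <= L * V * F.
  move: Hs Hc; rewrite -/q; move: FE LE cs tV.
  set A := \sum_(j < k) s j * s j; set B := \sum_(j < k) c j * - c j.
  set X := \sum_(j < k) s j ^+ 2 * lam j; set Y := \sum_(j < k) c j ^+ 2 * lam j.
  set P := L2_dot Om co co; set Q := L2_dot Om si si => FE LE cs tV Hs Hc.
  have H : 0 <= X + Y - 2 * t * (q * (A - B)) + t ^+ 2 * (q * (P + Q)) by lra.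
  rewrite FE cs in H.
  have H2 : 0 <= L * F - 2 * t * (q * F) + t ^+ 2 * (q * V) by lra.
  have := mulr_ge0 (ltW V0) H2.
  have -> : V * (L * F - 2 * t * (q * F) + t ^+ 2 * (q * V)) =
      L * V * F - 2 * (t * V) * (q * F) + (t * V) ^+ 2 * q by ring.
  by rewrite tV; lra.
have [F00|F00] := eqVneq F 0; first by rewrite F00 mulr0 mulr_ge0// ltW.
have Fp : 0 < F by rewrite lt_neqAle eq_sym F00.
by rewrite -(ler_pM2r Fp) -mulrA -expr2.
Qed.

End bessel.

(** * Test functions and plane waves *)

Lemma continuous_add_fun (R : realType) (T : topologicalType) (f g : T -> R) :
  continuous f -> continuous g -> continuous (fun x => f x + g x).
Proof. by move=> cf cg x; exact: (continuousD (cf x) (cg x)). Qed.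

Lemma continuous_mul_fun (R : realType) (T : topologicalType) (f g : T -> R) :
  continuous f -> continuous g -> continuous (fun x => f x * g x).
Proof. by move=> cf cg x; exact: (continuousM (cf x) (cg x)). Qed.

Section plane_waves.
Variables (R : realType) (n : nat).
Implicit Types (xi x : 'rV[R]_n).

Lemma continuous_dotr xi : continuous (fun x => dot xi x).
Proof.
rewrite /dot; elim: (index_enum _) => [|i s IH].
  rewrite (_ : (fun _ => _) = cst 0); first exact: cst_continuous.
  by apply/funext => x; rewrite big_nil.
rewrite (_ : (fun _ => _) =
    fun x => xi ord0 i * x ord0 i + \sum_(j <- s) xi ord0 j * x ord0 j).
  apply: continuous_add_fun => //; apply: continuous_mul_fun.
    exact: cst_continuous.
  by move=> x; exact: coord_continuous.
by apply/funext => x; rewrite big_cons.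
Qed.

Lemma dot_line xi x i (h : R) :
  dot xi (h *: delta_mx ord0 i + x) = h * xi ord0 i + dot xi x.
Proof.
rewrite /dot (bigD1 i)//= [X in _ = _ + X](bigD1 i)//= !mxE !eqxx mulr1.
rewrite mulrDr (mulrC (xi _ _) h) -!addrA; congr (_ + (_ + _)).
by apply: eq_bigr => j ji; rewrite !mxE (negbTE ji) andbF mulr0 add0r.
Qed.

(** Directional derivative of a function of the scalar product. *)
Lemma is_derive_plane_wave (tr dtr : R -> R) xi x i :
  (forall t : R, is_derive t (1 : R) tr (dtr t)) ->
  is_derive x (delta_mx ord0 i) (fun y => tr (dot xi y)) (xi ord0 i * dtr (dot xi x)).
Proof.
move=> dtrE.
pose g (h : R) := tr (h * xi ord0 i + dot xi x).
have shiftE (h : R) : ((fun y => tr (dot xi y)) \o shift x) (h *: delta_mx ord0 i) =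
    (g \o shift 0) (h *: 1).
  by rewrite /= dot_line /g scaler1 addr0.
have g0 : tr (dot xi x) = g 0 by rewrite /g mul0r add0r.
have dg : is_derive (0 : R) (1 : R) g (xi ord0 i * dtr (dot xi x)).
  have := dtrE (0 * xi ord0 i + dot xi x); rewrite mul0r add0r => H.
  have H' : is_derive ((fun h : R => h * xi ord0 i + dot xi x) 0) (1 : R) tr (dtr (dot xi x)).
    by rewrite mul0r add0r.
  have H2 : is_derive (0 : R) (1 : R) (fun h : R => h * xi ord0 i + dot xi x) (xi ord0 i).
    by apply: is_derive_eq; rewrite /GRing.scale/= ?(mulr0, mulr1, addr0, add0r).
  rewrite (mulrC (xi _ _)).
  exact: (@is_derive1_comp R tr (fun h : R => h * xi ord0 i + dot xi x) 0 _ _ H' H2).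
case: dg => dg1 dg2; apply: DeriveDef.
  by move: dg1; rewrite /derivable -g0; under eq_fun do rewrite -shiftE.
by rewrite -dg2 /derive -g0; under [in RHS]eq_fun do rewrite -shiftE.
Qed.

End plane_waves.

Section test_functions.
Variables (R : realType) (n : nat) (Om : set 'rV[R]_n).
Hypothesis oOm : open Om.
Local Notation mu := (lebesgue_rV R n).
Variables (V : R) (V0 : 0 < V) (muOm : mu Om = V%:E).
Implicit Types (xi x : 'rV[R]_n) (f g psi : 'rV[R]_n -> R).

Let mOm : measurable Om. Proof. exact: open_measurable_rV. Qed.
Let fOm : (mu Om < +oo)%E. Proof. by rewrite muOm ltry. Qed.

Lemma test_function_C1 psi : test_function Om psi ->
  [/\ continuous psi, forall i x, derivable psi x (delta_mx ord0 i) &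
      forall i, continuous (partial i psi)].
Proof. by move=> [/(_ 1%N) [? ? ?] _ _]. Qed.

Lemma test_function_zero_outside psi : test_function Om psi ->
  exists2 M, 0 <= M & zero_outside M psi.
Proof.
move=> [_ /compact_bounded [M [_ HM]] _]; exists (Num.max 0 (M + 1)).
  by rewrite le_max lexx.
move=> x [i Mx]; apply/eqP; apply: contraTT Mx => psix.
rewrite -leNgt le_max; apply/orP; right.
have /(HM (M + 1) _ x) : closed_support psi x by exact: subset_closure.
rewrite ltrDl ltr01 => /(_ isT); apply: le_trans.
rewrite [leRHS]mx_normrE.
exact: (le_bigmax 0 (fun ij => `|x ij.1 ij.2|) (ord0, i)).
Qed.

(** Outside [Om] a test function vanishes in a neighbourhood of each point. *)
Lemma test_function_off psi x : test_function Om psi -> ~ Om x ->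
  psi x = 0 /\ forall i, partial i psi x = 0.
Proof.
move=> [_ _ sub] Ox.
have nx : ~ closed_support psi x by move=> /sub.
have psi0 y : ~ closed_support psi y -> psi y = 0.
  by move=> ny; apply/eqP; apply: contrapT => /negP py; apply: ny; exact: subset_closure.
split; first exact: psi0.
move=> i; rewrite /partial.
have fE : \forall y \near x, psi y = cst 0 y.
  have oC : open (~` closed_support psi) by apply: closed_openC; exact: closed_closure.
  have := open_nbhs_nbhs (conj oC nx).
  by apply: filterS => y /psi0.
by rewrite (near_eq_derive _ fE) derive_cst.
Qed.

Lemma test_function_restrict psi : test_function Om psi -> psi \_ Om = psi.
Proof.
move=> tpsi; apply/funext => x; rewrite patchE; case: ifPn => //.
by rewrite notin_setE => /(test_function_off tpsi)[].
Qed.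

Lemma partial_test_function_restrict psi i :
  test_function Om psi -> partial i psi \_ Om = partial i psi.
Proof.
move=> tpsi; apply/funext => x; rewrite patchE; case: ifPn => //.
by rewrite notin_setE => /(test_function_off tpsi)[_ ->].
Qed.

Lemma L2_test_function psi : test_function Om psi -> L2 Om psi.
Proof.
move=> tpsi; have [cpsi _ _] := test_function_C1 tpsi.
have [M M0 z] := test_function_zero_outside tpsi.
have [C HC] := zero_outside_bounded M0 cpsi z.
apply: (@L2_bounded _ _ _ mOm _ C) => //; exact: continuous_measurable_rV.
Qed.

Lemma L2_partial_test_function psi i : test_function Om psi -> L2 Om (partial i psi).
Proof.
move=> tpsi; have [_ _ cpsi] := test_function_C1 tpsi.
have [M M0 z] := test_function_zero_outside tpsi.
have [C HC] := zero_outside_bounded M0 (cpsi i) (zero_outside_partial i z).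
apply: (@L2_bounded _ _ _ mOm _ C) => //; exact: continuous_measurable_rV.
Qed.

(** Functions on [Om] are extended by zero. *)
Lemma L2_dot_restrict (f g : 'rV[R]_n -> R) :
  L2_dot Om f g = \int[mu]_x ((f \_ Om) x * g x).
Proof.
rewrite /L2_dot Rintegral_mkcond; apply: eq_Rintegral => x _.
by rewrite !patchE; case: ifP => // _; rewrite mul0r.
Qed.

Lemma L2_integrable_restrict f : L2 Om f ->
  mu.-integrable setT (EFin \o (f \_ Om)) /\
  mu.-integrable setT (EFin \o (fun x => (f \_ Om) x ^+ 2)).
Proof.
move=> Lf; have [mf f2i] := Lf; split.
  rewrite -restrict_EFin -integrable_mkcond//.
  have L1 : L2 Om (fun=> 1 : R).
    by apply: (@L2_bounded _ _ _ mOm _ 1) => // x; rewrite normr1.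
  by have := L2_mul_integrable mOm Lf L1; under eq_fun do rewrite mulr1.
have := f2i; rewrite (integrable_mkcond _ mOm) restrict_EFin.
rewrite (_ : (fun x => f x ^+ 2) \_ Om = fun x => (f \_ Om) x ^+ 2)//.
by apply/funext => x; rewrite !patchE; case: ifP => // _; rewrite expr0n.
Qed.

Lemma Rintegral_sqr_restrict f : \int[mu]_x ((f \_ Om) x ^+ 2) = L2_dot Om f f.
Proof.
rewrite L2_dot_restrict; apply: eq_Rintegral => x _; rewrite patchE.
by case: ifP => // _; rewrite expr0n mul0r.
Qed.

Lemma power_restrict f xi : power (f \_ Om) xi =
  L2_dot Om f (fun x => cos (dot xi x)) ^+ 2 + L2_dot Om f (fun x => sin (dot xi x)) ^+ 2.
Proof. by rewrite !L2_dot_restrict. Qed.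

(** Integration by parts against a function of the scalar product with [xi]. *)
Lemma L2_dot_partial_wave (tr dtr : R -> R) psi i xi : test_function Om psi ->
  (forall t : R, is_derive t (1 : R) tr (dtr t)) -> continuous tr -> continuous dtr ->
  L2_dot Om (partial i psi) (fun x => tr (dot xi x)) =
  - (xi ord0 i * L2_dot Om psi (fun x => dtr (dot xi x))).
Proof.
move=> tpsi dtrE ctr cdtr.
have [cpsi dpsi cdpsi] := test_function_C1 tpsi.
have [M M0 z] := test_function_zero_outside tpsi.
have cw (g : R -> R) : continuous g -> continuous (fun x => g (dot xi x)).
  by move=> cg x; apply: continuous_comp; [exact: continuous_dotr|exact: cg].
pose f x := psi x * tr (dot xi x).
pose f1 x := partial i psi x * tr (dot xi x).
pose f2 x := psi x * dtr (dot xi x).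
have df x : is_derive x (delta_mx ord0 i) f (f1 x + xi ord0 i * f2 x).
  have d1 : is_derive x (delta_mx ord0 i) psi (partial i psi x).
    exact: derivableP.
  have d2 := is_derive_plane_wave xi x i dtrE.
  refine (@is_derive_eq _ _ _ f _ _ _ _ (is_deriveM d1 d2) _).
  by rewrite /GRing.scale/= /f1 /f2; ring.
have pfE : partial i f = fun x => f1 x + xi ord0 i * f2 x.
  by apply/funext => x; have [] := df x.
have cf : continuous f by apply: continuous_mul_fun => //; exact: cw.
have cf1 : continuous f1 by apply: continuous_mul_fun => //; exact: cw.
have cf2 : continuous f2 by apply: continuous_mul_fun => //; exact: cw.
have zf1 : zero_outside M f1.
  by move=> x Mx; rewrite /f1 (zero_outside_partial i z) ?mul0r.
have zf2 : zero_outside M f2 by move=> x Mx; rewrite /f2 z ?mul0r.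
have i1 := zero_outside_integrable M0 cf1 zf1.
have i2 := zero_outside_integrable M0 cf2 zf2.
have : (\int[mu]_x (partial i f x)%:E = 0)%E.
  apply: (@integral_partial_eq0 R n M f i M0 cf).
  - by move=> x; have [] := df x.
  - rewrite pfE; apply: continuous_add_fun => //; apply: continuous_mul_fun => //.
    exact: cst_continuous.
  - by move=> x Mx; rewrite /f z ?mul0r.
rewrite pfE RintegralE_fin//; last first.
  exact: (integrable_add measurableT i1 (integrable_scale measurableT _ i2)).
rewrite RintegralD//; last exact: (integrable_scale measurableT _ i2).
rewrite RintegralZl// => -[E].
rewrite !L2_dot_restrict partial_test_function_restrict// test_function_restrict//.
rewrite -/f1 -/f2.
by move/eqP: E; rewrite addr_eq0 => /eqP.
Qed.

Lemma L2_dot_partial_cos psi i xi : test_function Om psi ->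
  L2_dot Om (partial i psi) (fun x => cos (dot xi x)) =
  xi ord0 i * L2_dot Om psi (fun x => sin (dot xi x)).
Proof.
move=> tpsi; rewrite (@L2_dot_partial_wave cos (fun t => - sin t))//; last first.
- by move=> t; apply: cvgN; exact: continuous_sin.
- exact: continuous_cos.
rewrite -mulrN; congr (_ * _).
have Ls := L2_sin mOm muOm xi.
rewrite L2_dotC -[RHS]L2_dotC -[LHS]mulN1r -L2_dotZl//.
- by apply: eq_Rintegral => x _; ring.
- by have := L2_scale mOm (-1) Ls; under eq_fun do rewrite mulN1r.
- exact: L2_test_function.
Qed.

Lemma L2_dot_partial_sin psi i xi : test_function Om psi ->
  L2_dot Om (partial i psi) (fun x => sin (dot xi x)) =
  - (xi ord0 i * L2_dot Om psi (fun x => cos (dot xi x))).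
Proof.
move=> tpsi; rewrite (@L2_dot_partial_wave sin cos)//.
- exact: continuous_sin.
- exact: continuous_cos.
Qed.

End test_functions.

(** * The Fourier transform on [H10] *)

Section L2_limits.
Variables (R : realType) (n : nat) (Om : set 'rV[R]_n) (mOm : measurable Om).
Local Notation mu := (lebesgue_rV R n).
Implicit Types (f g h : 'rV[R]_n -> R).

Lemma L2_cauchy_schwarz f g : L2 Om f -> L2 Om g ->
  L2_dot Om f g ^+ 2 <= L2_dot Om f f * L2_dot Om g g.
Proof.
move=> Lf Lg.
have key t : 0 <= L2_dot Om f f - 2 * t * L2_dot Om f g + t ^+ 2 * L2_dot Om g g.
  have := @L2_dot_comb_sub R n Om mOm 1 (fun=> f) (fun=> 1) g t (fun=> Lf) Lg.
  rewrite /= !big_ord1 !mul1r => <-; exact: L2_dot_ge0.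
move: key (L2_dot_ge0 Om f) (L2_dot_ge0 Om g).
set a := L2_dot Om f f; set b := L2_dot Om f g; set c := L2_dot Om g g => key a0 c0.
have [c00|cn0] := eqVneq c 0.
  suff -> : b = 0 by rewrite expr0n/= c00 mulr0.
  apply/eqP; apply: contrapT => /negP b0.
  have := key ((a + 1) / (2 * b)); rewrite c00 mulr0 addr0.
  have -> : 2 * ((a + 1) / (2 * b)) * b = a + 1 by field.
  by lra.
have cp : 0 < c by rewrite lt_neqAle eq_sym cn0.
have := mulr_ge0 c0 (key (b / c)).
have -> : c * (a - 2 * (b / c) * b + (b / c) ^+ 2 * c) = a * c - b ^+ 2 by field.
by rewrite subr_ge0.
Qed.

Variables (g_ : nat -> 'rV[R]_n -> R) (g : 'rV[R]_n -> R).
Hypothesis Lg_ : forall m, L2 Om (g_ m).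
Hypothesis Lg : L2 Om g.
Hypothesis gg : L2_cvg Om g_ g.

Let d m x := g_ m x - g x.

Lemma L2_cvg_dist : L2_dot Om (d m) (d m) @[m --> \oo] --> 0.
Proof.
move: gg => /fine_cvg; rewrite /L2_cvg => H.
rewrite (_ : (fun m => _) = fine \o (fun m => (\int[mu]_(x in Om) ((d m x) ^+ 2)%:E)%E))//.
Qed.

Lemma L2_dot_cvg h : L2 Om h -> L2_dot Om (g_ m) h @[m --> \oo] --> L2_dot Om g h.
Proof.
move=> Lh; apply/cvgrPdist_lt => e e0.
have C0 : 0 < L2_dot Om h h + 1 by rewrite ltr_wpDl// L2_dot_ge0.
have e1 : 0 < e ^+ 2 / (L2_dot Om h h + 1) by rewrite divr_gt0// exprn_gt0.
have /cvgrPdist_lt/(_ _ e1) := L2_cvg_dist.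
apply: filterS => m; rewrite sub0r normrN ger0_norm ?L2_dot_ge0// => dm.
have Ld : L2 Om (d m) by exact: L2_sub.
have -> : L2_dot Om g h - L2_dot Om (g_ m) h = - L2_dot Om (d m) h.
  have := L2_dotDl mOm Ld Lg Lh.
  have -> : (fun x => d m x + g x) = g_ m by apply/funext => x; rewrite /d subrK.
  by move=> ->; lra.
rewrite normrN -(@ltr_pXn2r _ 2)// ?nnegrE// ?(ltW e0)// real_normK ?num_real//.
apply: le_lt_trans (L2_cauchy_schwarz Ld Lh) _.
move: dm; rewrite ltr_pdivlMr//; apply: le_lt_trans.
by rewrite ler_wpM2l ?L2_dot_ge0// lerDl.
Qed.

End L2_limits.

Section H10_fourier.
Variables (R : realType) (n : nat) (Om : set 'rV[R]_n).
Hypothesis oOm : open Om.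
Local Notation mu := (lebesgue_rV R n).
Variables (V : R) (muOm : mu Om = V%:E).
Variables (u : 'rV[R]_n -> R) (Du : 'I_n -> 'rV[R]_n -> R).
Hypothesis uH : H10 Om u Du.

Let mOm : measurable Om. Proof. exact: open_measurable_rV. Qed.

(** The gradient becomes multiplication by [xi], first for the approximating test
    functions and then in the limit. *)
Lemma H10_cos i xi : L2_dot Om (Du i) (fun x => cos (dot xi x)) =
  xi ord0 i * L2_dot Om u (fun x => sin (dot xi x)).
Proof.
have [[Lu LDu _] [psi [tpsi pu pDu]]] := uH.
have Lc := L2_cos mOm muOm xi; have Ls := L2_sin mOm muOm xi.
have Lpsi m := L2_test_function oOm muOm (tpsi m).
have Ldpsi m := L2_partial_test_function oOm muOm i (tpsi m).
have c1 := L2_dot_cvg mOm Ldpsi (LDu i) (pDu i) Lc.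
have c2 := L2_dot_cvg mOm Lpsi Lu pu Ls.
have E : (fun m => L2_dot Om (partial i (psi m)) (fun x => cos (dot xi x))) =
    fun m => xi ord0 i * L2_dot Om (psi m) (fun x => sin (dot xi x)).
  by apply/funext => m; rewrite (L2_dot_partial_cos oOm muOm).
apply: (cvg_unique _ c1) => //; rewrite [X in X @ _]E.
by apply: cvgM; [exact: cvg_cst|exact: c2].
Qed.

Lemma H10_sin i xi : L2_dot Om (Du i) (fun x => sin (dot xi x)) =
  - (xi ord0 i * L2_dot Om u (fun x => cos (dot xi x))).
Proof.
have [[Lu LDu _] [psi [tpsi pu pDu]]] := uH.
have Lc := L2_cos mOm muOm xi; have Ls := L2_sin mOm muOm xi.
have Lpsi m := L2_test_function oOm muOm (tpsi m).
have Ldpsi m := L2_partial_test_function oOm muOm i (tpsi m).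
have c1 := L2_dot_cvg mOm Ldpsi (LDu i) (pDu i) Ls.
have c2 := L2_dot_cvg mOm Lpsi Lu pu Lc.
have E : (fun m => L2_dot Om (partial i (psi m)) (fun x => sin (dot xi x))) =
    fun m => - (xi ord0 i * L2_dot Om (psi m) (fun x => cos (dot xi x))).
  by apply/funext => m; rewrite (L2_dot_partial_sin _ _ (tpsi m)).
apply: (cvg_unique _ c1) => //; rewrite [X in X @ _]E.
by apply: cvgN; apply: cvgM; [exact: cvg_cst|exact: c2].
Qed.

Lemma power_integral_le f : L2 Om f ->
  (\int[mu]_xi (power (f \_ Om) xi)%:E <= ((2 * pi) ^+ n * L2_dot Om f f)%:E)%E.
Proof.
move=> Lf; have [i1 i2] := L2_integrable_restrict oOm muOm Lf.
by rewrite -Rintegral_sqr_restrict; exact: plancherel_le.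
Qed.

Lemma power_integrable f : L2 Om f ->
  mu.-integrable setT (EFin \o power (f \_ Om)).
Proof.
move=> Lf; have [i1 i2] := L2_integrable_restrict oOm muOm Lf.
apply/integrableP; split; first by apply: measurable_EFin_fun; exact: measurable_power.
under eq_integral do rewrite /= ger0_norm ?power_ge0//.
by apply: le_lt_trans (power_integral_le Lf) _; rewrite ltry.
Qed.

(* For a positive [e], (a + b)^2 <= (1 + e) a^2 + (1 + 1/e) b^2. *)
Let young_sqr (a b e : R) : 0 < e ->
  (a + b) ^+ 2 <= (1 + e) * a ^+ 2 + (1 + e^-1) * b ^+ 2.
Proof.
move=> e0; rewrite -subr_ge0.
have -> : (1 + e) * a ^+ 2 + (1 + e^-1) * b ^+ 2 - (a + b) ^+ 2 = e^-1 * (e * a - b) ^+ 2.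
  by field; rewrite gt_eqF.
by rewrite mulr_ge0 ?sqr_ge0// invr_ge0 ltW.
Qed.

(** Plancherel's lower bound passes from test functions to their L^2 limits. *)
Lemma H10_plancherel_ge :
  (2 * pi) ^+ n * L2_dot Om u u <= \int[mu]_xi (power (u \_ Om) xi).
Proof.
have [[Lu LDu _] [psi [tpsi pu pDu]]] := uH.
have Lpsi m := L2_test_function oOm muOm (tpsi m).
have P0 : 0 < (2 * pi) ^+ n :> R by rewrite exprn_gt0// mulr_gt0// pi_gt0.
set P := (2 * pi) ^+ n in P0 *.
set B := Rintegral _ _ _.
pose d m x := psi m x - u x.
have Ld m : L2 Om (d m) by exact: L2_sub.
pose e_ m := L2_dot Om (d m) (d m).
have e_0 : e_ m @[m --> \oo] --> 0 by exact: (L2_cvg_dist pu).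
have psiE m : psi m = fun x => u x + d m x.
  by apply/funext => x; rewrite /d addrC subrK.
have ge_psi m : P * L2_dot Om (psi m) (psi m) <= \int[mu]_xi (power (psi m \_ Om) xi).
  have [cpsi _ _] := test_function_C1 (tpsi m).
  have [M M0 z] := test_function_zero_outside (tpsi m).
  rewrite -lee_fin -RintegralE_fin//; last exact: power_integrable.
  rewrite -Rintegral_sqr_restrict test_function_restrict//.
  exact: plancherel_ge M0 cpsi z.
have step1 e m : 0 < e -> \int[mu]_xi (power (psi m \_ Om) xi) <=
    (1 + e) * B + (1 + e^-1) * (P * e_ m).
  move=> e0.
  have i1 := integrable_scale measurableT (1 + e) (power_integrable Lu).
  have i2 := integrable_scale measurableT (1 + e^-1) (power_integrable (Ld m)).
  apply: (@le_trans _ _ (\int[mu]_xi ((1 + e) * power (u \_ Om) xi +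
      (1 + e^-1) * power (d m \_ Om) xi))).
    apply: le_Rintegral => //; first exact: power_integrable.
      exact: (integrable_add measurableT i1 i2).
    move=> xi _; rewrite !power_restrict.
    have dot_psi h : L2 Om h ->
        L2_dot Om (psi m) h = L2_dot Om u h + L2_dot Om (d m) h.
      by move=> Lh; rewrite {1}psiE L2_dotDl.
    rewrite !dot_psi; [|exact: (L2_sin mOm muOm)|exact: (L2_cos mOm muOm)].
    have := lerD (young_sqr (L2_dot Om u (fun x => cos (dot xi x)))
        (L2_dot Om (d m) (fun x => cos (dot xi x))) e0)
      (young_sqr (L2_dot Om u (fun x => sin (dot xi x)))
        (L2_dot Om (d m) (fun x => sin (dot xi x))) e0).
    by move: (L2_dot Om u _) (L2_dot Om (d m) _) (L2_dot Om u _)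
      (L2_dot Om (d m) _) (e^-1) => a b a' b' e'; lra.
  rewrite RintegralD// RintegralZl//; last exact: power_integrable.
  rewrite RintegralZl//; last exact: power_integrable.
  rewrite lerD2l ler_wpM2l//; first by rewrite addr_ge0// invr_ge0 ltW.
  rewrite -lee_fin -RintegralE_fin//; last exact: power_integrable.
  exact: power_integral_le.
have step2 e m : 0 < e -> L2_dot Om u u <=
    (1 + e) * L2_dot Om (psi m) (psi m) + (1 + e^-1) * e_ m.
  move=> e0.
  have i1 := integrable_scale mOm (1 + e) (L2_mul_integrable mOm (Lpsi m) (Lpsi m)).
  have i2 := integrable_scale mOm (1 + e^-1) (L2_mul_integrable mOm (Ld m) (Ld m)).
  rewrite /e_ /L2_dot -!RintegralZl//; try exact: L2_mul_integrable.
  rewrite -RintegralD//; apply: le_Rintegral => //; first exact: L2_mul_integrable.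
    exact: (integrable_add mOm i1 i2).
  move=> x _; have uE : u x = psi m x + - d m x by rewrite /d opprB addrC subrK.
  by have := young_sqr (psi m x) (- d m x) e0; rewrite -uE (sqrrN (d m x)) !expr2.
have B0 : 0 <= B by apply: Rintegral_ge0 => xi _; exact: power_ge0.
(* For a fixed [e] the errors [e_ m] tend to 0; then [e] tends to 0. *)
have main e : 0 < e -> P * L2_dot Om u u <= (1 + e) ^+ 2 * B.
  move=> e0; pose C := ((1 + e) * (1 + e^-1) + (1 + e^-1)) * P.
  have H m : P * L2_dot Om u u <= (1 + e) ^+ 2 * B + C * e_ m.
    have e1 : 0 < e^-1 by rewrite invr_gt0.
    have s2 := ler_wpM2l (ltW P0) (step2 e m e0).
    have ee : 0 <= 1 + e by lra.
    have s1 := ler_wpM2l ee (le_trans (ge_psi m) (step1 e m e0)).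
    rewrite /C; move: s1 s2; move: (L2_dot Om (psi m) _) (e_ m) (e^-1) => X Y Z.
    by lra.
  have cv : (1 + e) ^+ 2 * B + C * e_ m @[m --> \oo] --> (1 + e) ^+ 2 * B + C * 0.
    by apply: cvgD; [exact: cvg_cst|apply: cvgM; [exact: cvg_cst|exact: e_0]].
  rewrite mulr0 addr0 in cv.
  by apply: (cvgr_to_ge cv); exact: nearW.
have cv : (1 + k.+1%:R^-1) ^+ 2 * B @[k --> \oo] --> (1 + 0) ^+ 2 * B.
  apply: cvgM; last exact: cvg_cst.
  by apply: (cvg_comp _ (fun t : R => t ^+ 2)) (@exprn_continuous _ 2 _);
    apply: cvgD; [exact: cvg_cst|exact: (@cvg_harmonic R)].
rewrite addr0 expr1n mul1r in cv.
apply: (cvgr_to_ge cv); apply: nearW => k; apply: main.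
by rewrite invr_gt0.
Qed.

End H10_fourier.

(** * Integrals of radial functions *)

Section shells.
Variables (R : realType) (n : nat).
Local Notation leb := (@lebesgue_measure R).
Local Notation mu := (lebesgue_rV R n).
Variables (al be : R) (al0 : 0 <= al) (albe : al < be).
Variables (g : R -> R).
Hypothesis g0 : forall s, al <= s <= be -> 0 <= g s.
Hypothesis cg : {within `[al, be], continuous g}.

Let mg : measurable_fun setT (g \_ `]al, be]).
Proof.
apply/measurable_restrict => //; rewrite setTI.
apply: measurable_funS (subspace_continuous_measurable_fun _ cg) => //.
exact: subset_itv_oc_cc.
Qed.

Let gp0 s : 0 <= (g \_ `]al, be]) s.
Proof.
rewrite patchE; case: ifPn => // /set_mem /=; rewrite in_itv/= => /andP[als sb].
by rewrite g0// sb ltW.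
Qed.

(** Superposition of the indicator functions of the balls of radius [s] between
    [al] and [be], with density [g]. *)
Definition shell (xi : 'rV[R]_n) : \bar R :=
  (\int[leb]_s ((g \_ `]al, be]) s * (sqnorm xi < s ^+ 2)%R%:R)%:E)%E.

Let mshell2 : measurable_fun setT (fun p : 'rV[R]_n * measurableTypeR R =>
  ((g \_ `]al, be]) p.2 * (sqnorm p.1 < p.2 ^+ 2)%R%:R)%:E).
Proof.
apply: measurable_EFin_fun; apply: measurable_funM.
  exact: (measurableT_comp mg measurable_snd).
pose B := [set p : 'rV[R]_n * measurableTypeR R | sqnorm p.1 - p.2 ^+ 2 < 0].
have mB : measurable B.
  rewrite (_ : B = setT `&` (fun p : 'rV[R]_n * measurableTypeR R =>
      sqnorm p.1 - p.2 ^+ 2) @^-1` `]-oo, 0[%classic).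
    suff mh : measurable_fun setT (fun p : 'rV[R]_n * measurableTypeR R =>
      sqnorm p.1 - p.2 ^+ 2) by exact: mh.
    apply: measurable_funB; last by apply: measurable_funX; exact: measurable_snd.
    exact: (measurableT_comp (@measurable_sqnorm R n) measurable_fst).
  by rewrite setTI; apply/seteqP; split => p; rewrite /= in_itv.
rewrite (_ : (fun p => _) = \1_B); first exact: measurable_indic.
apply/funext => p; rewrite indicE; congr ((nat_of_bool _)%:R).
by apply/idP/idP; rewrite inE /B/= subr_lt0.
Qed.

Let shell2_ge0 (p : 'rV[R]_n * measurableTypeR R) :
  (0 <= ((g \_ `]al, be]) p.2 * (sqnorm p.1 < p.2 ^+ 2)%R%:R)%:E)%E.
Proof. by rewrite lee_fin mulr_ge0// gp0. Qed.

Lemma measurable_shell : measurable_fun setT shell.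
Proof. exact: (measurable_fun_fubini_tonelli_F _ mshell2 shell2_ge0). Qed.

Lemma shell_ge0 xi : (0 <= shell xi)%E.
Proof. by apply: integral_ge0 => s _; exact: (shell2_ge0 (xi, s)). Qed.

(** If [|xi| <= rho], all the balls of radius between [rho] and [be] contain
    [xi]. *)
Lemma shell_lower (G : R -> R) (xi : 'rV[R]_n) (rho : R) :
  (forall s, al < s < be -> is_derive s (1 : R) G (g s)) ->
  {within `[al, be], continuous G} ->
  al <= rho <= be -> sqnorm xi <= rho ^+ 2 ->
  ((G be - G rho)%:E <= shell xi)%E.
Proof.
move=> dG cG /andP[alrho]; rewrite le_eqVlt => /predU1P[->|rhobe] xirho.
  by rewrite subrr; exact: shell_ge0.
have sub : `[rho, be] `<=` `[al, be].
  by apply: subset_itvr; rewrite bnd_simp.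
have cg' : {within `[rho, be], continuous g}.
  exact: continuous_subspaceW cg.
have cG' : {within `[rho, be], continuous G}.
  exact: continuous_subspaceW cG.
have -> : (G be - G rho)%:E = (\int[leb]_(s in `]rho, be]) (g s)%:E)%E.
  rewrite integral_itv_obnd_cbnd; last first.
    apply: measurable_EFin_fun.
    apply: measurable_funS (subspace_continuous_measurable_fun _ cg') => //.
    exact: subset_itv_oc_cc.
  rewrite EFinB; apply/esym/continuous_FTC2 => //.
    have /(continuous_within_itvP _ rhobe)[_ Gl Gr] := cG'.
    split => // s; rewrite in_itv/= => /andP[rs sb].
    have [] // := dG s _; by rewrite (le_lt_trans alrho rs).
  move=> s; rewrite in_itv/= => /andP[rs sb]; rewrite derive1E.
  have sab : al < s < be by rewrite (le_lt_trans alrho rs).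
  by have [] := dG s sab.
rewrite integral_mkcond /shell; apply: ge0_le_integral => //.
- move=> s _; rewrite patchE; case: ifPn => // /set_mem/=; rewrite in_itv/= => /andP[rs sb].
  by rewrite lee_fin g0// sb (le_trans alrho (ltW rs)).
- apply/measurable_restrict => //; rewrite setTI; apply: measurable_EFin_fun.
  apply: measurable_funS (subspace_continuous_measurable_fun _ cg') => //.
  exact: subset_itv_oc_cc.
- exact: (measurableT_comp mshell2 (measurable_pair1 xi)).
- move=> s _; rewrite patchE; case: ifPn => [/set_mem/=|_]; last exact: (shell2_ge0 (xi, s)).
  rewrite in_itv/= => /andP[rs sb]; rewrite lee_fin patchE mem_set/=; last first.
    by rewrite in_itv/= sb (le_lt_trans alrho rs).
  suff -> : sqnorm xi < s ^+ 2 by rewrite mulr1.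
  apply: le_lt_trans xirho _; rewrite ltrXn2r//.
  exact: le_trans alrho.
Qed.

(** Tonelli's theorem and the volume of balls. *)
Lemma shell_integral (H : R -> R) :
  (forall s, al < s < be -> is_derive s (1 : R) H (s ^+ n * g s)) ->
  {within `[al, be], continuous H} ->
  {within `[al, be], continuous (fun s => s ^+ n * g s)} ->
  (\int[mu]_xi shell xi = (omega R n * (H be - H al))%:E)%E.
Proof.
move=> dH cH cng; rewrite /shell.
rewrite (@fubini_tonelli _ _ _ _ _ mu leb
    (fun p => ((g \_ `]al, be]) p.2 * (sqnorm p.1 < p.2 ^+ 2)%R%:R)%:E))//=.
transitivity (\int[leb]_s ((fun s => (omega R n * (s ^+ n * g s))%:E) \_ `]al, be]) s)%E.
  have om0 : 0 <= omega R n by rewrite /omega fine_ge0.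
  have mind s : measurable_fun setT (fun xi : 'rV[R]_n => (sqnorm xi < s)%R%:R : R).
    rewrite (_ : (fun _ => _) = \1_[set xi : 'rV[R]_n | sqnorm xi < s]).
      by apply: measurable_indic; exact: measurable_sqnorm_lt.
    apply/funext => xi; rewrite indicE; congr ((nat_of_bool _)%:R).
    by apply/idP/idP; rewrite inE.
  apply: eq_integral => s _; rewrite !patchE; case: ifPn => [/set_mem/=|_].
    rewrite in_itv/= => /andP[als sb]; under eq_integral do rewrite EFinM.
    rewrite ge0_integralZl//; last 2 first.
    - by apply: measurable_EFin_fun; exact: mind.
    - by rewrite lee_fin g0// sb ltW.
    have -> : (\int[mu]_xi ((sqnorm xi < s ^+ 2)%R%:R)%:E = (s ^+ n * omega R n)%:E)%E.
      have mB := @measurable_sqnorm_lt R n (s ^+ 2).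
      transitivity (\int[mu]_xi (\1_[set xi : 'rV[R]_n | sqnorm xi < s ^+ 2] xi)%:E)%E.
        apply: eq_integral => xi _; rewrite indicE; congr ((nat_of_bool _)%:R%:E).
        by apply/idP/idP; rewrite inE.
      by rewrite integral_indic// setIT; apply: ball_measure; exact: le_lt_trans als.
    by rewrite -EFinM; congr EFin; ring.
  by under eq_integral do rewrite mul0r; rewrite integral0.
rewrite -integral_mkcond.
have cng' : {within `[al, be], continuous (fun s => omega R n * (s ^+ n * g s))}.
  by move=> s; apply: cvgM; [exact: cvg_cst|exact: cng].
rewrite integral_itv_obnd_cbnd; last first.
  apply: measurable_EFin_fun.
  apply: measurable_funS (subspace_continuous_measurable_fun _ cng') => //.
  exact: subset_itv_oc_cc.
have -> : (omega R n * (H be - H al))%:E =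
    ((omega R n * H be)%:E - (omega R n * H al)%:E)%E by rewrite -EFinB mulrBr.
apply: (@continuous_FTC2 _ _ (fun s => omega R n * H s)) => //.
- have /(continuous_within_itvP _ albe)[_ Hl Hr] := cH.
  split; [|by apply: cvgM; [exact: cvg_cst|]|by apply: cvgM; [exact: cvg_cst|]].
  move=> s; rewrite in_itv/= => sab; have [dHs _] := dH s sab.
  by apply: derivableM => //; exact: derivable_cst.
- move=> s; rewrite in_itv/= => sab; rewrite derive1E.
  have := dH s sab => dHs.
  have dd : is_derive s (1 : R) (fun s => omega R n * H s) (omega R n * (s ^+ n * g s)).
    by apply: is_derive_eq; rewrite /GRing.scale/= ?mulr0 ?addr0.
  by apply: derive_val.
Qed.

End shells.

(** * The bathtub weight *)

Lemma is_derive_monomial (R : realType) (c : R) (k : nat) (s : R) :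
  is_derive s (1 : R) (fun s => c * s ^+ k.+1) (c * (k.+1%:R * s ^+ k)).
Proof.
rewrite (_ : (fun s => _) = c *: ((@id R) ^+ k.+1)); last first.
  by apply/funext => t; rewrite exprfctE.
by apply: is_derive_eq; rewrite /GRing.scale/= mulr1.
Qed.

Section bathtub.
Variables (R : realType) (n : nat) (hn : (3 <= n)%N) (L : R) (L0 : 0 < L).
Local Notation mu := (lebesgue_rV R n).

(** The radial function [Phi xi] is [m * (1 + a - a |xi|^2 / L)] inside the ball of
    radius [x_ * sqrt L], with [m] the minimum of [1] and [L / |xi|^2], and [0]
    outside; [a] is chosen so that it vanishes on the sphere. The last property is
    immediate from the two bounds on [F], and the integral is the stated multiple of
    [K_] by the equation of [x_]. To integrate it, [Phi] is written as a superposition of indicator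
    functions of balls, separately for the radii below and above [sqrt L]. *)
Lemma bathtub : exists (a : R) (Phi : 'rV[R]_n -> \bar R),
  [/\ 0 < a, measurable_fun setT Phi, forall xi, (0 <= Phi xi)%E,
    (\int[mu]_xi Phi xi = (omega R n * (Num.sqrt L ^+ n * K_ R n))%:E)%E &
    forall (xi : 'rV[R]_n) (F V : R), 0 <= F -> F <= V -> sqnorm xi * F <= L * V ->
      (((1 + a) * F)%:E <= (a / L * (sqnorm xi * F))%:E + V%:E * Phi xi)%E].
Proof.
have L0' := L0.
have [x1 xeq] := x_equationP R hn; set x := x_ R n in x1 xeq *.
have n3 : 3 <= n%:R :> R by rewrite (ler_nat _ 3).
have nS3 : n = (n - 3).+3 by rewrite -addn3 subnK.
pose m := (n - 3)%N.
have mE : m%:R = n%:R - 3 :> R by rewrite /m natrB.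
have nm : n = m.+3 by [].
have x0 : 0 < x by lra.
have x2 : 0 < x ^+ 2 - 1 by rewrite subr_gt0 exprn_egt1.
pose a := (x ^+ 2 - 1)^-1; have a0 : 0 < a by rewrite invr_gt0.
have ax : a * x ^+ 2 = 1 + a.
  by rewrite /a; field; rewrite gt_eqF.
pose r := Num.sqrt L; have r0 : 0 < r by rewrite sqrtr_gt0.
have r2 : r ^+ 2 = L by rewrite sqr_sqrtr// ltW.
have rxr : r < x * r by rewrite ltr_pMl.
have xr2 : (x * r) ^+ 2 = x ^+ 2 * L by rewrite exprMn r2.
(* [g1] and [g2] are minus the radial derivative of [Phi] below and above [r],
   [G1] and [G2] their primitives, [H1] and [H2] those of [s ^+ n * g1 s] and of
   [s ^+ n * g2 s]. *)
pose g1 (s : R) := 2 * a / L * s.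
pose G1 (s : R) := a / L * s ^+ 2.
pose H1 (s : R) := 2 * a / L / (n%:R + 2) * s ^+ n.+2.
pose g2 (s : R) := 2 * (1 + a) * L * (s ^+ 3)^-1.
pose G2 (s : R) := - ((1 + a) * L) * (s ^+ 2)^-1.
pose H2 (s : R) := 2 * (1 + a) * L / (n%:R - 2) * s ^+ m.+1.
have aL : 0 < a / L by rewrite divr_gt0.
have dG1 (s : R) : is_derive s (1 : R) G1 (g1 s).
  apply: is_derive_eq; rewrite /GRing.scale/= /g1; ring.
have nS2 : n.+2%:R = n%:R + 2 :> R by rewrite -addn2 natrD.
have mS1 : m.+1%:R = n%:R - 2 :> R by rewrite -addn1 natrD mE; lra.
have dH1 (s : R) : is_derive s (1 : R) H1 (s ^+ n * g1 s).
  refine (@is_derive_eq _ _ _ H1 _ _ _ _ (is_derive_monomial _ n.+1 s) _).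
  rewrite nS2 /g1 (exprS s n); move: (s ^+ n) => e.
  by field; rewrite !gt_eqF//; lra.
have dG2 (s : R) : 0 < s -> is_derive s (1 : R) G2 (g2 s).
  move=> s0; have s20 : s ^+ 2 != 0 by rewrite expf_neq0// gt_eqF.
  have dX : is_derive s (1 : R) (fun s => s ^+ 2) (2 * s).
    by apply: is_derive_eq; rewrite /GRing.scale/=; ring.
  have dV := @is_deriveV R (fun s : R => s ^+ 2) s (2 * s) 1 s20 dX.
  have dZ := @is_deriveZ R R R _ (- ((1 + a) * L)) _ _ _ dV.
  refine (@is_derive_eq _ _ _ G2 _ _ _ _ dZ _).
  rewrite /GRing.scale/= /g2; field; rewrite gt_eqF//.
have dH2 (s : R) : 0 < s -> is_derive s (1 : R) H2 (s ^+ n * g2 s).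
  move=> s0.
  refine (@is_derive_eq _ _ _ H2 _ _ _ _ (is_derive_monomial _ m s) _).
  have -> : s ^+ n = s ^+ m * s ^+ 3 by rewrite -exprD addn3 -nm.
  rewrite mS1 /g2; move: (s ^+ m) => e.
  by field; rewrite !gt_eqF//; lra.
have cont (f df : R -> R) (u v : R) :
    (forall s, u <= s <= v -> is_derive s (1 : R) f (df s)) ->
    {within `[u, v], continuous f}.
  move=> d; apply: derivable_within_continuous => s; rewrite in_itv/= => /d.
  by case.
have cg1 : {within `[0, r], continuous g1}.
  by apply: (cont _ (fun=> 2 * a / L)) => s _; apply: is_derive_eq;
    rewrite /GRing.scale/=; ring.
have cg2 : {within `[r, x * r], continuous g2}.
  apply: derivable_within_continuous => s; rewrite in_itv/= => /andP[rs _].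
  have s3 : s ^+ 3 != 0 by rewrite expf_neq0// gt_eqF// (lt_le_trans r0).
  have dX : is_derive s (1 : R) (fun s => s ^+ 3) (3 * s ^+ 2).
    by apply: is_derive_eq; rewrite /GRing.scale/=; ring.
  have dV := @is_deriveV R (fun s : R => s ^+ 3) s (3 * s ^+ 2) 1 s3 dX.
  by have [] := @is_deriveZ R R R _ (2 * (1 + a) * L) _ _ _ dV.
have cXn (u v : R) : {within `[u, v], continuous (fun s : R => s ^+ n)}.
  by apply: continuous_subspaceT; exact: exprn_continuous.
have g10 s : 0 <= s <= r -> 0 <= g1 s.
  by move=> /andP[s0 _]; rewrite mulr_ge0// -mulrA mulr_ge0// ltW.
have g20 s : r <= s <= x * r -> 0 <= g2 s.
  move=> /andP[rs _]; have s0 : 0 < s by exact: lt_le_trans rs.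
  apply: mulr_ge0; last by rewrite invr_ge0 exprn_ge0// ltW.
  by rewrite mulr_ge0 ?ltW// mulr_gt0// addr_gt0.
have le0r : 0 <= r by rewrite ltW.
pose S1 := @shell R n 0 r g1; pose S2 := @shell R n r (x * r) g2.
have mSh1 : measurable_fun setT S1 by exact: measurable_shell.
have mSh2 : measurable_fun setT S2 by exact: measurable_shell.
have S10 xi : (0 <= S1 xi)%E by exact: shell_ge0.
have S20 xi : (0 <= S2 xi)%E by exact: shell_ge0.
have pos s : r <= s -> 0 < s by exact: lt_le_trans.
exists a, (fun xi => S1 xi + S2 xi)%E; split => //.
- exact: emeasurable_funD.
- by move=> xi; exact: adde_ge0.
- rewrite ge0_integralD//.
  have -> : (\int[mu]_xi S1 xi = (omega R n * (H1 r - H1 0))%:E)%E.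
    have cH1 : {within `[0, r], continuous H1}.
      exact: (cont _ (fun s => s ^+ n * g1 s)).
    apply: (@shell_integral R n 0 r (lexx 0) r0 g1 g10 cg1 H1 (fun s _ => dH1 s) cH1).
    by move=> s; apply: cvgM; [exact: cXn|exact: cg1].
  have -> : (\int[mu]_xi S2 xi = (omega R n * (H2 (x * r) - H2 r))%:E)%E.
    apply: (@shell_integral R n r (x * r) le0r rxr g2 g20 cg2 H2).
    - by move=> s /andP[rs _]; apply: dH2; exact: lt_trans rs.
    - by apply: (cont _ (fun s => s ^+ n * g2 s)) => s /andP[rs _]; apply: dH2; exact: pos.
    - by move=> s; apply: cvgM; [exact: cXn|exact: cg2].
  rewrite -EFinD -mulrDr; congr (_ * _)%:E.
  rewrite /H1 /H2 expr0n/= mulr0 subr0 /K_ -/x.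
  have n2 : (n - 2 = m.+1)%N by rewrite nm.
  have xnE : x ^+ n = x ^+ 2 * x ^+ m.+1 by rewrite -exprD -n2 subnKC// (ltnW hn).
  have rnE : r ^+ n = r ^+ m.+1 * L by rewrite -r2 -exprD -n2 subnK// (ltnW hn).
  have rn2E : r ^+ n.+2 = r ^+ m.+1 * L * L by rewrite -rnE -r2 -exprD addn2.
  move: xeq; rewrite exprMn rn2E rnE n2 xnE /a.
  move: x2; rewrite subr_gt0; move: (x ^+ 2) (x ^+ m.+1) (r ^+ m.+1) (n%:R : R) n3.
  move=> X b e N N3 X1 E.
  have NE : N != 0 by rewrite gt_eqF//; lra.
  apply/eqP; rewrite -subr_eq0; apply/eqP.
  transitivity (- (e * L / ((X - 1) * (N - 2))) *
      ((N - 2) * (X * b) - N * b + 8 / (N + 2))); last by rewrite E mulr0.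
  by field; rewrite !gt_eqF//; lra.
move=> xi F V F0 FV qFV; set q := sqnorm xi in qFV *.
have q0 : 0 <= q := sqnorm_ge0 xi.
have V0 : 0 <= V by exact: le_trans FV.
have low1 rho : 0 <= rho <= r -> q <= rho ^+ 2 -> ((G1 r - G1 rho)%:E <= S1 xi)%E.
  have cG1 : {within `[0, r], continuous G1} by exact: (cont _ g1).
  exact: (@shell_lower R n 0 r (lexx 0) g1 g10 cg1 G1 xi rho (fun s _ => dG1 s) cG1).
have low2 rho : r <= rho <= x * r -> q <= rho ^+ 2 -> ((G2 (x * r) - G2 rho)%:E <= S2 xi)%E.
  have dG2' s : r < s < x * r -> is_derive s (1 : R) G2 (g2 s).
    by move=> /andP[rs _]; apply: dG2; exact: lt_trans rs.
  have cG2 : {within `[r, x * r], continuous G2}.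
    by apply: (cont _ g2) => s /andP[rs _]; apply: dG2; exact: pos.
  exact: (@shell_lower R n r (x * r) le0r g2 g20 cg2 G2 xi rho dG2' cG2).
have sq : Num.sqrt q ^+ 2 = q by rewrite sqr_sqrtr.
have G2x : G2 (x * r) = - a.
  rewrite /G2 xr2 -ax; field; rewrite !gt_eqF//.
have [qL|Lq] := leP q L.
  have H : (((1 + a) - a / L * q)%:E <= S1 xi + S2 xi)%E.
    apply: le_trans (leeD (low1 (Num.sqrt q) _ _) (low2 r _ _)).
    - rewrite -EFinD lee_fin G2x /G1 /G2 sq r2.
      by rewrite le_eqVlt; apply/orP; left; apply/eqP; field; rewrite !gt_eqF.
    - by rewrite sqrtr_ge0/= /r ler_wsqrtr.
    - by rewrite sq.
    - by rewrite lexx/= ltW.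
    - by rewrite r2.
  apply: le_trans (leeD2l _ (lee_wpmul2l _ H)); last by rewrite lee_fin.
  rewrite -EFinM -EFinD lee_fin.
  have : 0 <= (V - F) * (1 + a - a / L * q).
    rewrite mulr_ge0 ?subr_ge0//.
    have : a / L * q <= a by rewrite mulrAC ler_pdivrMr// ler_wpM2l// ltW.
    by lra.
  by lra.
have [qx|xq] := leP q (x ^+ 2 * L).
  have qp : 0 < q by exact: lt_trans Lq.
  have H : (((1 + a) * L / q - a)%:E <= S1 xi + S2 xi)%E.
    rewrite -[leLHS]add0e; apply: leeD => //.
    apply: le_trans (low2 (Num.sqrt q) _ _).
    - rewrite lee_fin G2x /G2 sq; lra.
    - rewrite /r ler_wsqrtr ?(ltW Lq)//= -(ler_pXn2r (_ : (0 < 2)%N))// ?nnegrE ?sqrtr_ge0//.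
        by rewrite sq xr2.
      by rewrite mulr_ge0// ltW.
    - by rewrite sq.
  apply: le_trans (leeD2l _ (lee_wpmul2l _ H)); last by rewrite lee_fin.
  rewrite -EFinM -EFinD lee_fin -(ler_pM2r qp).
  have c0 : 0 <= (1 + a) * L - a * q by rewrite subr_ge0 -ax -mulrA ler_wpM2l// ltW.
  have := mulr_ge0 c0 (_ : 0 <= L * V - q * F).
  rewrite subr_ge0 => /(_ qFV) P.
  rewrite -subr_ge0 (_ : _ - _ = ((1 + a) * L - a * q) * (L * V - q * F) / L).
    by rewrite divr_ge0// ltW.
  by field; rewrite !gt_eqF.
apply: le_trans (_ : (a / L * (q * F))%:E <= _)%E; last first.
  by rewrite leeDl// mule_ge0 ?lee_fin// adde_ge0.
rewrite lee_fin mulrA ler_wpM2r// -ax -mulrA ler_wpM2l ?ltW//.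
by rewrite mulrC ltr_pdivlMr.
Qed.

End bathtub.

(** * The lower bound on the eigenvalues *)

Section counting.
Variables (R : realType) (n : nat) (hn : (3 <= n)%N) (Om : set 'rV[R]_n).
Hypothesis oOm : open Om.
Local Notation mu := (lebesgue_rV R n).
Variables (V : R) (V0 : 0 < V) (muOm : mu Om = V%:E).
Variables (lam : nat -> R) (Hlam : dirichlet_eigenvalues Om lam).

Let mOm : measurable Om. Proof. exact: open_measurable_rV. Qed.

(** The bound in terms of the number of eigenvalues. *)
Lemma eigenvalue_count k : (0 < k)%N ->
  (2 * pi) ^+ n * k%:R <=
  V * (omega R n * (Num.sqrt (lam k.-1) ^+ n * K_ R n)).
Proof.
move=> k0; have [lam0 ndlam _ [phi [Lphi ophi _] Hphi]] := Hlam.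
have /choice[D HD] : forall j, exists Dphi, H10 Om (phi j) Dphi /\
    forall v Dv, H10 Om v Dv ->
      dirichlet_form Om Dphi Dv = lam j * L2_dot Om (phi j) v.
  by move=> j; have [Dphi ? ?] := Hphi j; exists Dphi.
pose L := lam k.-1.
have L0 : 0 < L by apply: lt_le_trans lam0 _; exact: ndlam.
have hD j : H10 Om (phi j) (D j) by have [] := HD j.
have LD j i : L2 Om (D j i) by have [[_ ? _] _] := hD j.
have P0 : 0 <= (2 * pi) ^+ n :> R by rewrite exprn_ge0// mulr_ge0// pi_ge0.
have fOm : (mu Om < +oo)%E by rewrite muOm ltry.
have oD j l : \sum_(i < n) L2_dot Om (D j i) (D l i) = lam j * (j == l)%:R.
  have [_ HDj] := HD j; rewrite -ophi -(HDj _ (D l))//.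
  rewrite /dirichlet_form Rintegral_sum_ord// => i.
  exact: L2_mul_integrable.
pose F xi := \sum_(j < k) power (phi j \_ Om) xi.
have Fi : mu.-integrable setT (EFin \o F).
  apply: integrable_sum_ord => // j; exact: (power_integrable oOm muOm).
(* Plancherel for the eigenfunctions and for their gradients. *)
have F_int : (2 * pi) ^+ n * k%:R <= \int[mu]_xi F xi.
  rewrite Rintegral_sum_ord//; last by move=> j; exact: (power_integrable oOm muOm).
  have -> : (2 * pi) ^+ n * k%:R = \sum_(j < k) (2 * pi) ^+ n :> R.
    by rewrite sumr_const card_ord mulr_natr.
  apply: ler_sum => j _.
  have := H10_plancherel_ge oOm muOm (hD j).
  by rewrite ophi eqxx mulr1.
have qF xi : sqnorm xi * F xi = \sum_(j < k) \sum_(i < n) power (D j i \_ Om) xi.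
  rewrite mulr_sumr; apply: eq_bigr => j _; rewrite /sqnorm mulr_suml.
  apply: eq_bigr => i _; rewrite !power_restrict.
  rewrite (H10_cos oOm muOm (hD j)) (H10_sin oOm muOm (hD j)); ring.
have Di j : mu.-integrable setT (EFin \o (fun xi => \sum_(i < n) power (D j i \_ Om) xi)).
  by apply: integrable_sum_ord => // i; exact: (power_integrable oOm muOm).
have qFi : mu.-integrable setT (EFin \o (fun xi => sqnorm xi * F xi)).
  under eq_fun do rewrite /= qF.
  exact: integrable_sum_ord.
have qF_int : \int[mu]_xi (sqnorm xi * F xi) <= (2 * pi) ^+ n * (k%:R * L).
  under eq_Rintegral do rewrite qF.
  rewrite Rintegral_sum_ord//.
  have -> : (2 * pi) ^+ n * (k%:R * L) = \sum_(j < k) ((2 * pi) ^+ n * L).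
    by rewrite sumr_const card_ord -mulr_natl; ring.
  apply: ler_sum => j _; rewrite Rintegral_sum_ord//; last first.
    by move=> i; exact: (power_integrable oOm muOm).
  apply: (@le_trans _ _ (\sum_(i < n) (2 * pi) ^+ n * L2_dot Om (D j i) (D j i))).
    apply: ler_sum => i _; rewrite -lee_fin -RintegralE_fin//.
      exact: (power_integral_le oOm muOm).
    exact: (power_integrable oOm muOm).
  rewrite -mulr_sumr oD eqxx mulr1 ler_wpM2l//; apply: ndlam.
  by rewrite -ltnS prednK.
have F0 xi : 0 <= F xi by apply: sumr_ge0 => j _; exact: power_ge0.
have ophi' (j l : 'I_k) : L2_dot Om (phi j) (phi l) = (j == l)%:R by rewrite ophi.
have oD' (j l : 'I_k) : \sum_(i < n) L2_dot Om (D j i) (D l i) = lam j * (j == l)%:R.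
  by rewrite oD.
have FE xi : F xi = \sum_(j < k) (L2_dot Om (phi j) (fun x => cos (dot xi x)) ^+ 2 +
    L2_dot Om (phi j) (fun x => sin (dot xi x)) ^+ 2).
  by apply: eq_bigr => j _; rewrite power_restrict.
have F_le xi : F xi <= V.
  by rewrite FE; apply: (density_le_volume mOm muOm xi (fun j : 'I_k => Lphi j) ophi').
have F_decay xi : sqnorm xi * F xi <= L * V.
  rewrite FE; apply: (density_decay mOm V0 muOm (xi := xi)
    (phi := fun j : 'I_k => phi j) (D := fun j : 'I_k => D j)
    (lam := fun j : 'I_k => lam j)) => //.
  - exact: ltW.
  - by move=> j; apply: ndlam; rewrite -ltnS prednK.
  - by move=> j i; exact: (H10_cos oOm muOm (hD j)).
  - by move=> j i; exact: (H10_sin oOm muOm (hD j)).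
have [a [Phi [a0 mPhi Phi0 PhiI bath]]] := bathtub hn L0.
have a1 : 0 < 1 + a by rewrite addr_gt0.
have aL0 : 0 <= a / L by rewrite divr_ge0// ltW.
have main : (((1 + a) * \int[mu]_xi F xi)%:E <=
    (a / L * \int[mu]_xi (sqnorm xi * F xi))%:E +
     V%:E * (omega R n * (Num.sqrt L ^+ n * K_ R n))%:E)%E.
  rewrite -PhiI -ge0_integralZl//; last by rewrite lee_fin ltW.
  rewrite -!RintegralZl// -!RintegralE_fin//; last 2 first.
  - exact: (integrable_scale measurableT).
  - exact: (integrable_scale measurableT).
  rewrite -ge0_integralD//; last 4 first.
  - move=> xi _; rewrite lee_fin; apply: mulr_ge0 => //; apply: mulr_ge0 => //.
    exact: sqnorm_ge0.
  - exact: measurable_int (integrable_scale measurableT _ qFi).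
  - by move=> xi _; rewrite mule_ge0// lee_fin ltW.
  - exact: measurable_funeM.
  apply: ge0_le_integral => //.
  - by move=> xi _; rewrite lee_fin mulr_ge0// ltW.
  - exact: measurable_int (integrable_scale measurableT _ Fi).
  - apply: emeasurable_funD; last exact: measurable_funeM.
    exact: measurable_int (integrable_scale measurableT _ qFi).
  - by move=> xi _; exact: bath.
move: main; rewrite -EFinM -EFinD lee_fin => main.
have h1 := ler_wpM2l (ltW a1) F_int.
have h2 := ler_wpM2l aL0 qF_int.
have h3 : a / L * ((2 * pi) ^+ n * (k%:R * L)) = a * ((2 * pi) ^+ n * k%:R).
  by field; rewrite gt_eqF.
rewrite h3 in h2.
by move: main h1 h2; rewrite /L; lra.
Qed.

End counting.

Lemma omega_ge0 (R : realType) n : 0 <= omega R n.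
Proof. by rewrite /omega fine_ge0. Qed.

Theorem theorem4p1 (R : realType) (n : nat) (hn : (3 <= n)%N) :
  [/\ unique (@x_equation R n) (x_ R n),
      forall (Omega : set 'rV[R]_n) (V : R) (lam : nat -> R),
        open Omega -> 0 < V -> lebesgue_rV R n Omega = V%:E ->
        dirichlet_eigenvalues Omega lam ->
        forall k : nat, (1 <= k)%N ->
          lam k.-1 >= c_ R n * weyl_constant R n * V `^ (- (2 / n%:R))
                      * k%:R `^ (2 / n%:R)
    & n%:R / (n%:R + 2) < c_ R n < 1].
Proof.
split; [exact: x_equation_unique| |exact: c_bounds].
move=> Om V lam oOm V0 muOm Hlam k k0.
have H := eigenvalue_count hn oOm V0 muOm Hlam k0.
have [lam0 ndlam _ _] := Hlam.
have L0 : 0 < lam k.-1 by apply: lt_le_trans lam0 _; exact: ndlam.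
move: (lam k.-1) L0 H => L L0 H.
have n0 : 0 < n%:R :> R by rewrite ltr0n (leq_trans _ hn).
have P0 : 0 < 2 * pi :> R by rewrite mulr_gt0// pi_gt0.
have kR0 : 0 < k%:R :> R by rewrite ltr0n.
have K1 := K_gt1 R hn.
have K0 : 0 < K_ R n by exact: lt_trans K1.
have w0 : 0 < omega R n.
  rewrite lt_neqAle omega_ge0 andbT; apply/eqP => w0.
  move: H; rewrite -w0 mul0r mulr0 leNgt => /negP; apply.
  by rewrite mulr_gt0// exprn_gt0.
pose e : R := 2 / n%:R.
have e0 : 0 < e by rewrite divr_gt0.
have en (y : R) : 0 <= y -> (y ^+ n) `^ e = y ^+ 2.
  by move=> y0; rewrite -powR_mulrn// -powRrM mulrCA divff ?gt_eqF// mulr1 powR_mulrn.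
have : ((2 * pi) ^+ n * k%:R) `^ e <= (V * (omega R n * (Num.sqrt L ^+ n * K_ R n))) `^ e.
  have l0 : 0 <= (2 * pi) ^+ n * k%:R :> R.
    by apply: mulr_ge0; [apply: exprn_ge0; exact: ltW|exact: ltW].
  apply: (ge0_ler_powR (ltW e0)) => //.
  exact: le_trans l0 H.
have s0 : 0 <= Num.sqrt L ^+ n by rewrite exprn_ge0// sqrtr_ge0.
have p0 : 0 <= (2 * pi) ^+ n :> R by rewrite exprn_ge0// ltW.
have Kge := ltW K0; have wge := ltW w0; have Vge := ltW V0; have kge := ltW kR0.
have sK0 : 0 <= Num.sqrt L ^+ n * K_ R n by exact: mulr_ge0.
have wsK0 : 0 <= omega R n * (Num.sqrt L ^+ n * K_ R n) by exact: mulr_ge0.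
rewrite (powRM e p0 kge) (powRM e Vge wsK0) (powRM e wge sK0) (powRM e s0 Kge).
rewrite !en ?sqrtr_ge0 ?(ltW P0)// sqr_sqrtr ?(ltW L0)// => H2.
rewrite /c_ /weyl_constant -/e !powRN.
have Ke : 0 < K_ R n `^ e by rewrite powR_gt0.
have We : 0 < omega R n `^ e by rewrite powR_gt0.
have Ve : 0 < V `^ e by rewrite powR_gt0.
move: H2; move: (K_ R n `^ e) Ke (omega R n `^ e) We (V `^ e) Ve => Ke Kp We Wp Ve Vp H2.
rewrite -(ler_pM2r (_ : 0 < Ve * (We * Ke))); last by rewrite !mulr_gt0.
have -> : Ke^-1 * ((2 * pi) ^+ 2 * We^-1) * Ve^-1 * k%:R `^ e * (Ve * (We * Ke)) =
    (2 * pi) ^+ 2 * k%:R `^ e by field; rewrite !gt_eqF.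
have <- // : Ve * (We * (L * Ke)) = L * (Ve * (We * Ke)) by ring.
Qed.
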